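(* For every integer $t\ge 2$, the family $\mathcal K^{M^3_t}_{3t}$ is degree-stable with respect to $\mathfrak K^3_{3t-1}$, the family $\mathcal K^{L^3_t}_{2t+1}$ is degree-stable with respect to $\mathfrak K^3_{2t}$, and the family $\mathcal K^{L^4_t}_{3t+1}$ is degree-stable with respect to $\mathfrak K^4_{3t}$.
   Context: An $r$-graph is a finite $r$-uniform hypergraph $\mathcal H$, identified with its edge set, with vertex set $V(\mathcal H)$ and $v(\mathcal H)=|V(\mathcal H)|$; $\delta(\mathcal H)$ is its minimum vertex degree (the degree of a vertex is the number of edges containing it). For a family $\mathcal F$ of $r$-graphs, $\mathcal H$ is $\mathcal F$-free if it contains no member of $\mathcal F$ as a (not necessarily induced) subgraph; $\mathrm{ex}(n,\mathcal F)$ is the maximum number of edges of an $\mathcal F$-free $r$-graph on $n$ vertices, and $\pi(\mathcal F)=\lim_{n\to\infty}\mathrm{ex}(n,\mathcal F)/\binom nr$. $M^3_t$ is the $3$-graph on $3t$ vertices consisting of $t$ pairwise disjoint edges. $L^r_t$ is the $r$-graph on $(r-1)t+1$ vertices consisting of $t$ edges having one vertex $v$ in common and such that $E\cap E'=\{v\}$ for all distinct edges $E,E'$. Weak expansions: for an $r$-graph $F$ on $m$ vertices, let $\partial_{r-2}F$ be the graph on $V(F)$ whose edges are the pairs of vertices contained in a common edge of $F$. Then $\mathcal K^F_m$ is the set of all $r$-graphs of the form $F\cup\{S_{uv} : uv\in\binom{V(F)}{2}\setminus\partial_{r-2}F\}$, where for every pair $uv$ of vertices of $F$ not covered by an edge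 of $F$, $S_{uv}$ is an $r$-set containing $u$ and $v$ (its other vertices may be arbitrary, inside or outside $V(F)$, and the sets $S_{uv}$ may overlap or coincide). An $r$-graph $\mathcal H$ is a blowup of an $r$-graph $G$ if there is a map $\psi\colon V(\mathcal H)\to V(G)$ (not necessarily surjective) such that for every $r$-subset $E$ of $V(\mathcal H)$ one has $E\in\mathcal H\iff\psi(E)\in G$. $K^r_\ell$ is the complete $r$-graph on $\ell$ vertices and $\mathfrak K^r_\ell$ is the class of all blowups of $K^r_\ell$. A family $\mathcal F$ is degree-stable with respect to a class $\mathfrak H$ of $\mathcal F$-free $r$-graphs if there exist $\epsilon>0$ and $N_0$ such that every $\mathcal F$-free $r$-graph $\mathcal H$ on $n\ge N_0$ vertices with $\delta(\mathcal H)\ge(\pi(\mathcal F)/(r-1)!-\epsilon)n^{r-1}$ is a subgraph of some member of $\mathfrak H$. *)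

(* Defs.v *)
From HB Require Import structures.
From mathcomp Require Import all_boot all_order all_algebra.
From mathcomp Require Import all_classical all_reals all_analysis.

Set Implicit Arguments.
Unset Strict Implicit.
Unset Printing Implicit Defensive.

Import Order.TTheory GRing.Theory Num.Theory.
Import numFieldNormedType.Exports.

Local Open Scope ring_scope.

Definition uniform_edges (r : nat) (V : finType) (E : {set {set V}}) : bool :=
  [forall e in E, #|e| == r].

Record hypergraph (r : nat) (V : finType) := Hypergraph {
  edges :> {set {set V}};
  _ : uniform_edges r edges }.

HB.instance Definition _ r V := [isSub for @edges r V].
HB.instance Definition _ r V := [Countable of hypergraph r V by <:].
HB.instance Definition _ r V := [Finite of hypergraph r V by <:].

(* Families and classes may have members on arbitrary finite vertex sets. *)
Definition hfamily (r : nat) := forall V : finType, hypergraph r V -> Prop.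

Definition is_subgraph r (V W : finType) (G : hypergraph r V) (H : hypergraph r W) : Prop :=
  exists2 f : V -> W, injective f & forall e, e \in edges G -> f @: e \in edges H.

Definition hfree r (F : hfamily r) (W : finType) (H : hypergraph r W) : Prop :=
  forall (V : finType) (G : hypergraph r V), F V G -> ~ is_subgraph G H.

Definition vertex_degree r (V : finType) (H : hypergraph r V) (v : V) : nat :=
  #|[set e in edges H | v \in e]|.

(* No degree exceeds the number of edges, so the default value of the iterated
   minimum only matters when there are no vertices. *)
Definition min_degree r (V : finType) (H : hypergraph r V) : nat :=
  \big[minn/#|edges H|]_(v : V) vertex_degree H v.

Definition ex_number r (n : nat) (F : hfamily r) : nat :=
  \max_(H : hypergraph r 'I_n | `[< hfree F H >]) #|edges H|.

(* The limit exists for every family, by monotonicity of the quotients for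
   r <= n. *)
Definition turan_density (R : realType) r (F : hfamily r) : R :=
  lim ((fun n : nat => (ex_number n F)%:R / 'C(n, r)%:R : R) @ \oo)%classic.

Definition degree_stable (R : realType) r (F C : hfamily r) : Prop :=
  (forall (W : finType) (G : hypergraph r W), C W G -> hfree F G) /\
  exists (eps : R) (N0 : nat), 0 < eps /\
    forall (V : finType) (H : hypergraph r V),
      (N0 <= #|V|)%N ->
      hfree F H ->
      (turan_density R F / ((r - 1)`!)%:R - eps) * #|V|%:R ^+ (r - 1)
        <= (min_degree H)%:R ->
      exists (W : finType) (G : hypergraph r W), C W G /\ is_subgraph H G.

(* Unordered pairs are two-element sets. *)
Definition shadow_graph r (V : finType) (F : hypergraph r V) : {set {set V}} :=
  [set p : {set V} | (#|p| == 2%N) && [exists e in edges F, p \subset e]].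

Definition uncovered_pairs r (V : finType) (F : hypergraph r V) : {set {set V}} :=
  [set p : {set V} | #|p| == 2%N] :\: shadow_graph F.

(* The map i places a copy of V(F) in W, so the family is closed under
   isomorphism; the last condition excludes vertices of W outside V(F) and all
   the S_uv. *)
Definition weak_expansions r (V : finType) (F : hypergraph r V) : hfamily r :=
  fun (W : finType) (G : hypergraph r W) =>
    exists (i : V -> W) (S : {set V} -> {set W}),
      [/\ injective i,
          forall p, p \in uncovered_pairs F -> #|S p| = r /\ i @: p \subset S p,
          edges G = [set i @: e | e : {set V} in edges F]
                      :|: [set S p | p in uncovered_pairs F] &
          [set: W] = i @: [set: V] :|: \bigcup_(p in uncovered_pairs F) S p].

Definition is_blowup r (U W : finType) (G : hypergraph r U) (H : hypergraph r W) : Prop :=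
  exists psi : W -> U,
    forall e : {set W}, #|e| = r -> (e \in edges H) <-> (psi @: e \in edges G).

Lemma complete_uniform r l : uniform_edges r [set e : {set 'I_l} | #|e| == r].
Proof. by apply/forall_inP => e; rewrite inE. Qed.

Definition complete_hypergraph r l : hypergraph r 'I_l := Hypergraph (complete_uniform r l).

Definition blowups_complete r l : hfamily r :=
  fun (W : finType) (H : hypergraph r W) => is_blowup (complete_hypergraph r l) H.
Arguments blowups_complete : clear implicits.

Lemma matching_uniform r t :
  uniform_edges r [set [set (i, j) | j : 'I_r] | i : 'I_t].
Proof.
apply/forall_inP => _ /imsetP[i _ ->].
by rewrite card_imset ?card_ord // => j k [].
Qed.

Definition matching r t : hypergraph r ('I_t * 'I_r)%type :=
  Hypergraph (matching_uniform r t).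

Lemma linear_star_uniform r t :
  uniform_edges r.+1 [set None |: [set Some (i, j) | j : 'I_r] | i : 'I_t].
Proof.
apply/forall_inP => _ /imsetP[i _ ->].
rewrite cardsU1 card_imset; last by move=> j k [].
by rewrite card_ord; case: imsetP => // -[].
Qed.

(* t edges of size r + 1 meeting pairwise exactly in the centre None: this is
   L^{r+1}_t, on r t + 1 vertices. *)
Definition linear_star r t : hypergraph r.+1 (option ('I_t * 'I_r)) :=
  Hypergraph (linear_star_uniform r t).

(* Main.v *)
(* Let lam q r = C(q, r) / q^r be the Lagrangian of the complete r-graph on q
   vertices, where F is the forbidden r-graph and q + 1 is its order. A
   hypergraph is free of the weak expansions of F only if no core (a set of
   pairwise covered vertices) carries a copy of F. Blowups give
   turan_density >= r! lam, so the degree hypothesis says that, at the uniform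
   weights, all partial derivatives of the Lagrangian polynomial are at least
   r lam - eps. Moving weight between uncovered vertices in small steps, without
   ever decreasing the polynomial, leads to weights supported by a core, where
   the stability of the Lagrangian of F-free r-graphs forces a complete r-graph
   on q vertices. Its vertices are coloured with q colours; going back along the
   steps, the colouring of the vertices of large derivative extends from each
   step to the previous one, and at the uniform weights all vertices are such.

   Stability of the Lagrangian for matchings comes from shifting: in a shifted
   family either the two lightest vertices are uncovered and can be merged, or
   deleting the heaviest vertex lowers the matching number. For linear stars,
   consider the link of the heaviest vertex at a maximum of the polynomial: it
   has no large matching. If that weight is almost 1/q, the result for matchings
   applies to the link; otherwise a bound for matchings with capped weights
   contradicts the Lagrange multiplier condition. *)

(* The steps must be small because the colouring travels backwards: moving much weight at once could
   change the derivatives so much that a colouring of the vertices good after the move says nothing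
   about those good before it. With steps of at most [eta], the weights restricted to the vertices
   good on both sides keep mass 1 - O(eta) and nearly the same derivatives. This needs vertices of
   low derivative to be light at every near-optimal weight: shrinking them by mass [eta] would
   otherwise exceed the Lagrangian bound, by a second-order term.

   Comparison with the blowup is made on one transversal. Missing edges have small total weight, and
   one vertex per class can be chosen, keeping the class masses, without increasing it; if all
   chosen weights are bounded below, none of the edges counted is missing.

   Uniformity at most 3 for matchings, hence 4 for stars, is used when shifting: an edge through the
   heaviest and the two lightest vertices has no further vertex. *)
From mathcomp Require Import all_boot all_order all_algebra all_fingroup.
From mathcomp Require Import ring lra zify.

Set Implicit Arguments.
Unset Strict Implicit.
Unset Printing Implicit Defensive.

Import Order.TTheory GRing.Theory Num.Theory.

Local Open Scope ring_scope.

(** * Lagrangian polynomials *)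

Section Polynomials.
Variables (R : realFieldType) (V : finType).
Implicit Types (g : {set V} -> R) (x y : V -> R) (E : {set {set V}}).
Implicit Types (u v : V) (e X : {set V}).

Definition mon x e : R := \prod_(i in e) x i.
(** Squarefree monomials make [pol g] multilinear; [dpol] is its partial derivative and [ddpol] its
    mixed second derivative. The coefficients are arbitrary because negated and combined edge
    weights occur below. *)
Definition pol g x : R := \sum_(e : {set V}) g e * mon x e.
Definition dpol g v x : R := \sum_(e : {set V} | v \in e) g e * mon x (e :\ v).
Definition ddpol g u v x : R :=
  \sum_(e : {set V} | (u \in e) && (v \in e)) g e * mon x (e :\ u :\ v).
Definition ind E e : R := (e \in E)%:R.
Definition mv x u v (h : R) i := if i == u then x u + h else if i == v then x v - h else x i.
Definition unif r g := forall e, g e != 0 -> #|e| = r.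
Definition nneg x := forall i, 0 <= x i.
Definition tot x : R := \sum_i x i.
Definition supp x : {set V} := [set i | x i != 0].

Lemma mon_eq x y e : {in e, x =1 y} -> mon x e = mon y e.
Proof. by move=> xy; apply: eq_bigr => i /xy. Qed.

Lemma monD1 x v e : v \in e -> mon x e = x v * mon x (e :\ v).
Proof. by move=> ve; rewrite /mon (big_setD1 v). Qed.

Lemma mon_ge0 x e : nneg x -> 0 <= mon x e.
Proof. by move=> x0; apply: prodr_ge0 => i _. Qed.

Lemma mon_le x y e : nneg x -> (forall i, x i <= y i) -> mon x e <= mon y e.
Proof. by move=> x0 xy; apply: ler_prod => i _; rewrite x0 xy. Qed.

Lemma mon_eq0 x e i : i \in e -> x i = 0 -> mon x e = 0.
Proof. by move=> ie xi0; rewrite (monD1 _ ie) xi0 mul0r. Qed.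

Lemma mon_supp x e : mon x e != 0 -> e \subset supp x.
Proof.
move=> h; apply/subsetP => i ie; rewrite inE; apply: contraNneq h => /(mon_eq0 ie) ->.
by [].
Qed.

Lemma nneg_mv x u v h : nneg x -> 0 <= x u + h -> 0 <= x v - h -> nneg (mv x u v h).
Proof. by move=> x0 hu hv i; rewrite /mv; case: eqP => // _; case: eqP. Qed.

Lemma tot_mv x u v h : u != v -> tot (mv x u v h) = tot x.
Proof.
move=> uv; rewrite /tot (bigD1 u) // (bigD1 v) /=; last by rewrite eq_sym.
rewrite [RHS](bigD1 u) // [in RHS](bigD1 v) /=; last by rewrite eq_sym.
rewrite /mv eqxx eq_sym (negbTE uv) eqxx.
rewrite (eq_bigr x); first by ring.
by move=> i /andP[/negbTE -> /negbTE ->].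
Qed.

Lemma eq_pol g g' x : g =1 g' -> pol g x = pol g' x.
Proof. by move=> gg; apply: eq_bigr => e _; rewrite gg. Qed.

Lemma pol_eq g x y : (forall e, g e != 0 -> {in e, x =1 y}) -> pol g x = pol g y.
Proof.
move=> xy; apply: eq_bigr => e _; have [->|/xy/mon_eq ->//] := eqVneq (g e) 0.
by rewrite !mul0r.
Qed.

Lemma polE E x : pol (ind E) x = \sum_(e in E) mon x e.
Proof.
rewrite /pol big_mkcond [RHS]big_mkcond; apply: eq_bigr => e _; rewrite /ind.
by case: (e \in E); rewrite ?mul1r ?mul0r.
Qed.

Lemma pol_ge0 g x : nneg x -> (forall e, 0 <= g e) -> 0 <= pol g x.
Proof. by move=> x0 g0; apply: sumr_ge0 => e _; rewrite mulr_ge0 ?mon_ge0. Qed.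

Lemma ind_ge0 E e : 0 <= ind E e.
Proof. exact: ler0n. Qed.

Lemma pol_le g g' x : nneg x -> (forall e, g e <= g' e) -> pol g x <= pol g' x.
Proof. by move=> x0 gg; apply: ler_sum => e _; rewrite ler_wpM2r ?mon_ge0. Qed.

Lemma pol_le_supp g g' x :
  nneg x -> (forall e, e \subset supp x -> g e <= g' e) -> pol g x <= pol g' x.
Proof.
move=> x0 gg; apply: ler_sum => e _; have [h|h] := boolP (e \subset supp x).
  by rewrite ler_wpM2r ?mon_ge0 ?gg.
have -> : mon x e = 0 by apply: contraNeq h => /mon_supp.
by rewrite !mulr0.
Qed.

Lemma pol_eq_supp g g' x :
  nneg x -> (forall e, e \subset supp x -> g e = g' e) -> pol g x = pol g' x.
Proof.
by move=> x0 h; apply/le_anti/andP; split; apply: pol_le_supp => // e /h ->.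
Qed.

Lemma pol_mono g x y : nneg x -> (forall i, x i <= y i) -> (forall e, 0 <= g e) ->
  pol g x <= pol g y.
Proof. by move=> x0 xy g0; apply: ler_sum => e _; rewrite ler_wpM2l ?mon_le. Qed.

Lemma polD g g' x : pol (fun e => g e + g' e) x = pol g x + pol g' x.
Proof. by rewrite -big_split; apply: eq_bigr => e _; rewrite mulrDl. Qed.

Lemma polZ a g x : pol (fun e => a * g e) x = a * pol g x.
Proof. by rewrite mulr_sumr; apply: eq_bigr => e _; rewrite mulrA. Qed.

Lemma pol_scale r g a x : unif r g -> pol g (fun i => a * x i) = a ^+ r * pol g x.
Proof.
move=> gr; rewrite mulr_sumr; apply: eq_bigr => e _.
have [->|/gr er] := eqVneq (g e) 0; first by rewrite !mul0r mulr0.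
by rewrite /mon big_split prodr_const er /=; ring.
Qed.

Lemma unif_ind r E : (forall e, e \in E -> #|e| = r) -> unif r (ind E).
Proof. by move=> h e; rewrite /ind pnatr_eq0 eqb0 negbK => /h. Qed.

Lemma ddpol_ge0 g u v x : nneg x -> (forall e, 0 <= g e) -> 0 <= ddpol g u v x.
Proof. by move=> x0 g0; apply: sumr_ge0 => e _; rewrite mulr_ge0 ?mon_ge0. Qed.

Lemma dpol_le_supp v g g' x : nneg x ->
  (forall e, v \in e -> e :\ v \subset supp x -> g e <= g' e) -> dpol g v x <= dpol g' v x.
Proof.
move=> x0 gg; apply: ler_sum => e ve; have [h|h] := boolP (e :\ v \subset supp x).
  by rewrite ler_wpM2r ?mon_ge0 ?gg.
have -> : mon x (e :\ v) = 0 by apply: contraNeq h => /mon_supp.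
by rewrite !mulr0.
Qed.

(** By multilinearity the Taylor expansion along the move is exact and stops at degree two. *)
Lemma pol_mv g x u v h : u != v -> pol g (mv x u v h) =
  pol g x + h * (dpol g u x - dpol g v x) - h ^+ 2 * ddpol g u v x.
Proof.
move=> uv; rewrite /pol /dpol /ddpol.
rewrite [X in h * (X - _)]big_mkcond [X in h * (_ - X)]big_mkcond.
rewrite [X in _ ^+ 2 * X]big_mkcond -sumrB !mulr_sumr -big_split -sumrB.
apply: eq_bigr => e _ /=.
have fix_ (f : {set V}) : u \notin f -> v \notin f -> mon (mv x u v h) f = mon x f.
  move=> uf vf; apply: mon_eq => i i_f; rewrite /mv.
  by case: eqP i_f uf => [->->//|_ i_f _]; case: eqP i_f vf => [->->//|].
have mvu : mv x u v h u = x u + h by rewrite /mv eqxx.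
have mvv : mv x u v h v = x v - h by rewrite /mv eq_sym (negbTE uv) eqxx.
have [ue|ue] := boolP (u \in e); have [ve|ve] := boolP (v \in e) => /=.
- have veu : v \in e :\ u by rewrite !inE eq_sym uv ve.
  have uev : u \in e :\ v by rewrite !inE uv ue.
  rewrite (monD1 _ ue) (monD1 _ veu) mvu mvv fix_ ?inE ?eqxx ?andbF //.
  rewrite [mon x e](monD1 _ ue) (monD1 x veu) (monD1 x uev).
  have -> : e :\ v :\ u = e :\ u :\ v by apply/setP => i; rewrite !inE andbCA.
  by ring.
- rewrite (monD1 _ ue) mvu fix_ ?inE ?eqxx ?(negbTE ve) ?andbF //.
  by rewrite [mon x e](monD1 _ ue); ring.
- rewrite (monD1 _ ve) mvv fix_ ?inE ?eqxx ?(negbTE ue) ?andbF //.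
  by rewrite [mon x e](monD1 _ ve); ring.
- by rewrite fix_ //; ring.
Qed.

Lemma pol_split g x v :
  pol g x = x v * dpol g v x + pol (fun e => if v \in e then 0 else g e) x.
Proof.
rewrite /pol (bigID (fun e => v \in e)) /= mulr_sumr; congr (_ + _).
  by apply: eq_bigr => e ve; rewrite (monD1 _ ve); ring.
rewrite big_mkcond; apply: eq_bigr => e _.
by case: (v \in e); rewrite ?mul0r.
Qed.

Definition link v g e := if v \in e then 0 else g (v |: e).

Lemma dpol_link g v x : dpol g v x = pol (link v g) x.
Proof.
rewrite /dpol /pol (bigID (fun e => v \in e) xpredT) /=.
rewrite [X in _ = X + _]big1 ?add0r; last first.
  by move=> e ve; rewrite /link ve mul0r.
rewrite (reindex_onto (fun e => v |: e) (fun e => e :\ v)) /=; last first.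
  by move=> e ve; rewrite setD1K.
apply: eq_big => [e|e /andP[_ /eqP he]].
  rewrite setU11 /=; apply/eqP/idP => [<-|ve]; first by rewrite !inE eqxx.
  by rewrite setU1K.
rewrite he /link.
by have -> : v \in e = false by rewrite -he !inE eqxx.
Qed.

Lemma euler r g x : unif r g -> \sum_i x i * dpol g i x = r%:R * pol g x.
Proof.
move=> gr; rewrite /dpol mulr_sumr.
transitivity (\sum_(i : V) \sum_(e : {set V}) if i \in e then g e * mon x e else 0).
  apply: eq_bigr => i _; rewrite mulr_sumr big_mkcond; apply: eq_bigr => e _.
  by case: ifP => // ie; rewrite (monD1 _ ie); ring.
rewrite exchange_big; apply: eq_bigr => e _.
rewrite -big_mkcond sumr_const.
have [->|/gr <-] := eqVneq (g e) 0; first by rewrite !mul0r mulr0 mul0rn.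
by rewrite mulr_natl.
Qed.

Lemma unif_link r v g : unif r.+1 g -> unif r (link v g).
Proof.
move=> gr e; rewrite /link; case: ifPn => [_|ve /gr]; first by rewrite eqxx.
by rewrite cardsU1 ve => -[].
Qed.

Lemma pol_unif0 g x : unif 0 g -> pol g x = g set0.
Proof.
move=> g0; rewrite /pol (bigD1 set0) //= /mon big_set0 mulr1 big1 ?addr0 // => e.
by have [->|/g0/cards0_eq ->] := eqVneq (g e) 0; rewrite ?mul0r ?eqxx.
Qed.

(** Induction on [r] through Euler's identity: each derivative is the polynomial of a link, whose
    coefficients are again at most 1. *)
Lemma pol_le_tot r g x : unif r g -> nneg x -> (forall e, g e <= 1) ->
  pol g x <= tot x ^+ r / r`!%:R.
Proof.
elim: r g => [|r IH] g gr x0 g1.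
  by rewrite pol_unif0 // fact0 expr0 divr1.
have r0 : 0 < r.+1%:R :> R by rewrite ltr0n.
rewrite -(ler_pM2l r0) -euler // factS natrM exprS.
have -> : r.+1%:R * (tot x * tot x ^+ r / (r.+1%:R * r`!%:R)) = tot x * (tot x ^+ r / r`!%:R).
  by field; rewrite -[1]/(1%:R) -natrD !pnatr_eq0 -lt0n fact_gt0.
rewrite [in X in _ <= X]/tot mulr_suml; apply: ler_sum => i _; apply: ler_wpM2l => //.
rewrite dpol_link; apply: IH => // [|e]; first exact: unif_link.
by rewrite /link; case: ifP.
Qed.

End Polynomials.

Arguments ind {R V}.

(** * Merging vertices that share no edge *)

Section Merging.
Variables (R : realFieldType) (V : finType).
Implicit Types (g : {set V} -> R) (x y : V -> R) (E : {set {set V}}).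
Implicit Types (u v : V) (e X : {set V}).

Lemma ddpol_eq0 g x u v :
  (forall e, u \in e -> v \in e -> e \subset u |: (v |: supp x) -> g e = 0) -> ddpol g u v x = 0.
Proof.
move=> h; apply: big1 => e /andP[ue ve].
have [he|he] := boolP (e \subset u |: (v |: supp x)); first by rewrite h ?mul0r.
suff -> : mon x (e :\ u :\ v) = 0 by rewrite mulr0.
apply: contraNeq he => /mon_supp/subsetP he; apply/subsetP => i ie.
have := he i; rewrite !inE ie andbT; case: (i == u); case: (i == v) => //=.
by apply.
Qed.

(** No monomial on the support contains both vertices, so the polynomial is linear along the move
    and all the weight can go to the vertex with the larger derivative. Coefficients may be
    negative, as [selection] applies this to the negated polynomial. *)
Lemma merge g x u v : nneg x -> u != v -> u \in supp x -> v \in supp x ->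
  (forall e, u \in e -> v \in e -> e \subset supp x -> g e = 0) ->
  exists a b, [/\ (a, b) = (u, v) \/ (a, b) = (v, u),
    nneg (mv x a b (x b)), supp (mv x a b (x b)) \subset supp x :\ b &
    pol g x <= pol g (mv x a b (x b))].
Proof.
move=> x0 uv us vs h.
have D0 a b : (a, b) = (u, v) \/ (a, b) = (v, u) -> ddpol g a b x = 0.
  move=> ab; apply: ddpol_eq0 => e ae be es; apply: h.
  - by case: ab ae be => -[-> ->].
  - by case: ab ae be => -[-> ->].
  - apply: subset_trans es _; apply/subsetP => i; rewrite !inE.
    by move: us vs; rewrite !inE => us vs; case: ab => -[-> ->] /or3P[/eqP ->|/eqP ->|].
have key a b : (a, b) = (u, v) \/ (a, b) = (v, u) -> dpol g b x <= dpol g a x ->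
  [/\ nneg (mv x a b (x b)), supp (mv x a b (x b)) \subset supp x :\ b &
    pol g x <= pol g (mv x a b (x b))].
  move=> ab le_ba; have ab' : a != b by case: ab => -[-> ->] //; rewrite eq_sym.
  have as_ : a \in supp x by case: ab => -[-> _].
  split.
  - by apply: nneg_mv; rewrite ?subrr // addr_ge0.
  - apply/subsetP => i; rewrite !inE /mv.
    case: (eqVneq i a) => [->|ia]; first by rewrite inE in as_; rewrite ab' as_.
    by case: (eqVneq i b) => [->|ib] //; rewrite subrr eqxx.
  - by rewrite pol_mv // D0 // mulr0 subr0 lerDl mulr_ge0 ?subr_ge0.
have [le_vu|/ltW le_uv] := lerP (dpol g v x) (dpol g u x).
  by exists u, v; have [] := key u v (or_introl erefl) le_vu; split=> //; left.
by exists v, u; have [] := key v u (or_intror erefl) le_uv; split=> //; right.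
Qed.

(** Zykov symmetrisation: each merge empties a vertex, so the process stops, and it stops only when
    every pair in the support is covered by an edge inside the support. *)
Lemma zykov E x : nneg x -> exists x', [/\ nneg x', tot x' = tot x, supp x' \subset supp x,
  pol (ind E) x <= pol (ind E) x' &
  forall u v, u \in supp x' -> v \in supp x' -> u != v ->
    exists e, [/\ e \in E, e \subset supp x', u \in e & v \in e]].
Proof.
have [n] := ubnP #|supp x|; elim: n x => // n IH x; rewrite ltnS => xn x0.
have [/forall_inP cov|] := boolP [forall u in supp x, forall v in supp x,
  (u != v) ==> [exists e in E, [&& e \subset supp x, u \in e & v \in e]]].
  exists x; split=> // u v us vs uv.
  have /forall_inP/(_ v vs)/implyP/(_ uv)/exists_inP[e eE /and3P[? ? ?]] := cov u us.
  by exists e.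
rewrite negb_forall_in => /exists_inP[u us]; rewrite negb_forall_in => /exists_inP[v vs].
rewrite negb_imply negb_exists_in => /andP[uv /forall_inP hE].
have [|a [b [ab y0 ys le_xy]]] := @merge (ind E) x u v x0 uv us vs.
  move=> e ue ve es; rewrite /ind; case: (boolP (e \in E)) => // /hE.
  by rewrite es ue ve.
have bs : b \in supp x by case: ab => -[_ ->].
have ab' : a != b by case: ab => -[-> ->] //; rewrite eq_sym.
have [|//|z [z0 tz zs le_yz cov]] := IH (mv x a b (x b)).
  apply: leq_trans xn; apply: leq_ltn_trans (subset_leq_card ys) _.
  by rewrite [X in (_ < X)%N](cardsD1 b) bs.
exists z; split=> //; first by rewrite tz tot_mv.
  by apply: subset_trans zs _; apply: subset_trans ys _; rewrite subD1set.
exact: le_trans le_yz.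
Qed.

(** Two vertices of one colour share no monomial on the support, so merging them inside their class,
    for the negated polynomial, never increases [pol g]. This is the deterministic form of choosing
    a random vertex in each class. *)
Lemma selection (K : eqType) (col : V -> K) g x : nneg x ->
  (forall e, e \subset supp x -> g e != 0 -> {in e &, injective col}) ->
  exists x', [/\ nneg x', supp x' \subset supp x, {in supp x' &, injective col},
    forall k, \sum_(i | col i == k) x' i = \sum_(i | col i == k) x i &
    pol g x' <= pol g x].
Proof.
have [n] := ubnP #|supp x|; elim: n x => // n IH x; rewrite ltnS => xn x0 rb.
have [/forall_inP inj|] := boolP [forall u in supp x, forall v in supp x,
  (col u == col v) ==> (u == v)].
  exists x; split=> // u v us vs /eqP uv.
  by have /forall_inP/(_ v vs)/implyP/(_ uv)/eqP := inj u us.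
rewrite negb_forall_in => /exists_inP[u us]; rewrite negb_forall_in => /exists_inP[v vs].
rewrite negb_imply => /andP[/eqP cuv uv].
have [|a [b [ab y0 ys le_xy]]] := @merge (fun e => -1 * g e) x u v x0 uv us vs.
  move=> e ue ve es; suff -> : g e = 0 by rewrite mulr0.
  by apply: contra_neq_eq uv => /(rb e es) /(_ u v ue ve cuv).
have bs : b \in supp x by case: ab => -[_ ->].
have as_ : a \in supp x by case: ab => -[-> _].
have ab' : a != b by case: ab => -[-> ->] //; rewrite eq_sym.
have cab : col a = col b by case: ab => -[-> ->].
have yx : supp (mv x a b (x b)) \subset supp x.
  by apply: subset_trans ys _; rewrite subD1set.
have [|//||z [z0 zs inj mass le_yz]] := IH (mv x a b (x b)).
- apply: leq_trans xn; apply: leq_ltn_trans (subset_leq_card ys) _.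
  by rewrite [X in (_ < X)%N](cardsD1 b) bs.
- by move=> e es; apply: rb; apply: subset_trans es yx.
exists z; split=> //; first exact: subset_trans zs yx.
  move=> k; rewrite mass; case: (eqVneq (col a) k) => [ak|ak]; last first.
    apply: eq_bigr => i /eqP ik; rewrite /mv.
    case: eqP => [ia|_]; first by rewrite -ik ia eqxx in ak.
    by case: eqP => // ib; rewrite -ik ib cab eqxx in ak.
  rewrite (bigD1 a) ?ak ?eqxx // (bigD1 b) /=; last by rewrite -cab ak eqxx eq_sym.
  rewrite [RHS](bigD1 a) ?ak ?eqxx // [in RHS](bigD1 b) /=; last by rewrite -cab ak eqxx eq_sym.
  rewrite /mv eqxx [b == a]eq_sym (negbTE ab') eqxx.
  rewrite (eq_bigr x); first by ring.
  by move=> i /andP[/andP[_ /negbTE ->] /negbTE ->].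
by apply: le_trans le_yz _; move: le_xy; rewrite !polZ !mulN1r lerN2.
Qed.

End Merging.

(** * Elementary symmetric polynomials and Maclaurin's inequality *)

Section Complete.
Variables (R : realFieldType) (V : finType).
Implicit Types (x y : V -> R) (X : {set V}) (i j v : V).

(** Its polynomial is the elementary symmetric polynomial of degree [r] in the weights on [X],
    whence the notation [e_]. *)
Definition full X r : {set {set V}} := [set e : {set V} | (e \subset X) && (#|e| == r)].
Notation e_ X r := (pol (ind (full X r))).

Lemma unif_full X r : unif r (ind (full X r) : {set V} -> R).
Proof. by apply: unif_ind => e; rewrite inE => /andP[_ /eqP]. Qed.

Lemma full0 X x : e_ X 0 x = 1.
Proof. by rewrite pol_unif0 /ind ?inE ?sub0set ?cards0 //; exact: unif_full. Qed.

Lemma full_ge0 X r x : nneg x -> 0 <= e_ X r x.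
Proof. by move=> x0; apply: pol_ge0 => // e; exact: ind_ge0. Qed.

Lemma full_eq X r x y : {in X, x =1 y} -> e_ X r x = e_ X r y.
Proof.
move=> xy; apply: pol_eq => e; rewrite /ind pnatr_eq0 eqb0 negbK inE => /andP[/subsetP eX _].
by move=> i /eX /xy.
Qed.

Lemma link_full X r v : v \in X -> link v (ind (full X r.+1) : _ -> R) =1 ind (full (X :\ v) r).
Proof.
move=> vX e; rewrite /link /ind !inE subsetD1; case: ifPn => ve; first by rewrite andbF.
by rewrite subUset sub1set vX cardsU1 ve andbT.
Qed.

Lemma full_peel X r v x : v \in X -> e_ X r.+1 x = x v * e_ (X :\ v) r x + e_ (X :\ v) r.+1 x.
Proof.
move=> vX; rewrite (pol_split _ _ v) dpol_link (eq_pol _ (link_full r vX)).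
congr (_ + _); apply: eq_pol => e; rewrite /ind !inE subsetD1.
by case: (v \in e); rewrite ?andbF ?andbT.
Qed.

Lemma full_dpol X r v x : nneg x -> dpol (ind (full X r.+1)) v x <= e_ X r x.
Proof.
move=> x0; rewrite dpol_link; apply: pol_le => // e; rewrite /link /ind; case: ifPn => ve; first exact: ler0n.
rewrite ler_nat !inE subUset cardsU1 ve /= add1n eqSS.
by case: (e \subset X); rewrite ?andbF ?andbT //; case: eqP; case: (_ \subset _).
Qed.

Lemma dpol_out X r v x : v \notin X -> dpol (ind (full X r)) v x = 0.
Proof.
move=> vX; apply: big1 => e ve; rewrite /ind inE.
by case: subsetP => [/(_ v ve)|]; rewrite ?(negbTE vX) ?mul0r.
Qed.

Lemma full_step X r x : nneg x -> e_ X r.+1 x <= (\sum_(i in X) x i) * e_ X r x.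
Proof.
move=> x0; apply: (@le_trans _ _ (r.+1%:R * e_ X r.+1 x)).
  by rewrite ler_peMl ?full_ge0 // ler1n.
rewrite -euler; last exact: unif_full.
rewrite (bigID (mem X)) /= [X in _ + X]big1 ?addr0; last first.
  by move=> i iX; rewrite dpol_out ?mulr0.
by rewrite mulr_suml; apply: ler_sum => i iX; rewrite ler_wpM2l ?full_dpol.
Qed.

(** Peeling off both vertices shows that their weights enter only through their product and their
    sum; at fixed sum the polynomial grows with the product. *)
Lemma full_quad X r i j x : nneg x -> i != j -> i \in X -> j \in X -> exists A B C,
  [/\ 0 <= A, 0 <= B, 0 <= C &
  forall y, (forall k, k != i -> k != j -> y k = x k) ->
    e_ X r y = y i * y j * A + (y i + y j) * B + C].
Proof.
move=> x0 ij iX jX; pose Y := X :\ i :\ j.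
have jXi : j \in X :\ i by rewrite !inE eq_sym ij jX.
have eY s y : (forall k, k != i -> k != j -> y k = x k) -> e_ Y s y = e_ Y s x.
  by move=> yx; apply: full_eq => k; rewrite !inE => /and3P[kj ki _]; exact: yx.
case: r => [|[|r]].
- by exists 0, 0, 1; split=> // y _; rewrite full0; ring.
- exists 0, 1, (e_ Y 1 x); split=> // [|y /eY yx]; first exact: full_ge0.
  by rewrite (full_peel _ _ iX) (full_peel _ _ jXi) !full0 yx; ring.
exists (e_ Y r x), (e_ Y r.+1 x), (e_ Y r.+2 x); split; rewrite ?full_ge0 // => y /eY yx.
by rewrite (full_peel _ _ iX) !(full_peel _ _ jXi) !yx; ring.
Qed.

Lemma full_const X r x a : {in X, forall i, x i = a} -> e_ X r x = 'C(#|X|, r)%:R * a ^+ r.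
Proof.
move=> xa; rewrite polE (eq_bigr (fun=> a ^+ r)) ?sumr_const.
  rewrite -[LHS]mulr_natl; congr (_%:R * _); rewrite -cards_draws.
  by apply: eq_card => e; rewrite !inE.
move=> e; rewrite inE => /andP[/subsetP eX /eqP <-].
by rewrite -prodr_const; apply: eq_bigr => i /eX /xa.
Qed.

(** Smoothing towards the mean: with one weight above the mean [m] and another below, moving mass
    between them until the lower one equals [m] increases their product. The number of weights
    different from [m] drops each time. *)
Lemma maclaurin X r x : nneg x -> (0 < #|X|)%N ->
  e_ X r x <= 'C(#|X|, r)%:R * ((\sum_(i in X) x i) / #|X|%:R) ^+ r.
Proof.
move=> x0 X0; set m := _ / _.
have sm y : \sum_(i in X) (y i - m) = \sum_(i in X) y i - \sum_(i in X) x i.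
  rewrite sumrB sumr_const; congr (_ - _); rewrite -[LHS]mulr_natr /m mulfVK //.
  by rewrite pnatr_eq0 -lt0n.
have : \sum_(i in X) (x i - m) = 0 by rewrite sm subrr.
have [n] := ubnP #|[set i in X | x i != m]|.
clearbody m; clear sm; elim: n x x0 => // n IH x x0; rewrite ltnS => xn sx.
have [xm|] := boolP [forall i in X, x i == m].
  by rewrite (@full_const X r x m) // => i iX; apply/eqP; move/forall_inP: xm; exact.
rewrite negb_forall_in => /exists_inP[k kX kxm].
have [i iX xi] : exists2 i, i \in X & m < x i.
  apply/exists_inP; apply: contraNT kxm; rewrite negb_exists_in => /forall_inP h.
  have h' i : i \in X -> 0 <= m - x i by move=> /h; rewrite -leNgt subr_ge0.
  have : \sum_(i in X) (m - x i) = 0.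
    rewrite (eq_bigr (fun i => - (x i - m))) => [|i0 _]; last by rewrite opprB.
    by rewrite sumrN sx oppr0.
  by move/eqP; rewrite psumr_eq0 // => /allP/(_ k); rewrite mem_index_enum kX subr_eq0 eq_sym; apply.
have [j jX xj] : exists2 j, j \in X & x j < m.
  apply/exists_inP; apply: contraNT kxm; rewrite negb_exists_in => /forall_inP h.
  have h' j : j \in X -> 0 <= x j - m by move=> /h; rewrite -leNgt subr_ge0.
  by move/eqP: sx; rewrite psumr_eq0 // => /allP/(_ k); rewrite mem_index_enum kX subr_eq0; apply.
have ij : i != j by apply: contraTneq xi => ->; rewrite -leNgt ltW.
have [A [B [C [A0 _ _ h]]]] := full_quad r x0 ij iX jX.
pose y := mv x j i (m - x j).
have yi : y i = x i - (m - x j) by rewrite /y /mv (negbTE ij) eqxx.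
have yj : y j = m by rewrite /y /mv eqxx; ring.
have yk l : l != i -> l != j -> y l = x l by rewrite /y /mv => /negbTE -> /negbTE ->.
apply: (@le_trans _ _ (e_ X r y)).
  rewrite (h x) // (h y) // yi yj -subr_ge0.
  have -> : (x i - (m - x j)) * m * A + (x i - (m - x j) + m) * B + C -
    (x i * x j * A + (x i + x j) * B + C) = (x i - m) * (m - x j) * A by ring.
  by apply: mulr_ge0 => //; apply: mulr_ge0; rewrite subr_ge0 ltW.
apply: IH.
- apply: nneg_mv => //; first by rewrite addrC subrK (le_trans _ (ltW xj)).
  by rewrite opprB addrCA addr_ge0 // subr_ge0 ltW.
- apply: leq_trans xn; apply: proper_card; apply/properP; split.
    apply/subsetP => l; rewrite !inE => /andP[-> /=].
    have [->|lj] := eqVneq l j; first by rewrite yj eqxx.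
    have [->|li] := eqVneq l i; first by move=> _; rewrite gt_eqF.
    by rewrite yk.
  by exists j; rewrite !inE jX /= ?yj ?eqxx ?lt_eqF.
- rewrite -[RHS]sx (bigD1 i) //= (bigD1 j) ?jX 1?eq_sym //=.
  rewrite [RHS](bigD1 i) //= [in RHS](bigD1 j) ?jX 1?eq_sym //= yi yj.
  rewrite (eq_bigr (fun l => x l - m)); first by ring.
  by move=> l /andP[/andP[_ li] lj]; rewrite yk.
Qed.

End Complete.

Notation e_ X r := (pol (ind (full X r))).

(** * Lagrangians of complete hypergraphs and their stability *)

Section Lambda.
Variable R : realFieldType.

Definition lam q r : R := 'C(q, r)%:R / q%:R ^+ r.

Lemma lam_ge0 q r : 0 <= lam q r.
Proof. by rewrite divr_ge0 ?exprn_ge0 ?ler0n. Qed.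

Lemma lam_gt0 q r : (0 < q)%N -> (r <= q)%N -> 0 < lam q r.
Proof. by move=> q0 rq; rewrite divr_gt0 ?exprn_gt0 ?ltr0n ?bin_gt0. Qed.

Lemma lam_ffact q r : lam q r * r`!%:R = (q ^_ r)%:R / q%:R ^+ r.
Proof. by rewrite /lam mulrAC -natrM bin_ffact. Qed.

Lemma ffactq_le n q r : (0 < n)%N -> (n <= q)%N ->
  (n ^_ r)%:R / n%:R ^+ r <= (q ^_ r)%:R / q%:R ^+ r :> R.
Proof.
move=> n0 nq; elim: r => [|r IH]; first by rewrite !ffactn0 !expr0.
have h a : ((a ^_ r.+1)%:R / a%:R ^+ r.+1 : R) = (a ^_ r)%:R / a%:R ^+ r * ((a - r)%:R / a%:R).
  by rewrite ffactnSr natrM exprSr invfM; ring.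
have q0 : (0 < q)%N by exact: leq_trans nq.
rewrite !h ler_pM ?divr_ge0 ?exprn_ge0 ?ler0n //.
rewrite ler_pdivrMr ?ltr0n // mulrAC ler_pdivlMr ?ltr0n // -!natrM ler_nat.
by rewrite !mulnBl [(n * q)%N]mulnC leq_sub2l ?leq_mul2l ?nq ?orbT.
Qed.

Lemma lam_le n q r : (0 < n)%N -> (n <= q)%N -> lam n r <= lam q r.
Proof.
move=> n0 nq; rewrite -(@ler_pM2r _ r`!%:R) ?ltr0n ?fact_gt0 // !lam_ffact.
exact: ffactq_le.
Qed.

Lemma lam_lt n q r : (0 < n)%N -> (n < q)%N -> (2 <= r)%N -> (r <= q)%N -> lam n r < lam q r.
Proof.
move=> n0 nq r2 rq; rewrite -(@ltr_pM2r _ r`!%:R) ?ltr0n ?fact_gt0 // !lam_ffact.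
case: r r2 rq => // r r1 rq.
have h a : ((a ^_ r.+1)%:R / a%:R ^+ r.+1 : R) = (a ^_ r)%:R / a%:R ^+ r * ((a - r)%:R / a%:R).
  by rewrite ffactnSr natrM exprSr invfM; ring.
have q0 : (0 < q)%N by exact: leq_trans nq.
rewrite !h; apply: (@le_lt_trans _ _ ((q ^_ r)%:R / q%:R ^+ r * ((n - r)%:R / n%:R))).
  by rewrite ler_wpM2r ?ffactq_le ?divr_ge0 ?ler0n // ltnW.
rewrite ltr_pM2l; last by rewrite divr_gt0 ?exprn_gt0 ?ltr0n ?ffact_gt0 // ltnW.
rewrite ltr_pdivrMr ?ltr0n // mulrAC ltr_pdivlMr ?ltr0n // -!natrM ltr_nat.
have {}r1 : (0 < r)%N by lia.
by rewrite !mulnBl [(n * q)%N]mulnC; apply: ltn_sub2l; nia.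
Qed.

Lemma full_lam (V : finType) (X : {set V}) q r (x : V -> R) : nneg x -> (#|X| <= q)%N -> (0 < r)%N ->
  e_ X r x <= lam q r * (\sum_(i in X) x i) ^+ r.
Proof.
move=> x0 Xq r0; have s0 : 0 <= \sum_(i in X) x i by apply: sumr_ge0.
have [X0|X0] := posnP #|X|.
  have h : 0 <= lam q r * (\sum_(i in X) x i) ^+ r by apply: mulr_ge0; [exact: lam_ge0 | exact: exprn_ge0].
  rewrite polE big1 // => e; rewrite inE (cards0_eq X0) subset0.
  by case: eqP => // ->; rewrite cards0 eq_sym => /eqP re; rewrite re in r0.
apply: le_trans (maclaurin r x0 X0) _.
by rewrite exprMn exprVn mulrCA mulrC ler_wpM2r ?exprn_ge0 // lam_le.
Qed.

Lemma exists_ge_mean (V : finType) (X : {set V}) (x : V -> R) : (0 < #|X|)%N ->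
  exists2 i, i \in X & (\sum_(i in X) x i) / #|X|%:R <= x i.
Proof.
move=> X0; apply/exists_inP; apply: contraT; rewrite negb_exists_in => /forall_inP h.
move: h; set m := _ / _ => h.
have : \sum_(i in X) x i < \sum_(i in X) m.
  have [k kX] : exists k, k \in X by apply/card_gt0P.
  rewrite (bigD1 k) //= [ltRHS](bigD1 k) //=; apply: ltr_leD.
    by rewrite ltNge h.
  by apply: ler_sum => i /andP[iX _]; rewrite ltW // ltNge h.
rewrite sumr_const -[X in _ < X]mulr_natr /m mulfVK ?ltxx //.
by rewrite pnatr_eq0 -lt0n.
Qed.

(* If two weights differ, averaging them gains the square of their half
   difference times the elementary symmetric function of the other weights. *)
Lemma full_stability q r : (2 <= r)%N -> (r <= q)%N -> exists2 c : R, 0 < c &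
  forall (V : finType) (X : {set V}) (x : V -> R), nneg x -> \sum_(i in X) x i <= 1 ->
    (#|X| <= q)%N -> lam q r - c < e_ X r x ->
    #|X| = q /\ forall i, i \in X -> (2 * q%:R)^-1 <= x i.
Proof.
move=> r2 rq; have q0 : (0 < q)%N by lia.
have r0 : (0 < r)%N by lia.
have [r' r'E] : exists r', r = r'.+2 by exists (r - 2)%N; lia.
have q0R : 1 <= q%:R :> R by rewrite ler1n.
set l := lam q r; have l0 : 0 < l by apply: lam_gt0.
pose d := l - lam q.-1 r.
have d0 : 0 < d by rewrite subr_gt0 lam_lt //; lia.
(* [l / 4] forces total weight above 3/4, and [d] excludes fewer than [q] vertices. The first term
   is the square of 1/(8q) times l/2: a weight below 1/(2q) differs by more than 1/(4q) from one
   that is at least the mean, and the elementary symmetric function of the other weights exceeds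
   l/2. *)
pose c := Num.min (l / (128 * q%:R ^+ 2)) (Num.min d (l / 4)).
have c0 : 0 < c.
  have q2 : 0 < 128 * q%:R ^+ 2 :> R by apply: mulr_gt0 => //; apply: exprn_gt0; lra.
  by rewrite /c !lt_min d0 divr_gt0 // divr_gt0.
have c1 : c <= l / (128 * q%:R ^+ 2) by rewrite /c ge_min lexx.
have cd : c <= d by rewrite /c !ge_min lexx !orbT.
have c4 : c <= l / 4 by rewrite /c !ge_min lexx !orbT.
exists c => // V X x x0 s1 Xq lt_e.
have s0 : 0 <= \sum_(i in X) x i by apply: sumr_ge0.
have lt0 : 0 < l - c by move: c4 l0; clear; lra.
have Xq' : #|X| = q.
  apply/eqP; rewrite eqn_leq Xq leqNgt; apply/negP => lt_Xq.
  have : e_ X r x <= lam q.-1 r * 1.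
    apply: le_trans (full_lam x0 (_ : #|X| <= q.-1)%N r0) _; first by rewrite -ltnS prednK.
    by rewrite ler_wpM2l ?lam_ge0 // exprn_ile1.
  by move: cd lt_e; rewrite /d; clear; lra.
split=> // j jX; rewrite leNgt; apply/negP => xj.
set s := \sum_(i in X) x i in s0 s1.
have X0 : (0 < #|X|)%N by rewrite Xq'.
have s34 : 3 / 4 < s.
  have h : e_ X r x <= l * s.
    apply: le_trans (full_lam x0 Xq r0) _.
    apply: ler_wpM2l; first exact: ltW.
    by rewrite -/s -[leRHS]expr1 ler_wiXn2l.
  have : l * (3 / 4) < l * s by move: h lt_e c4; clear; lra.
  by rewrite ltr_pM2l.
have [i iX xi] := exists_ge_mean x X0; rewrite Xq' -/s in xi.
have qi : 0 < q%:R^-1 :> R by rewrite invr_gt0 ltr0n.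
have xij : (8 * q%:R)^-1 < (x i - x j) / 2.
  move: xj xi; rewrite !invfM; set z := q%:R^-1 in qi *; move: qi s34; clear; nra.
have xij0 : 0 < x i - x j.
  suff : 0 < (x i - x j) / 2 by rewrite pmulr_lgt0 // invr_gt0.
  by apply: lt_trans xij; rewrite invr_gt0 mulr_gt0 // ltr0n.
have ij : i != j by apply: contraTneq xij => ->; rewrite subrr mul0r -leNgt invr_ge0 mulr_ge0 ?ler0n.
pose Y := X :\ i :\ j; have jXi : j \in X :\ i by rewrite !inE eq_sym ij jX.
have le1 (Z : {set V}) : Z \subset X -> \sum_(i in Z) x i <= 1.
  move=> ZX; apply: le_trans s1; rewrite /s [leRHS](big_setID Z) /= (setIidPr ZX).
  by rewrite lerDl sumr_ge0.
have eY : e_ X r x <= e_ Y r' x.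
  have step (Z : {set V}) k m : k \in Z -> Z \subset X -> e_ Z m.+1 x <= e_ (Z :\ k) m x.
    move=> kZ ZX; rewrite (full_peel _ _ kZ) -[leRHS]mul1r.
    apply: (@le_trans _ _ ((\sum_(i in Z) x i) * e_ (Z :\ k) m x)).
      by rewrite (big_setD1 k kZ) /= mulrDl lerD2l full_step.
    by rewrite ler_wpM2r ?full_ge0 ?le1.
  rewrite r'E; apply: le_trans (step X i _ iX (subxx _)) _.
  exact: (step _ _ _ jXi (subD1set _ _)).
have [A [B [C [A0 B0 C0 h]]]] := full_quad r x0 ij iX jX.
pose dl := (x i - x j) / 2; pose y := mv x j i dl.
have yi : y i = x i - dl by rewrite /y /mv (negbTE ij) eqxx.
have yj : y j = x j + dl by rewrite /y /mv eqxx.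
have yk k : k != i -> k != j -> y k = x k by rewrite /y /mv => /negbTE -> /negbTE ->.
have y0 : nneg y.
  by apply: nneg_mv; rewrite /dl //; move: (x0 i) (x0 j) xij0; clear; lra.
have sy : \sum_(i in X) y i = s.
  rewrite (big_setD1 i iX) /= (big_setD1 j jXi) /= yi yj /s.
  rewrite (big_setD1 i iX) /= (big_setD1 j jXi) /= (eq_bigr x); first by ring.
  by move=> k; rewrite !inE => /and3P[kj ki _]; rewrite yk.
have gain : e_ X r y = e_ X r x + dl ^+ 2 * e_ Y r' x.
  have eYy s' : e_ Y s' y = e_ Y s' x.
    by apply: full_eq => k; rewrite !inE => /and3P[kj ki _]; exact: yk.
  rewrite r'E !(full_peel _ _ iX) !(full_peel _ _ jXi) !eYy yi yj /dl.
  by field.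
have le_y : e_ X r y <= l.
  apply: le_trans (full_lam y0 Xq r0) _.
  rewrite -[leRHS]mulr1; apply: ler_wpM2l; first exact: ltW.
  by rewrite sy exprn_ile1.
have dl2 : (8 * q%:R)^-1 ^+ 2 < dl ^+ 2.
  by rewrite ltrXn2r // ?invr_ge0 ?mulr_ge0 ?ler0n // ltW // divr_gt0.
have : (8 * q%:R)^-1 ^+ 2 * (l / 2) < c.
  apply: le_lt_trans (_ : dl ^+ 2 * e_ Y r' x < _); last first.
    by move: le_y lt_e; rewrite gain; clear; lra.
  apply: ler_pM; [exact: sqr_ge0 | by rewrite divr_ge0 // ltW | exact: ltW |].
  by move: eY lt_e c4 l0; clear; lra.
rewrite ltNge => /negP; apply; apply: le_trans c1 _.
rewrite le_eqVlt; apply/orP; left; apply/eqP; by field; rewrite pnatr_eq0 -lt0n.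
Qed.

End Lambda.

Lemma subset_between (V : finType) (A B : {set V}) n :
  A \subset B -> (#|A| <= n <= #|B|)%N ->
  exists e : {set V}, [/\ A \subset e, e \subset B & #|e| = n].
Proof.
elim: n => [|n IH] AB.
  by rewrite leqn0 cards_eq0 => /andP[/eqP A0 _]; exists set0; rewrite A0 !sub0set cards0.
move=> /andP[]; rewrite leq_eqVlt => /orP[/eqP An _|An nB]; first by exists A.
have [|e [Ae eB en]] := IH AB; first by rewrite -ltnS An ltnW.
have /properP[_ [v vB ve]] : e \proper B by rewrite properEcard eB en.
exists (v |: e); split; first exact: subset_trans Ae (subsetUr _ _).
  by rewrite subUset sub1set vB.
by rewrite cardsU1 ve en.
Qed.

Lemma ffact_leq_exp n k : (n ^_ k <= n ^ k)%N.
Proof.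
rewrite ffact_prod -[X in (_ <= _ ^ X)%N]card_ord -prod_nat_const.
by apply: leq_prod => i _; rewrite leq_subr.
Qed.

Section Estimates.
Variables (R : realFieldType) (V : finType).
Implicit Types (g : {set V} -> R) (x y : V -> R) (E : {set {set V}}) (P e : {set V}).

Lemma pol_le1 n g x : unif n g -> nneg x -> tot x <= 1 -> (forall e, g e <= 1) -> pol g x <= 1.
Proof.
move=> gn x0 x1 g1; apply: le_trans (pol_le_tot gn x0 g1) _.
have t0 : 0 <= tot x by apply: sumr_ge0.
rewrite ler_pdivrMr ?ltr0n ?fact_gt0 // mul1r.
by apply: (@le_trans _ _ 1); rewrite ?exprn_ile1 // ler1n fact_gt0.
Qed.

Lemma unif_ind_sub n E g : unif n g -> (forall e, e \in E -> g e != 0) -> unif n (ind E : _ -> R).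
Proof. by move=> gn h; apply: unif_ind => e /h /gn. Qed.

Lemma pol_le_cover g x P : nneg x -> (forall e, 0 <= g e) ->
  (forall e, e \subset supp x -> g e != 0 -> exists2 i, i \in P & i \in e) ->
  pol g x <= \sum_(i in P) x i * dpol g i x.
Proof.
move=> x0 g0 h; rewrite /dpol.
have -> : \sum_(i in P) x i * (\sum_(e : {set V} | i \in e) g e * mon x (e :\ i)) =
  \sum_(e : {set V}) \sum_(i in P) if i \in e then g e * mon x e else 0.
  rewrite exchange_big; apply: eq_bigr => i _.
  rewrite mulr_sumr big_mkcond; apply: eq_bigr => e _.
  by case: ifP => // ie; rewrite (monD1 _ ie); ring.
have t0 e i : 0 <= (if i \in e then g e * mon x e else 0).
  by case: ifP => // _; rewrite mulr_ge0 ?mon_ge0.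
apply: ler_sum => e _; have [m0|/mon_supp es] := eqVneq (mon x e) 0.
  by rewrite m0 mulr0; apply: sumr_ge0 => i _; rewrite ?m0 ?mulr0 if_same.
have [ge|/(h e es)[i iP ie]] := eqVneq (g e) 0.
  by rewrite ge mul0r; apply: sumr_ge0 => i _; rewrite ?mul0r if_same.
by rewrite (bigD1 i) //= ie lerDl sumr_ge0.
Qed.

(** The Weierstrass inequality prod (1 - t_i) >= 1 - sum t_i, multiplied by the monomial. *)
Lemma mon_shrink (t x : V -> R) (e : {set V}) : nneg x -> (forall i, 0 <= t i <= 1) ->
  mon x e - \sum_(i in e) t i * (x i * mon x (e :\ i)) <= mon (fun i => (1 - t i) * x i) e.
Proof.
move=> x0 t01.
have -> : \sum_(i in e) t i * (x i * mon x (e :\ i)) = (\sum_(i in e) t i) * mon x e.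
  by rewrite mulr_suml; apply: eq_bigr => i ie; rewrite [mon x e](monD1 _ ie).
have -> : mon (fun i => (1 - t i) * x i) e = mon (fun i => 1 - t i) e * mon x e.
  by rewrite /mon -big_split.
rewrite -{1}[mon x e]mul1r -mulrBl; apply: ler_wpM2r; first exact: mon_ge0.
suff : 0 <= mon (fun i => 1 - t i) e <= 1 /\ 1 - \sum_(i in e) t i <= mon (fun i => 1 - t i) e by case.
rewrite /mon; elim/big_rec2: _ => [|i p q ie [/andP[p0 p1] qp]]; first by rewrite subr0 ler01 !lexx.
by have /andP[t0 t1] := t01 i; split; last nra; apply/andP; split; nra.
Qed.

Lemma pol_homogeneous n g (l : R) : (0 < n)%N -> unif n g ->
  (forall x, nneg x -> tot x = 1 -> pol g x <= l) ->
  forall x, nneg x -> pol g x <= l * tot x ^+ n.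
Proof.
move=> n0 gn key x x0; have t0 : 0 <= tot x by apply: sumr_ge0.
have [tx|tx] := eqVneq (tot x) 0.
  rewrite tx expr0n gtn_eqF ?mulr0 //.
  rewrite /pol big1 // => e _; have [->|/gn en] := eqVneq (g e) 0; first by rewrite mul0r.
  have [i ie] : exists i, i \in e by apply/card_gt0P; rewrite en.
  rewrite (mon_eq0 ie) ?mulr0 //; apply/eqP; move/eqP: tx; rewrite /tot psumr_eq0 //.
  by move/allP/(_ i); rewrite mem_index_enum; apply.
have y0 : nneg (fun i => (tot x)^-1 * x i) by move=> i; rewrite mulr_ge0 ?invr_ge0.
have y1 : tot (fun i => (tot x)^-1 * x i) = 1 by rewrite /tot -mulr_sumr mulVf.
have := key _ y0 y1; rewrite (pol_scale _ _ gn) exprVn ler_pdivrMl //.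
  by rewrite mulrC.
by rewrite exprn_gt0 // lt_def tx.
Qed.

End Estimates.

(** * Degree stability *)

Section Shrink.
Variables (R : realFieldType) (V : finType).
Implicit Types (g : {set V} -> R) (x t : V -> R) (e : {set V}).

Lemma pol_shrink g t x : nneg x -> (forall e, 0 <= g e) -> (forall i, 0 <= t i <= 1) ->
  pol g x - \sum_i t i * (x i * dpol g i x) <= pol g (fun i => (1 - t i) * x i).
Proof.
move=> x0 g0 t01; rewrite /dpol.
have -> : \sum_i t i * (x i * \sum_(e : {set V} | i \in e) g e * mon x (e :\ i)) =
  \sum_(e : {set V}) g e * \sum_(i in e) t i * (x i * mon x (e :\ i)).
  under [RHS]eq_bigr => e _ do rewrite mulr_sumr big_mkcond.
  rewrite [RHS]exchange_big; apply: eq_bigr => i _.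
  rewrite 2!mulr_sumr big_mkcond; apply: eq_bigr => e _.
  by case: ifP => // ie; ring.
rewrite /pol -sumrB; apply: ler_sum => e _.
by rewrite -mulrBr ler_wpM2l ?mon_shrink.
Qed.

End Shrink.

Section Arithmetic.
Variable R : realFieldType.
Implicit Types (a l p : R).

Lemma exp1B_le n a : 0 <= a -> a <= 1 ->
  (1 - a) ^+ n <= 1 - n%:R * a + n%:R * (n%:R - 1) / 2 * a ^+ 2.
Proof.
move=> a0 a1; elim: n => [|n IH]; first by rewrite expr0; lra.
have : (1 - a) * (1 - a) ^+ n <= (1 - a) * (1 - n%:R * a + n%:R * (n%:R - 1) / 2 * a ^+ 2).
  by rewrite ler_wpM2l // subr_ge0.
move=> h; rewrite [leLHS]exprS; apply: le_trans h _; rewrite -natr1 -subr_ge0.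
case: n {IH} => [|n]; first by lra.
rewrite [leRHS](_ : _ = a ^+ 3 * (n.+1%:R * (n.+1%:R - 1) / 2)); last by field.
apply: mulr_ge0; first by rewrite exprn_ge0.
by rewrite -natr1 addrK divr_ge0 // mulr_ge0 // -?natr1 ?addr_ge0.
Qed.

(** The first-order terms n l a cancel. What remains is a^2 <= e + l n (n - 1) a^2 / 2, whose last
    term is at most a^2 / 2. *)
Lemma low_degree_arith (n l a p e : R) : 0 <= l -> l - e <= p + a * (n * l - a) ->
  p <= l * (1 - n * a + n * (n - 1) / 2 * a ^+ 2) -> l * (n * (n - 1)) <= 1 -> a ^+ 2 / 2 <= e.
Proof.
move=> l0 h1 h2 h3; have : l * (n * (n - 1)) * a ^+ 2 <= 1 * a ^+ 2 by rewrite ler_wpM2r ?sqr_ge0.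
have : l - e <= l * (1 - n * a + n * (n - 1) / 2 * a ^+ 2) + a * (n * l - a).
  exact: le_trans h1 (lerD h2 (lexx _)).
rewrite mul1r [a ^+ 2]expr2; lra.
Qed.

Lemma lam_small q r : (2 <= r <= q)%N -> lam R q r * (r%:R * (r%:R - 1)) <= 1.
Proof.
move=> /andP[r2 rq]; have q0 : (0 < q)%N by lia.
have h1 : lam R q r * (r`!)%:R <= 1.
  by rewrite lam_ffact ler_pdivrMr ?exprn_gt0 ?ltr0n // mul1r -natrX ler_nat ffact_leq_exp.
apply: le_trans h1; apply: ler_wpM2l; first exact: lam_ge0.
case: r r2 {rq} => [|[|n]] // _; rewrite -natr1 addrK natr1 -natrM ler_nat.
by rewrite !factS mulnA leq_pmulr ?fact_gt0.
Qed.

End Arithmetic.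

(** * Cores and admissible forbidden configurations *)

Definition restr (V : finType) (E : {set {set V}}) (X : {set V}) := [set e in E | e \subset X].

Definition link_set (V : finType) v (E : {set {set V}}) :=
  [set e : {set V} | (v \notin e) && (v |: e \in E)].

Definition clique (V : finType) (E : {set {set V}}) (X : {set V}) :=
  forall u v, u \in X -> v \in X -> u != v -> exists e, [/\ e \in E, u \in e & v \in e].

Definition complete_on (V : finType) r (E : {set {set V}}) (X : {set V}) :=
  forall e : {set V}, e \subset X -> #|e| = r -> e \in E.

Definition uniform (V : finType) r (E : {set {set V}}) := forall e, e \in E -> #|e| = r.

Definition forbids := forall V : finType, {set {set V}} -> Prop.

Definition core_free (Ff : forbids) (V : finType) (E : {set {set V}}) :=
  forall X, clique E X -> Ff V (restr E X).

Definition lagrangian_gap (R : realFieldType) (Ff : forbids) (r q : nat) (c : R) :=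
  forall (V : finType) (E : {set {set V}}) (T : {set V}) (x : V -> R),
    uniform r E -> (forall e, e \in E -> e \subset T) -> Ff V E -> clique E T ->
    nneg x -> supp x \subset T -> tot x = 1 -> lam R q r - c < pol (ind E) x ->
    exists2 K : {set V}, K \subset T & #|K| = q /\ complete_on r E K.

(* [Ff] is F-freeness for a fixed r-graph F with q + 1 vertices. *)
Record admissible (R : realFieldType) (Ff : forbids) (r q : nat) : Prop := Admissible {
  adm_pair : forall (V : finType) (E : {set {set V}}) (X : {set V}) u v, #|X| = q.+1 ->
    u \in X -> v \in X -> u != v ->
    (forall e : {set V}, e \subset X -> #|e| = r -> ~~ ((u \in e) && (v \in e)) -> e \in E) ->
    ~ Ff V (restr E X);
  adm_edge : forall (V : finType) (E : {set {set V}}) (C e : {set V}) a, #|C| = q -> complete_on r E C ->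
    e \in E -> #|e| = r -> ~~ (e \subset C) -> a \in C -> a \in e -> ~ Ff V (restr E (C :|: e));
  adm_lagrangian : exists2 c : R, 0 < c & lagrangian_gap Ff r q c }.

Section Basics.
Variables (R : realFieldType) (Ff : forbids) (r q : nat).
Hypotheses (adm : admissible R Ff r q) (r2 : (2 <= r)%N) (rq : (r < q)%N).
Variables (V : finType) (E : {set {set V}}).
Hypotheses (Er : uniform r E) (Ef : core_free Ff E).
Implicit Types (x : V -> R).

Lemma complete_clique (K : {set V}) : (r <= #|K|)%N -> complete_on r E K -> clique E K.
Proof.
move=> rK h u v uK vK uv.
have [||e [uve eK er]] := @subset_between V [set u; v] K r.
- by rewrite subUset !sub1set uK vK.
- by rewrite cards2 uv r2 rK.
exists e; split; first exact: h.
  by rewrite (subsetP uve) // !inE eqxx.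
by rewrite (subsetP uve) // !inE eqxx orbT.
Qed.

(** A vertex of [T] outside [K] is joined to [K] by an edge inside [T]; together with [K] this edge
    spans a core, which contradicts [adm_edge]. *)
Lemma clique_complete_eq (T K : {set V}) :
  (forall u v, u \in T -> v \in T -> u != v ->
    exists e, [/\ e \in E, e \subset T, u \in e & v \in e]) ->
  K \subset T -> #|K| = q -> complete_on r E K -> T = K.
Proof.
move=> cov KT Kq cK; apply/eqP; rewrite eqEsubset KT andbT; apply/subsetP => u uT.
apply/negPn/negP => uK.
have [a aK] : exists a, a \in K by apply/card_gt0P; rewrite Kq; lia.
have [|e [eE eT ue ae]] := cov u a uT (subsetP KT _ aK).
  by apply: contraNneq uK => ->.
apply: (adm_edge adm Kq cK eE (Er eE) _ aK ae).
  by apply/negP => /subsetP/(_ _ ue); rewrite (negbTE uK).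
apply: Ef => v w vX wX vw.
have XT : K :|: e \subset T by rewrite subUset KT eT.
by have [f [? _ ? ?]] := cov v w (subsetP XT _ vX) (subsetP XT _ wX) vw; exists f.
Qed.

Definition covered x := forall u v, u \in supp x -> v \in supp x -> u != v ->
  exists e, [/\ e \in E, e \subset supp x, u \in e & v \in e].

(** A covered support is a core, so [Ff] holds on it and the gap yields a complete set of [q]
    vertices; by [clique_complete_eq] this is the whole support. *)
Lemma covered_card (c : R) x : lagrangian_gap Ff r q c -> nneg x -> tot x = 1 -> covered x ->
  lam R q r - c < pol (ind E) x -> #|supp x| = q.
Proof.
move=> Hc x0 x1 cov lt.
have clT : clique E (supp x).
  by move=> u v us vs uv; have [e [? _ ? ?]] := cov u v us vs uv; exists e.
have [||||||||K KT [Kq cK]] := Hc V (restr E (supp x)) (supp x) x.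
- by move=> e; rewrite inE => /andP[/Er].
- by move=> e; rewrite inE => /andP[].
- exact: Ef.
- move=> u v us vs uv; have [e [eE es ue ve]] := cov u v us vs uv; exists e.
  by rewrite inE eE es.
- exact: x0.
- exact: subxx.
- exact: x1.
- rewrite (_ : pol _ x = pol (ind E) x) //; apply: pol_eq_supp => // e es.
  by rewrite /ind inE es andbT.
- rewrite (clique_complete_eq cov KT) // => e eK er.
  by have := cK e eK er; rewrite inE => /andP[].
Qed.

(** Symmetrising a counterexample turns its support into a core of exactly [q] vertices, where
    Maclaurin's inequality gives the bound. *)
Lemma core_free_lagrangian x : nneg x -> pol (ind E) x <= lam R q r * tot x ^+ r.
Proof.
apply: pol_homogeneous; [exact: ltnW | exact: unif_ind |] => y y0 y1.
rewrite leNgt; apply/negP => lt.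
have [y' [y'0 + _ le cov]] := zykov E y0; rewrite y1 => ty'.
have lt' : lam R q r < pol (ind E) y' by exact: lt_le_trans le.
have [c c0 Hc] := adm_lagrangian adm.
have qs : #|supp y'| = q by apply: (covered_card Hc) => //; apply: lt_trans lt'; rewrite ltrBlDr ltrDl.
have : pol (ind E) y' <= lam R q r * (\sum_(i in supp y') y' i) ^+ r.
  apply: le_trans (full_lam y'0 _ _); [|by rewrite qs|exact: ltnW].
  apply: pol_le_supp => // e es; rewrite /ind ler_nat inE es /=.
  by case: (boolP (e \in E)) => // /Er ->; rewrite eqxx.
suff -> : \sum_(i in supp y') y' i = 1 by rewrite expr1n mulr1 leNgt lt'.
rewrite -ty' /tot [RHS](bigID (mem (supp y'))) /= [X in _ + X]big1 ?addr0 //.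
by move=> i; rewrite inE negbK => /eqP.
Qed.

(* Scaling down the weights of low-degree vertices cannot push the polynomial
   above the Lagrangian bound. *)
Lemma low_degree_mass (x : V -> R) (eta eps : R) : nneg x -> tot x = 1 -> 0 < eta -> eta <= 1 ->
  eps < eta ^+ 2 / 2 -> lam R q r - eps <= pol (ind E) x ->
  \sum_(v | dpol (ind E) v x < r%:R * lam R q r - eta) x v <= eta.
Proof.
move=> x0 x1 eta0 eta1 epseta le_p.
pose B v := dpol (ind E) v x < r%:R * lam R q r - eta.
set b := \sum_(v | _) x v; rewrite leNgt; apply/negP => ltb.
have b0 : 0 < b by exact: lt_trans ltb.
pose th := eta / b; have th01 : 0 <= th <= 1.
  apply/andP; split; first by rewrite divr_ge0 ?ltW.
  by rewrite /th ler_pdivrMr // mul1r ltW.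
pose t v := if B v then th else 0 : R.
have t01 i : 0 <= t i <= 1 by rewrite /t; case: ifP; rewrite ?lexx ?ler01.
pose z i := (1 - t i) * x i.
have le_z : pol (ind E) x - _ <= pol (ind E) z := pol_shrink x0 (ind_ge0 R E) t01.
have z0 : nneg z by move=> i; rewrite mulr_ge0 // subr_ge0; have /andP[] := t01 i.
have tb : \sum_i t i * x i = eta.
  rewrite /t (eq_bigr (fun i => if B i then th * x i else 0)); last first.
    by move=> i _; case: ifP; rewrite ?mul0r.
  by rewrite -big_mkcond -mulr_sumr (_ : \sum_(i | B i) x i = b) // /th divfK // gt_eqF.
have tz : tot z = 1 - eta.
  by rewrite -x1 -tb /tot -sumrB; apply: eq_bigr => i _; rewrite /z; ring.
have := core_free_lagrangian z0; rewrite tz => le_z'.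
set l := lam R q r in le_p le_z' *.
have l0 : 0 <= l by exact: lam_ge0.
have le_s : \sum_i t i * (x i * dpol (ind E) i x) <= eta * (r%:R * l - eta).
  rewrite -{1}tb mulr_suml; apply: ler_sum => i _; rewrite -mulrA /t.
  case: ifP => Bi; last by rewrite !mul0r.
  apply: ler_wpM2l; first by case/andP: th01.
  by have := ler_wpM2l (x0 i) (ltW Bi).
have bern := exp1B_le r (ltW eta0) eta1.
have lr : l * (r%:R * (r%:R - 1)) <= 1 by apply: lam_small; rewrite r2 ltnW.
apply/negP: epseta; rewrite -leNgt; apply: (low_degree_arith l0 _ (le_trans le_z' (ler_wpM2l l0 bern)) lr).
by rewrite -lerBlDr; apply: le_trans le_z; apply: lerB.
Qed.

End Basics.

Section Arithmetic.
Variable R : realFieldType.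
Implicit Types (n l a t w p q : R).

Lemma density_arith n l a t p : 1 <= n -> 0 <= l -> l <= 1 -> 0 <= a -> 1 - 4 * a <= t ->
  0 <= n * l - 5 * a -> t * (n * l - 5 * a) <= n * p -> l - 10 * a <= p.
Proof.
move=> n1 l0 l1 a0 ta K0 h.
have h' : (1 - 4 * a) * (n * l - 5 * a) <= n * p by apply: le_trans h; rewrite ler_wpM2r.
have n0 : 0 < n by lra.
rewrite -(ler_pM2l n0); apply: le_trans h'.
have : 0 <= a * (n - 1) by rewrite mulr_ge0 // subr_ge0.
have : 0 <= n * (a * (1 - l)) by rewrite !mulr_ge0 ?subr_ge0 // ltW.
have : 0 <= a * a by rewrite mulr_ge0.
by lra.
Qed.

(** Here w is the mass of one class and p the derivative on it. The other classes already account
    for nearly all of n l, which leaves w p <= w n l + 9 a; dividing by w >= 1/(2q) gives 18 q a. *)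
Lemma class_arith n l a t w p q : 0 < q -> (2 * q)^-1 <= w -> 0 <= a -> 1 - 4 * a <= t ->
  0 <= n * l - 5 * a -> n * l <= 1 -> w * p + (t - w) * (n * l - 5 * a) <= n * l ->
  p <= n * l + 18 * q * a.
Proof.
move=> q0 wq a0 ta K0 l1 h; set K := n * l - 5 * a in K0 h.
have w0 : 0 < w by apply: lt_le_trans wq; rewrite invr_gt0 mulr_gt0.
have h1 : (1 - 4 * a - w) * K <= (t - w) * K by rewrite ler_wpM2r // lerD2r.
have h2 : a * K <= a by rewrite ler_piMr // /K; lra.
have h3 : w * p <= w * (n * l) + 9 * a.
  have : w * K = w * (n * l) - 5 * (w * a) by rewrite /K; ring.
  have : 0 <= w * a by rewrite mulr_ge0 // ltW.
  by rewrite /K in h h1 h2 *; nra.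
have qw : 1 <= 2 * q * w by rewrite mulrC -ler_pdivrMr ?div1r // mulr_gt0.
rewrite -(ler_pM2l w0); apply: le_trans h3 _; rewrite mulrDr lerD2l.
have : a * 1 <= a * (2 * q * w) by rewrite ler_wpM2l.
by lra.
Qed.

End Arithmetic.

Lemma uniform_link (V : finType) (E : {set {set V}}) k o : uniform k.+1 E ->
  uniform k (link_set o E).
Proof. by move=> Ek e; rewrite inE => /andP[oe /Ek]; rewrite cardsU1 oe add1n => -[]. Qed.

Section Families.
Variables (R : realFieldType) (V : finType).
Implicit Types (E : {set {set V}}) (x : V -> R) (g : {set V} -> R) (P e : {set V}).

Lemma polID E (P : pred {set V}) x : pol (ind E) x =
  pol (ind [set e in E | P e]) x + pol (ind [set e in E | ~~ P e]) x.
Proof.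
rewrite -polD; apply: eq_pol => e; rewrite /ind !inE.
by case: (e \in E); case: (P e); rewrite /= ?addr0 ?add0r.
Qed.

Lemma tot_supp x : \sum_(i in supp x) x i = tot x.
Proof.
rewrite /tot [RHS](bigID (mem (supp x))) /= [X in _ + X]big1 ?addr0 // => i.
by rewrite inE negbK => /eqP.
Qed.

Definition rainbow (K : eqType) (col : V -> K) (e : {set V}) :=
  [forall u in e, forall v in e, (col u == col v) ==> (u == v)].

Lemma rainbowP (K : eqType) (col : V -> K) (e : {set V}) :
  reflect {in e &, injective col} (rainbow col e).
Proof.
apply: (iffP forall_inP) => [h u v ue ve /eqP uv|h u ue].
  by have /forall_inP/(_ v ve)/implyP/(_ uv)/eqP := h u ue.
by apply/forall_inP => v ve; apply/implyP => /eqP /(h u v ue ve) ->.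
Qed.

Lemma class_single (K : eqType) (col : V -> K) x i : {in supp x &, injective col} ->
  i \in supp x -> \sum_(k | col k == col i) x k = x i.
Proof.
move=> inj is_; rewrite (bigD1 i) //= big1 ?addr0 // => k /andP[/eqP ki].
by apply: contraNeq => xk; apply/eqP; apply: inj => //; rewrite inE.
Qed.

Lemma dpol_indE E v x : dpol (ind E) v x = pol (ind (link_set v E)) x.
Proof.
rewrite dpol_link; apply: eq_pol => e; rewrite /link /ind inE.
by case: (v \in e).
Qed.

Lemma mon_ge (x : V -> R) e a : 0 <= a -> (forall i, i \in e -> a <= x i) -> a ^+ #|e| <= mon x e.
Proof.
move=> a0 h; rewrite -prodr_const; apply: ler_prod => i ie.
by rewrite a0 h.
Qed.

Lemma pol_ge_mon g x e : nneg x -> (forall e, 0 <= g e) -> g e * mon x e <= pol g x.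
Proof.
by move=> x0 g0; rewrite /pol (bigD1 e) //= lerDl sumr_ge0 // => f _; rewrite mulr_ge0 ?mon_ge0.
Qed.

Lemma pol_le_mon g x y : (forall e, 0 <= g e) ->
  (forall e, g e != 0 -> mon x e <= mon y e) -> pol g x <= pol g y.
Proof.
move=> g0 h; apply: ler_sum => e _; have [->|/h ?] := eqVneq (g e) 0; first by rewrite !mul0r.
by rewrite ler_wpM2l.
Qed.

Lemma pol_cone E x y u v : nneg x -> nneg y -> x u = 1 ->
  (forall i, i != u -> i != v -> x i <= y i) ->
  pol (ind [set e : {set V} | [&& u \in e, v \notin e & e :\ u \in E]]) x <= pol (ind E) y.
Proof.
move=> x0 y0 xu xy; rewrite (pol_split _ _ u) xu mul1r dpol_indE.
rewrite [X in _ + X]big1 ?addr0; last first.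
  by move=> e _; case: ifP => ue; rewrite /ind ?inE ?ue mul0r.
rewrite !polE [leLHS]big_mkcond [leRHS]big_mkcond; apply: ler_sum => e _; rewrite !inE.
case: ifP => [/and4P[ue _]|_]; last by case: ifP => // _; rewrite mon_ge0.
rewrite negb_or eq_sym => /andP[vu ve]; rewrite setU1K // => ->.
apply: ler_prod => i ie; rewrite x0 xy //; first by apply: contraNneq ue => <-.
by apply: contraNneq ve => <-.
Qed.

End Families.

(** For uniform [E] and [B] the whole vertex set, this says that [E] is contained in a blowup of the
    complete hypergraph on [q] vertices. *)
Definition colorable q (V : finType) (E : {set {set V}}) (B : {set V}) :=
  exists phi : V -> 'I_q,
    forall e : {set V}, e \in E -> e \subset B -> {in e &, injective phi}.

(** * Extending a colouring of the support to all vertices of large derivative *)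

Section Extension.
Variables (R : realFieldType) (Ff : forbids) (s q : nat).
Notation r := s.+2.
Hypotheses (adm : admissible R Ff r q) (rq : (r < q)%N).
Variables (V : finType) (E : {set {set V}}).
Hypotheses (Er : uniform r E) (Ef : core_free Ff E).
Variables (y : V -> R) (col : V -> 'I_q) (eta c1 : R) (A : {set V}).
Notation lm := (lam R q r).
Notation w0 := ((2 * q%:R)^-1 : R).
Hypotheses (y0 : nneg y) (y1 : tot y <= 1) (y4 : 1 - 4 * eta <= tot y) (eta0 : 0 <= eta).
Hypothesis (rb : forall e, e \in E -> e \subset supp y -> {in e &, injective col}).
Hypothesis (SA : supp y \subset A).
Hypothesis (deg : forall v, v \in A -> r%:R * lm - 5 * eta <= dpol (ind E) v y).
Hypothesis (stab : forall (W : finType) (X : {set W}) (x : W -> R), nneg x ->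
  \sum_(i in X) x i <= 1 -> (#|X| <= q)%N -> lm - 10 * eta <= e_ X r x ->
  #|X| = q /\ forall i, i \in X -> w0 <= x i).
Hypothesis (c10 : 0 < c1).
(** By [h1] the edges missed in [pair_free] weigh less than any r-set of vertices of weight at least
    [w0]. By [h2] the missing edges weigh less than [c1 ^+ r] times the derivative at any vertex of
    [A], as [missed_class] requires. *)
Hypothesis (h1 : 10 * eta + 2 * ((18 * q%:R + 5) * eta + c1) < w0 ^+ r).
Hypothesis (h2 : 10 * eta < c1 ^+ r * (r%:R * lm - 5 * eta)).
Implicit Types (e : {set V}) (v : V) (j : 'I_q).

Let q0 : (0 < q)%N. Proof. exact: leq_trans rq. Qed.
Let q0R : 0 < q%:R :> R. Proof. by rewrite ltr0n. Qed.
Let w00 : 0 < w0. Proof. by rewrite invr_gt0 mulr_gt0. Qed.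

Let K0 : 0 <= r%:R * lm - 5 * eta.
Proof.
rewrite leNgt; apply/negP => K0; have : 0 <= c1 ^+ r * (r%:R * lm - 5 * eta).
  by apply: le_trans (ltW h2); rewrite mulr_ge0.
by rewrite leNgt pmulr_rlt0 ?K0 // exprn_gt0.
Qed.

Let rl1 : r%:R * lm <= 1.
Proof.
have := @lam_small R q r; rewrite (ltnW rq) => /(_ isT).
have := lam_ge0 R q r; move: lm => l l0; apply: le_trans.
rewrite mulrA [l * _]mulrC ler_peMr ?mulr_ge0 //.
by rewrite -natr1 addrK ler1n.
Qed.

Let l1 : lm <= 1.
Proof. by apply: le_trans rl1; rewrite ler_peMl ?lam_ge0 // ler1n. Qed.

Lemma density_ge : lm - 10 * eta <= pol (ind E) y.
Proof.
apply: (@density_arith _ r%:R lm eta (tot y)) => //; first by rewrite ler1n.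
- exact: lam_ge0.
- rewrite -euler; last exact: unif_ind.
  rewrite mulr_suml; apply: ler_sum => i _.
  have [->|yi] := eqVneq (y i) 0; first by rewrite !mul0r.
  by rewrite ler_wpM2l // deg // (subsetP SA) // inE.
Qed.

(** The blowup with which [E] is compared inside the support: rainbow r-sets, rainbow sets avoiding
    class [j] (the links of that class), rainbow r-sets missing from [E], and sets missing from the
    link of [v] when [v] is put into class [j]. *)
Definition Rb := [set e in full (supp y) r | rainbow col e].
Definition Rj j n := [set e in full (supp y) n | rainbow col e && [forall i in e, col i != j]].
Definition Mis := [set e in Rb | e \notin E].
Definition Mv v j := [set e in Rj j s.+1 | v |: e \notin E].
Definition mass j := \sum_(i | col i == j) y i.

Lemma unif_Rb : unif r (ind Rb : _ -> R).
Proof. by apply: unif_ind => e; rewrite !inE => /andP[/andP[_ /eqP]]. Qed.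

Lemma tot_mass : tot y = \sum_j mass j.
Proof. exact: (partition_big col xpredT). Qed.

Lemma edge_Rb e : e \in E -> e \subset supp y -> e \in Rb.
Proof. by move=> eE es; rewrite !inE es (Er eE) eqxx; apply/rainbowP/rb. Qed.

(** Selecting one vertex per class turns the rainbow sets into r-subsets of at most [q] vertices
    that carry the class masses. Their polynomial is at most [lm] and, edges in the support being
    rainbow, at least [lm - 10 * eta]; stability then bounds each class mass from below. *)
Lemma Rb_selection : pol (ind Rb) y <= lm /\ forall j, w0 <= mass j.
Proof.
have [|z [z0 zs inj ms le_z]] := selection (col := col) (g := fun e => -1 * ind Rb e) y0.
  move=> e _; rewrite mulf_eq0 negb_or => /andP[_].
  by rewrite /ind pnatr_eq0 eqb0 negbK !inE => /andP[_ /rainbowP].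
have {}le_z : pol (ind Rb) y <= pol (ind Rb) z.
  by move: le_z; rewrite !polZ !mulN1r lerN2.
have {}le_z : pol (ind Rb) y <= e_ (supp z) r z.
  apply: le_trans le_z _; apply: pol_le_supp => // e es; rewrite /ind ler_nat !inE es /=.
  by case: (_ \subset _); case: (rainbow col e); case: (#|e| == _).
have zq : (#|supp z| <= q)%N by rewrite -[X in (_ <= X)%N]card_ord -(card_in_imset inj) max_card.
have tz : \sum_(i in supp z) z i = tot y.
  rewrite tot_supp tot_mass /tot (partition_big col xpredT) //=.
  by apply: eq_bigr => j _; rewrite ms.
split.
  apply: le_trans le_z _; apply: le_trans (full_lam z0 zq _) _ => //.
  by rewrite tz -[leRHS]mulr1 ler_wpM2l ?lam_ge0 // exprn_ile1 // sumr_ge0.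
have [||zc zw] := stab z0 _ zq.
- by rewrite tz.
- apply: le_trans le_z; apply: le_trans density_ge _.
  by apply: pol_le_supp => // e es; rewrite /ind ler_nat; case: (boolP (e \in E)) => // /edge_Rb ->.
move=> j; have : j \in col @: supp z.
  suff -> : col @: supp z = setT by rewrite inE.
  by apply/eqP; rewrite eqEcard subsetT cardsT card_ord (card_in_imset inj) zc leqnn.
case/imsetP => i iz ->; rewrite /mass -ms class_single //.
exact: zw.
Qed.

Lemma Mis_le : pol (ind Mis) y <= 10 * eta.
Proof.
have := polID Rb (fun e => e \in E) y; have [le_Rb _] := Rb_selection.
have -> : pol (ind [set e in Rb | e \in E]) y = pol (ind E) y.
  apply: pol_eq_supp => // e es; rewrite /ind inE.
  by case: (boolP (e \in E)) => eE; rewrite ?andbF ?andbT ?(edge_Rb eE es).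
rewrite -/Mis => h; have := density_ge; move: le_Rb; rewrite h.
set a := pol _ _; set b := pol _ _ => h3 h4.
by rewrite -(lerD2l a) (le_trans h3) // -lerBlDr.
Qed.

Lemma dpol_Rb i : i \in supp y -> dpol (ind Rb) i y = pol (ind (Rj (col i) s.+1)) y.
Proof.
move=> iS; rewrite dpol_indE; apply: eq_pol => e; rewrite /ind; congr (_%:R); congr nat_of_bool.
rewrite !inE subUset sub1set inE in iS *; rewrite iS /=.
have [ie|ie] := boolP (i \in e); rewrite /=.
  apply/esym/negbTE/negP => /and3P[_ _ /forall_inP /(_ i ie)].
  by rewrite eqxx.
rewrite cardsU1 ie add1n eqSS -!andbA; congr (_ && (_ && _)).
apply/rainbowP/andP => [inj|[/rainbowP inj /forall_inP av]].
  split.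
    by apply/rainbowP => u v ue ve; apply: inj; rewrite !inE ?ue ?ve orbT.
  apply/forall_inP => u ue; apply: contraNneq ie => ui.
  by rewrite -(inj u i) // !inE ?eqxx ?ue ?orbT.
move=> u v; rewrite !inE => /predU1P[->|ue] /predU1P[->|ve] //.
- by move=> uv; have := av v ve; rewrite -uv eqxx.
- by move=> uv; have := av u ue; rewrite uv eqxx.
- exact: inj.
Qed.

(** In Euler's identity for the rainbow sets the other classes contribute nearly their full share,
    so class [j], of mass at least [w0], has no room for a larger derivative. *)
Lemma Rj_le j : pol (ind (Rj j s.+1)) y <= r%:R * lm + 18 * q%:R * eta.
Proof.
have [le_Rb wm] := Rb_selection.
apply: (@class_arith _ _ _ _ (tot y) (mass j)) => //.
apply: le_trans (_ : r%:R * pol (ind Rb) y <= _); last by rewrite ler_wpM2l.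
rewrite -(euler _ unif_Rb) (bigID (fun i => col i == j)) /=.
have -> : tot y - mass j = \sum_(i | col i != j) y i.
  by rewrite /tot (bigID (fun i => col i == j)) /= -/(mass j) addrAC subrr add0r.
rewrite /mass !mulr_suml; apply: lerD; apply: ler_sum => i ij.
  have [->|yi] := eqVneq (y i) 0; first by rewrite !mul0r.
  by rewrite dpol_Rb ?inE // (eqP ij).
have [->|yi] := eqVneq (y i) 0; first by rewrite !mul0r.
have iS : i \in supp y by rewrite inE.
apply: ler_wpM2l => //; apply: le_trans (deg (subsetP SA _ iS)) _.
apply: dpol_le_supp => // e ie es; rewrite /ind ler_nat; case: (boolP (e \in E)) => // eE.
rewrite edge_Rb //; apply/subsetP => k ke; have [->//|ki] := eqVneq k i.
by rewrite (subsetP es) // !inE ki.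
Qed.

Lemma Mv_le v j m : r%:R * lm - 5 * eta - m <= pol (ind [set e in Rj j s.+1 | v |: e \in E]) y ->
  pol (ind (Mv v j)) y <= (18 * q%:R + 5) * eta + m.
Proof.
have := polID (Rj j s.+1) (fun e => v |: e \in E) y; have := Rj_le j.
rewrite -/(Mv v j) => le_R h; move: le_R; rewrite h.
set a := pol _ _; set b := pol _ _ => le_ab le_a.
rewrite -(lerD2l a); apply: le_trans le_ab _.
by rewrite -lerBlDr; apply: le_trans le_a; rewrite le_eqVlt; apply/orP; left; apply/eqP; ring.
Qed.

Lemma Mv_own v : v \in supp y -> pol (ind (Mv v (col v))) y <= (18 * q%:R + 5) * eta.
Proof.
move=> vS; rewrite -[leRHS]addr0; apply: Mv_le; rewrite subr0.
apply: le_trans (deg (subsetP SA _ vS)) _; rewrite dpol_indE.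
apply: pol_le_supp => // e es; rewrite /ind ler_nat inE.
have [/andP[ve vE]|//] := boolP (_ && _).
suff -> : e \in [set e in Rj (col v) s.+1 | v |: e \in E] by [].
rewrite inE vE andbT.
have vs : v |: e \subset supp y by rewrite subUset sub1set vS.
have inj := rb vE vs; have := Er vE; rewrite cardsU1 ve add1n => -[ce].
rewrite !inE es ce eqxx /=; apply/andP; split.
  by apply/rainbowP => a b ae be; apply: inj; rewrite !inE ?ae ?be orbT.
apply/forall_inP => u ue; apply: contraNneq ve => uv.
by rewrite -(inj u v) // !inE ?eqxx ?ue ?orbT.
Qed.

(* [z] gives v and v' weight 1 and empties their class: a transversal of [z]
   minimising the weight [g] of the missing edges has q + 1 vertices and all
   edges not containing both v and v', against [adm_pair]. *)
Lemma pair_free v v' j : v != v' -> (v \in supp y -> col v = j) -> (v' \in supp y -> col v' = j) ->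
  (exists e, [/\ e \in E, v \in e & v' \in e]) ->
  10 * eta + (pol (ind (Mv v j)) y + pol (ind (Mv v' j)) y) < w0 ^+ r -> False.
Proof.
move=> vv' vj v'j [e0 [e0E ve0 v'e0]] small.
pose z i := if (i == v) || (i == v') then 1 else if col i == j then 0 else y i.
(* [v] and [v'] get private colours while class [j] is empty under [z], so [q + 1] colours carry
   mass. *)
pose kol i : option (option 'I_q) :=
  if i == v then None else if i == v' then Some None else Some (Some (col i)).
(* Missing edges that avoid both vertices or contain exactly one of them; those through both are
   left out, matching the condition in [adm_pair]. *)
pose g e := ind [set e in Mis | (v \notin e) && (v' \notin e)] e +
  (ind [set e : {set V} | [&& v \in e, v' \notin e & e :\ v \in Mv v j]] e +
   ind [set e : {set V} | [&& v' \in e, v \notin e & e :\ v' \in Mv v' j]] e) : R.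
have zv : z v = 1 by rewrite /z eqxx.
have zv' : z v' = 1 by rewrite /z eqxx orbT.
have z0 : nneg z by move=> i; rewrite /z; case: ifP => // _; case: ifP.
have zy i : i != v -> i != v' -> z i <= y i.
  by rewrite /z => /negbTE -> /negbTE -> /=; case: ifP.
have g0 e : 0 <= g e by rewrite /g !addr_ge0 ?ind_ge0.
have pgz : pol g z < w0 ^+ r.
  apply: le_lt_trans small; rewrite /g !polD; apply: lerD.
    apply: le_trans Mis_le; apply: (@le_trans _ _ (pol (ind [set e in Mis | (v \notin e) && (v' \notin e)]) y)).
      apply: pol_le_mon => [e|e]; first exact: ind_ge0.
      rewrite /ind pnatr_eq0 eqb0 negbK inE => /and3P[_ ve v'e].
      apply: ler_prod => i ie; rewrite z0 zy //; first by apply: contraNneq ve => <-.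
      by apply: contraNneq v'e => <-.
    by apply: pol_le => // e; rewrite /ind ler_nat [in leqLHS]inE; case: (e \in Mis) => //; exact: leq_b1.
  by apply: lerD; apply: pol_cone => // i iv iv'; apply: zy.
have kol_inj e : {in e :\ v :\ v' &, injective col} -> {in e &, injective kol}.
  move=> inj u w ue we; rewrite /kol.
  case: (eqVneq u v) => [->|uv]; first by case: (eqVneq w v) => // _; case: ifP.
  case: (eqVneq w v) => [->|wv]; first by case: ifP.
  case: (eqVneq u v') => [->|uv']; first by case: (eqVneq w v') => // _; case: ifP.
  case: (eqVneq w v') => // wv' [cuw]; apply: inj => //; by rewrite !inE ?uv ?uv' ?wv ?wv'.
have [e _ ge|z' [z'0 zs inj ms le_z]] := @selection _ _ _ kol g z z0.
  apply: kol_inj; have : rainbow col (e :\ v :\ v').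
    have sub (f : {set V}) : e :\ v :\ v' \subset f -> rainbow col f -> rainbow col (e :\ v :\ v').
      move=> /subsetP h /rainbowP rf; apply/rainbowP => a b ae be; apply: rf; exact: h.
    case: (boolP (e \in Mis)) => [|eM].
      rewrite !inE => /andP[/andP[_]] rf _; apply: sub rf.
      by apply: subset_trans (subD1set _ _) _; rewrite subD1set.
    case: (boolP (e :\ v \in Mv v j)) => [|eM1].
      by rewrite !inE => /andP[/and3P[_ rf _] _]; apply: sub rf; rewrite subD1set.
    case: (boolP (e :\ v' \in Mv v' j)) => [|eM2].
      rewrite !inE => /andP[/and3P[_ rf _] _]; apply: sub rf.
      by apply/subsetP => i; rewrite !inE => /and3P[-> _ ->].
    move: ge; rewrite /g /ind inE (negbTE eM).
    rewrite (in_set (fun e => [&& v \in e, v' \notin e & e :\ v \in Mv v j])) (negbTE eM1).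
    rewrite (in_set (fun e => [&& v' \in e, v \notin e & e :\ v' \in Mv v' j])) (negbTE eM2).
    by rewrite !andbF !addr0 eqxx.
  by move=> /rainbowP.
have z'v : z' v = 1.
  rewrite -zv; have := ms None; rewrite !(big_pred1 v) // => i /=.
  - by rewrite /kol; case: (eqVneq i v) => // _; case: ifP.
  - by rewrite /kol; case: (eqVneq i v) => // _; case: ifP.
have z'v' : z' v' = 1.
  rewrite -zv'; have := ms (Some None); rewrite !(big_pred1 v') // => i /=.
  - rewrite /kol; case: (eqVneq i v) => [->|_]; first by rewrite (negbTE vv').
    by case: (eqVneq i v').
  - rewrite /kol; case: (eqVneq i v) => [->|_]; first by rewrite (negbTE vv').
    by case: (eqVneq i v').
have msk k : k != j -> \sum_(i | kol i == Some (Some k)) z' i = mass k.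
  move=> kj; rewrite ms /mass big_mkcond [RHS]big_mkcond; apply: eq_bigr => i _.
  have y_out u : (u \in supp y -> col u = j) -> (if col u == k then y u else 0) = 0.
    case: eqP => // uk h; case: (eqVneq (y u) 0) => // yu.
    by rewrite -uk h ?inE ?eqxx in kj.
  rewrite /kol /z; case: (eqVneq i v) => [->|iv] /=; first by rewrite y_out.
  case: (eqVneq i v') => [->|iv'] /=; first by rewrite y_out.
  have -> : (Some (Some (col i)) == Some (Some k)) = (col i == k) by [].
  by case: (eqVneq (col i) k) => // ->; rewrite (negbTE kj).
set X := supp z' in zs inj.
have vX : v \in X by rewrite inE z'v oner_eq0.
have v'X : v' \in X by rewrite inE z'v' oner_eq0.
have Xo i : i \in X -> i != v -> i != v' -> (i \in supp y) /\ col i != j.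
  move=> /(subsetP zs); rewrite !inE /z => h /negbTE iv /negbTE iv'; move: h; rewrite iv iv' /=.
  by case: (eqVneq (col i) j); rewrite ?eqxx.
have wm k : w0 <= mass k by case: Rb_selection.
have w01 : w0 <= 1.
  by rewrite invf_le1 ?mulr_gt0 // -natrM ler1n muln_gt0.
have Xc : #|X| = q.+1.
  have -> : q.+1 = #|[set~ Some (Some j)]| by rewrite cardsC1 !card_option card_ord.
  rewrite -(card_in_imset inj); congr #|pred_of_set _|; apply/setP => k; rewrite !inE.
  apply/imsetP/idP => [[i iX ->]|].
    apply/negP => /eqP; rewrite /kol; case: (eqVneq i v) => // iv; case: (eqVneq i v') => // iv'.
    by case=> ij; have [_] := Xo i iX iv iv'; rewrite ij eqxx.
  case: k => [[k|]|] kj.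
  - have {}kj : k != j by apply: contraNneq kj => ->.
    have /eqP : \sum_(i | kol i == Some (Some k)) z' i != 0.
      by rewrite msk // gt_eqF // (lt_le_trans w00).
    case: (pickP [pred i | (kol i == Some (Some k)) && (i \in X)]) => [i /andP[/eqP <- iX] _|h].
      by exists i.
    case; apply: big1 => i ki; have := h i; rewrite /= ki inE /=.
    by move/negbT; rewrite negbK => /eqP.
  - by exists v' => //; rewrite /kol eq_sym (negbTE vv') eqxx.
  - by exists v => //; rewrite /kol eqxx.
have Xw i : i \in X -> w0 <= z' i.
  move=> iX; have [->|iv] := eqVneq i v; first by rewrite z'v.
  have [->|iv'] := eqVneq i v'; first by rewrite z'v'.
  have [_ ij] := Xo i iX iv iv'.
  rewrite -(class_single inj iX) [kol i]/kol (negbTE iv) (negbTE iv') msk //.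
have noX e : e \subset X -> #|e| = r -> 1 <= g e -> False.
  move=> /subsetP eX er ge; suff : w0 ^+ r <= pol g z'.
    by rewrite leNgt (le_lt_trans le_z pgz).
  apply: le_trans (pol_ge_mon e z'0 g0); rewrite -er.
  apply: le_trans (mon_ge (ltW w00) (fun i ie => Xw i (eX i ie))) _.
  by rewrite -[leLHS]mul1r ler_wpM2r ?mon_ge0.
have full_X e : e \subset X -> #|e| = r -> ~~ ((v \in e) && (v' \in e)) -> e \in E.
  move=> eX er nvv; apply/negPn/negP => eE; apply: (noX e) => //.
  have fo i : i \in e :\ v :\ v' -> (i \in supp y) /\ col i != j.
    by rewrite !inE => /and3P[iv' iv ie]; have := Xo i (subsetP eX _ ie) iv iv'; rewrite inE.
  have ri : {in e :\ v :\ v' &, injective col}.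
    move=> a b; rewrite !inE => /and3P[av' av ae] /and3P[bv' bv be] ab.
    apply: inj; rewrite ?(subsetP eX) //.
    by rewrite /kol (negbTE av) (negbTE av') (negbTE bv) (negbTE bv') ab.
  have cone u u' : u != u' -> [set v; v'] = [set u; u'] -> u \in e -> u' \notin e -> e :\ u \in Mv u j.
    move=> uu' vu ue u'e.
    have E1 : e :\ v :\ v' = e :\ u.
      apply/setP => i; have := congr1 (fun A : {set V} => i \in A) vu; rewrite !inE.
      have [->|iu'] := eqVneq i u'; first by rewrite (negbTE u'e) !andbF.
      by rewrite orbF => <-; rewrite negb_or andbA [(i != v') && _]andbC.
    rewrite !inE setD1K // eE andbT -E1.
    have -> : e :\ v :\ v' \subset supp y by apply/subsetP => i /fo[].
    have -> : #|e :\ v :\ v'| == s.+1 by rewrite E1; move: er; rewrite (cardsD1 u) ue add1n => -[->].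
    rewrite /=; apply/andP; split; first exact/rainbowP.
    by apply/forall_inP => i /fo[].
  rewrite /g /ind inE (in_set (fun e => [&& v \in e, v' \notin e & e :\ v \in Mv v j])).
  rewrite (in_set (fun e => [&& v' \in e, v \notin e & e :\ v' \in Mv v' j])).
  have [ve|ve] := boolP (v \in e).
    have v'e : v' \notin e by move: nvv; rewrite ve.
    by rewrite (cone v v') // (negbTE v'e) !andbF /= add0r addr0.
  have [v'e|v'e] := boolP (v' \in e).
    by rewrite (cone v' v) // 1?eq_sym // 1?setUC // andbF /= !add0r.
  rewrite /= addr0 andbT !inE eE andbT er eqxx andbT addr0.
  have Ee : e :\ v :\ v' = e.
    apply/setP => i; rewrite !inE; case ie: (i \in e); rewrite ?andbF //= andbT.
    apply/andP; split; [apply: contraNneq v'e | apply: contraNneq ve] => <- //.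
  have -> : e \subset supp y by apply/subsetP => i; rewrite -{1}Ee => /fo[].
  by have -> : rainbow col e by apply/rainbowP; rewrite -Ee.
apply: (adm_pair adm Xc vX v'X vv' full_X); apply: Ef => a b aX bX ab.
(* [X] is a core: [e0] covers the pair [v], [v'], and any other pair lies in an r-set omitting one
   of [v], [v'], which is an edge by [full_X]. *)
have [/andP[va v'a]|nab] := boolP ((v \in [set a; b]) && (v' \in [set a; b])).
  exists e0; move: va v'a; rewrite !inE.
  by move=> /orP[]/eqP E1 /orP[]/eqP E2; subst; rewrite ?eqxx // in ab vv' *.
have [w [wX wab wv]] : exists w, [/\ w \in X, w \notin [set a; b] & (w == v) || (w == v')].
  move: nab; rewrite negb_and => /orP[h|h]; first by exists v; rewrite vX h eqxx.
  by exists v'; rewrite v'X h eqxx orbT.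
have [||e [abe eX er]] := @subset_between V [set a; b] (X :\ w) r.
- by rewrite subsetD1 wab subUset !sub1set aX bX.
- rewrite cards2 ab /=; move: Xc; rewrite (cardsD1 w) wX add1n => -[->]; exact: ltnW.
exists e; rewrite !(subsetP abe) ?inE ?eqxx ?orbT //; split=> //; apply: full_X => //.
  by apply: subset_trans eX _; rewrite subD1set.
move: eX; rewrite subsetD1 => /andP[_ we]; apply/negP => /andP[ve v'e].
by case/orP: wv => /eqP wv; rewrite wv ?ve ?v'e in we.
Qed.

(** Stronger than [rb], which concerns only edges inside the support: here the edge may leave it.
    Both vertices miss little in their own class, so [pair_free] applies within the budget [h1]. *)
Lemma class_uncovered u u' e : u \in supp y -> u' \in supp y -> col u = col u' -> e \in E ->
  u \in e -> u' \in e -> u = u'.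
Proof.
move=> us u's uu eE ue u'e; apply/eqP/negPn/negP => nuu.
apply: (@pair_free u u' (col u)) => //; first by exists e.
have := Mv_own u's; rewrite -uu => h'; have h := Mv_own us.
apply: le_lt_trans h1; rewrite lerD2l mulr2n mulrDl !mul1r.
by apply: lerD; [apply: le_trans h _ | apply: le_trans h' _]; rewrite lerDl ltW.
Qed.

Definition cov i v := [exists e in E, (i \in e) && (v \in e)].
Definition nb j v := \sum_(i | (col i == j) && cov i v) y i.
Notation Lk v := (link_set v E).

Lemma unif_Lk v : unif s.+1 (ind (Lk v) : _ -> R).
Proof. by apply: unif_ind; exact: uniform_link. Qed.

Lemma cov_Lk v e i : e \in Lk v -> i \in e -> cov i v.
Proof.
rewrite inE => /andP[_ eE] ie; apply/exists_inP; exists (v |: e) => //.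
by rewrite !inE ie eqxx orbT.
Qed.

Lemma rainbow_Lk v e : e \in Lk v -> e \subset supp y -> {in e &, injective col}.
Proof.
rewrite inE => /andP[_ eE] /subsetP es a b ae be ab.
by apply: (class_uncovered (es _ ae) (es _ be) ab eE); rewrite !inE ?ae ?be orbT.
Qed.

(* Otherwise selecting one neighbour of v in each class would give a complete
   transversal containing an edge of the link of v, against [adm_edge]. *)
Lemma missed_class v : v \in A -> v \notin supp y -> exists j, nb j v <= c1.
Proof.
move=> vA vs; apply/existsP; apply: contraT; rewrite negb_exists => /forallP all_nb.
have {}all_nb j : c1 < nb j v by rewrite ltNge all_nb.
pose z i := if cov i v then y i else 0.
(* A negative value at a transversal gives two things at once: the link of [v] has an edge inside
   it, and the missing sets weigh less than [c1 ^+ r], so that none of them lies in the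
   transversal. *)
pose g e := ind Mis e + (- c1 ^+ r) * ind (Lk v) e : R.
have z0 : nneg z by move=> i; rewrite /z; case: ifP.
have zy i : z i <= y i by rewrite /z; case: ifP.
have zs : supp z \subset supp y.
  by apply/subsetP => i; rewrite !inE /z; case: ifP => //; rewrite eqxx.
have pgz : pol g z < 0.
  rewrite polD polZ mulNr subr_lt0.
  have -> : pol (ind (Lk v)) z = dpol (ind E) v y.
    rewrite dpol_indE; apply: pol_eq => e.
    rewrite /ind pnatr_eq0 eqb0 negbK => eL i ie.
    by rewrite /z (cov_Lk eL ie).
  apply: le_lt_trans (_ : _ <= 10 * eta) (lt_le_trans h2 _).
    by apply: le_trans Mis_le; apply: pol_mono => // e; exact: ind_ge0.
  by rewrite ler_wpM2l ?exprn_ge0 ?deg // ltW.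
have [e es|z' [z'0 z's inj ms le_z]] := @selection _ _ _ col g z z0.
  rewrite /g /ind; case: (boolP (e \in Mis)) => [|_].
    by rewrite !inE => /andP[/andP[_ /rainbowP]].
  case: (boolP (e \in Lk v)) => [eL _|_]; last by rewrite mulr0 addr0 eqxx.
  exact: rainbow_Lk eL (subset_trans es zs).
have {}le_z : pol g z' < 0 by exact: le_lt_trans le_z pgz.
set X := supp z' in z's inj.
have Xs : X \subset supp y by exact: subset_trans z's zs.
have Xcov i : i \in X -> cov i v.
  by move=> /(subsetP z's); rewrite inE /z; case: ifP => //; rewrite eqxx.
have msj j : \sum_(i | col i == j) z' i = nb j v.
  rewrite ms /nb big_mkcondr /=; apply: eq_bigr => i _.
  by rewrite /z.
have Xw i : i \in X -> c1 <= z' i.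
  by move=> iX; rewrite -(class_single inj iX) msj ltW.
have Xq : #|X| = q.
  rewrite -(card_in_imset inj) -[RHS]card_ord -cardsT; congr #|pred_of_set _|.
  apply/setP => j; rewrite in_setT; apply/imsetP.
  case: (pickP [pred i | (col i == j) && (i \in X)]) => [i /andP[/eqP <- iX]|h]; first by exists i.
  have : \sum_(i | col i == j) z' i = 0.
    apply: big1 => i ij; have := h i; rewrite /= ij inE /=.
    by move/negbT; rewrite negbK => /eqP.
  by rewrite msj => nb0; have := lt_trans c10 (all_nb j); rewrite nb0 ltxx.
have tz' : tot z' <= 1.
  apply: le_trans y1; rewrite /tot (partition_big col xpredT) //=.
  rewrite [leRHS](partition_big col xpredT) //=; apply: ler_sum => j _.
  by rewrite ms; apply: ler_sum => i _.
have [f fX fL] : exists2 f : {set V}, f \subset X & f \in Lk v.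
  case: (pickP [pred f : {set V} | (f \subset X) && (f \in Lk v)]) => [f /andP[fX fL]|h]; first by exists f.
  have : pol g z' = pol (ind Mis) z'.
    rewrite polD polZ (_ : pol (ind (Lk v)) z' = 0) ?mulr0 ?addr0 //.
    apply: big1 => e _; have [->|/mon_supp eX] := eqVneq (mon z' e) 0; first by rewrite mulr0.
    by have := h e; rewrite /= eX /ind /= => ->; rewrite mul0r.
  by move=> h'; move: le_z; rewrite h' ltNge pol_ge0 // => e; exact: ind_ge0.
have Mis_z' : pol (ind Mis) z' < c1 ^+ r.
  move: le_z; rewrite polD polZ mulNr subr_lt0 => /lt_le_trans; apply.
  rewrite ger_pMr ?exprn_gt0 //; apply: (pol_le1 (@unif_Lk v)) => // e.
  by rewrite /ind lern1; case: (_ \in _).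
have Xcomp : complete_on r E X.
  move=> e eX er; apply/negPn/negP => eE.
  have eM : e \in Mis.
    rewrite !inE eE andbT er eqxx andbT (subset_trans eX Xs) /=.
    by apply/rainbowP => a b ae be; apply: inj; apply: (subsetP eX).
  suff : c1 ^+ r <= pol (ind Mis) z' by rewrite leNgt Mis_z'.
  apply: le_trans (pol_ge_mon e z'0 (ind_ge0 R Mis)).
  rewrite /ind eM mul1r -er; apply: mon_ge; first exact: ltW.
  by move=> i /(subsetP eX) /Xw.
have [fv fE] : v \notin f /\ v |: f \in E by move: fL; rewrite inE => /andP.
have vX : v \notin X by apply: contra vs => /(subsetP Xs).
have [a af] : exists a, a \in f.
  by apply/card_gt0P; move: (Er fE); rewrite cardsU1 fv add1n => -[->].
apply: False_ind; apply: (adm_edge adm Xq Xcomp fE (Er fE) (a := a)).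
- by apply/negP => /subsetP/(_ v); rewrite setU11 (negbTE vX) => /(_ isT).
- exact: (subsetP fX).
- by rewrite !inE af orbT.
apply: Ef => u w; rewrite setUCA (setUidPl fX).
have covX i : i \in X -> exists e, [/\ e \in E, i \in e & v \in e].
  by move=> /Xcov /exists_inP[e eE /andP[]]; exists e.
rewrite !in_setU1 => /predU1P[->|uX] /predU1P[->|wX] uw.
- by rewrite eqxx in uw.
- by have [e [eE we ve]] := covX w wX; exists e.
- exact: covX.
- by apply: (complete_clique _ _ Xcomp) => //; rewrite Xq ltnW.
Qed.

(** Link edges meeting class [j] weigh at most [nb j v], hence at most [c1]; the others are rainbow
    and avoid [j], so they count towards [Rj]. *)
Lemma Mv_missed v j : v \in A -> v \notin supp y -> nb j v <= c1 ->
  pol (ind (Mv v j)) y <= (18 * q%:R + 5) * eta + c1.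
Proof.
move=> vA vs le_nb; apply: Mv_le; rewrite lerBlDr.
apply: le_trans (deg vA) _; rewrite dpol_indE -/(Lk v) (polID _ (fun e => [forall i in e, col i != j])).
apply: lerD.
  apply: pol_le_supp => // e es; rewrite /ind ler_nat [in leqLHS]inE.
  case: (boolP (e \in Lk v)) => //= eL; case: (boolP [forall i in e, col i != j]) => // av.
  suff -> : e \in [set e in Rj j s.+1 | v |: e \in E] by [].
  have := eL; rewrite inE => /andP[ve veE]; rewrite !inE veE av es !andbT /=.
  move: (Er veE); rewrite cardsU1 ve add1n => -[->]; rewrite eqxx.
  exact/rainbowP/(rainbow_Lk eL es).
apply: le_trans le_nb; set L' := [set e in _ | _].
have uL : unif s.+1 (ind L' : _ -> R).
  by apply: unif_ind_sub (@unif_Lk v) _ => e; rewrite inE => /andP[eL _]; rewrite /ind eL oner_eq0.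
apply: le_trans (@pol_le_cover _ _ _ _ [set i | (col i == j) && cov i v] y0 (ind_ge0 R L') _) _.
  move=> e es; rewrite /ind pnatr_eq0 eqb0 negbK inE => /andP[eL].
  rewrite negb_forall_in => /exists_inP[i ie]; rewrite negbK => ij; exists i => //.
  by rewrite inE ij (cov_Lk eL ie).
rewrite /nb big_mkcond [leRHS]big_mkcond; apply: ler_sum => i _; rewrite inE.
case: ifP => // _; rewrite ler_piMr // dpol_link.
apply: (pol_le1 (unif_link uL)) => // e.
by rewrite /link /ind; case: ifP => // _; rewrite lern1; case: (_ \in _).
Qed.

(** A vertex outside the support takes the colour of a class that it nearly misses. Two vertices of
    an edge with equal colours would both miss little in the other classes, which [pair_free]
    forbids. *)
Lemma extension : colorable q E A.
Proof.
(* On [A] the default of [odflt] is never reached, by [missed_class]. *)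
pose phi v := if v \in supp y then col v else odflt (col v) [pick j | nb j v <= c1].
have near v : v \in A -> pol (ind (Mv v (phi v))) y <= (18 * q%:R + 5) * eta + c1.
  move=> vA; rewrite /phi; case: (boolP (v \in supp y)) => vs.
    by apply: le_trans (Mv_own vs) _; rewrite lerDl ltW.
  case: pickP => [j|h] /=; first exact: Mv_missed.
  by have [j] := missed_class vA vs; rewrite h.
have own v : v \in supp y -> col v = phi v by rewrite /phi => ->.
exists phi => e eE /subsetP eA u w ue we uw; apply/eqP/negPn/negP => nuw.
apply: (@pair_free u w (phi u)) => //; first exact: own.
- by move=> /own ->.
- by exists e.
apply: le_lt_trans h1; rewrite lerD2l mulr2n mulrDl !mul1r.
by apply: lerD; [exact/near/eA | rewrite uw; exact/near/eA].
Qed.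

End Extension.

Section Constants.
Variable R : realFieldType.

Lemma extension_constants r (q w l c : R) : 0 < q -> 0 < w -> w <= 1 -> 0 < l -> 0 < c -> (0 < r)%N ->
  exists eta c1 : R, [/\ 0 < eta /\ eta <= 1, 0 < c1, 10 * eta < c,
    10 * eta + 2 * ((18 * q + 5) * eta + c1) < w ^+ r &
    10 * eta < c1 ^+ r * (r%:R * l - 5 * eta)].
Proof.
move=> q0 w0 w1 l0 c0 r0; pose c1 := w ^+ r / 8.
have wr : 0 < w ^+ r by rewrite exprn_gt0.
have c10 : 0 < c1 by rewrite divr_gt0.
have c11 : c1 <= 1.
  have : w ^+ r <= 1 by rewrite exprn_ile1 // ltW.
  by rewrite /c1; lra.
have m0 : 0 < c1 ^+ r by rewrite exprn_gt0.
have m1 : c1 ^+ r <= 1 by rewrite exprn_ile1 // ltW.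
have rR : 1 <= r%:R :> R by rewrite ler1n.
set m := c1 ^+ r in m0 m1 *.
have d0 : 0 < 36 * q + 20 by lra.
(* [a] keeps (36 q + 20) eta within w^r / 4, which together with 2 c1 = w^r / 4 gives the inequality
   with [w ^+ r]. [b] keeps 15 eta within m l / 2, which gives the last one, as 5 m eta <= 5 eta. *)
pose a := w ^+ r / 4 / (36 * q + 20); pose b := m * l / 30.
have a0 : 0 < a by rewrite !divr_gt0.
have b0 : 0 < b by rewrite divr_gt0 // mulr_gt0.
pose eta := Num.min (Num.min (c / 20) 1) (Num.min a b).
have eta0 : 0 < eta by rewrite !lt_min a0 b0 ltr01 divr_gt0.
have eta_c : eta <= c / 20 by rewrite !ge_min lexx.
have eta1 : eta <= 1 by rewrite !ge_min lexx orbT.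
have eta_a : eta <= a by rewrite !ge_min lexx !orbT.
have eta_b : eta <= b by rewrite !ge_min lexx !orbT.
exists eta, c1; split=> //; first by lra.
  have : eta * (36 * q + 20) <= w ^+ r / 4 by rewrite -ler_pdivlMr.
  by rewrite /c1; lra.
have : m * eta <= eta by rewrite ler_piMl // ltW.
have : m * l <= m * (r%:R * l) by rewrite ler_pM2l // ler_peMl // ltW.
rewrite /b in eta_b; rewrite mulrBr [m * (5 * eta)]mulrCA => h3 h4.
by set X := m * (r%:R * l) in h3 *; clearbody eta X; lra.
Qed.

End Constants.

Section Restriction.
Variables (R : realFieldType) (V : finType).
Implicit Types (x : V -> R) (g : {set V} -> R) (S e : {set V}).

Lemma pol_restrict g x S : nneg x -> (forall e, 0 <= g e) ->
  pol g x <= pol g (fun i => if i \in S then x i else 0) + \sum_(i in ~: S) x i * dpol g i x.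
Proof.
move=> x0 g0; pose g' e := if e \subset S then 0 else g e.
have g'0 e : 0 <= g' e by rewrite /g'; case: ifP.
apply: (@le_trans _ _ (pol g (fun i => if i \in S then x i else 0) + pol g' x)).
  rewrite /pol -big_split; apply: ler_sum => e _ /=; rewrite /g'.
  case: ifPn => eS; last by rewrite lerDr mulr_ge0 // mon_ge0 // => i; case: ifP.
  rewrite mul0r addr0 ler_wpM2l // le_eqVlt; apply/orP; left; apply/eqP.
  by apply: mon_eq => i ie; rewrite (subsetP eS).
rewrite lerD2l; apply: le_trans (pol_le_cover (P := ~: S) x0 g'0 _) _.
  move=> e _; rewrite /g'; case: ifPn => [_|/subsetPn[i ie iS] _]; first by rewrite eqxx.
  by exists i => //; rewrite inE.
apply: ler_sum => i _; rewrite ler_wpM2l //; apply: dpol_le_supp => // e _ _.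
by rewrite /g'; case: ifP.
Qed.

(** An edge through both vertices contains a third vertex of weight 0, so neither derivative sees
    the move. A comparison of the two derivatives therefore persists through all steps between the
    same pair. *)
Lemma dpol_mv (E : {set {set V}}) x u v (h : R) a : u != v -> (a == u) || (a == v) ->
  u \in supp x -> v \in supp x ->
  (forall e, e \in E -> u \in e -> v \in e -> ~~ (e \subset supp x)) ->
  dpol (ind E) a (mv x u v h) = dpol (ind E) a x.
Proof.
move=> uv auv us vs unc; apply: eq_bigr => e ae; rewrite /ind.
case: (boolP (e \in E)) => eE; last by rewrite !mul0r.
rewrite !mul1r; have [uve|uve] := boolP ((u \in e) && (v \in e)).
  have /andP[ue ve] := uve; have /subsetPn[w we ws] := unc e eE ue ve.
  have wu : w != u by apply: contraNneq ws => ->.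
  have wv : w != v by apply: contraNneq ws => ->.
  have wa : w \in e :\ a.
    by rewrite !inE we andbT; case/orP: auv => /eqP ->.
  move: ws; rewrite inE negbK => /eqP xw.
  by rewrite !(mon_eq0 wa) // /mv (negbTE wu) (negbTE wv).
apply: mon_eq => i; rewrite !inE => /andP[ia ie]; rewrite /mv.
case: eqP => iu; first by case/negP: uve; subst; case/orP: auv => /eqP E1; subst; rewrite ?eqxx ?ie // in ia *.
by case: eqP => iv //; case/negP: uve; subst; case/orP: auv => /eqP E1; subst; rewrite ?eqxx ?ie ?ae // in ia *.
Qed.

End Restriction.

(** * Carrying the colouring back along small steps *)

Section Stability.
Variables (R : realFieldType) (Ff : forbids) (s q : nat).
Notation r := s.+2.
Hypotheses (adm : admissible R Ff r q) (rq : (r < q)%N).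
Variables (V : finType) (E : {set {set V}}).
Hypotheses (Er : uniform r E) (Ef : core_free Ff E).
Notation lm := (lam R q r).
Variables (eta c1 eps : R).
Hypotheses (eta0 : 0 < eta) (eta1 : eta <= 1) (c10 : 0 < c1).
Hypothesis (stab : forall (W : finType) (X : {set W}) (x : W -> R), nneg x ->
  \sum_(i in X) x i <= 1 -> (#|X| <= q)%N -> lm - 10 * eta <= e_ X r x ->
  #|X| = q /\ forall i, i \in X -> (2 * q%:R)^-1 <= x i).
Hypothesis (h1 : 10 * eta + 2 * ((18 * q%:R + 5) * eta + c1) < (2 * q%:R)^-1 ^+ r).
Hypothesis (h2 : 10 * eta < c1 ^+ r * (r%:R * lm - 5 * eta)).
Hypotheses (eps_eta : eps < eta ^+ 2 / 2).
Hypothesis (cov_card : forall x, nneg x -> tot x = 1 -> covered E x ->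
  lm - eps <= pol (ind E) x -> #|supp x| = q).
Implicit Types (x : V -> R).

Definition low x v := dpol (ind E) v x < r%:R * lm - eta.
Definition good x := [set v | (x v != 0) && ~~ low x v].

(** [extension] is applied to [x] restricted to the vertices good before and after the step. Outside
    lie the low vertices of [x], the low vertices of [x'] and the weight [h] taken from [v], at most
    [eta] each, so mass and derivatives drop by at most 3 eta. The colouring comes from [x'], the
    conclusion is about [x]. *)
Lemma good_step x u v h : nneg x -> tot x = 1 -> u != v -> 0 <= h -> h <= eta -> h <= x v ->
  lm - eps <= pol (ind E) x -> lm - eps <= pol (ind E) (mv x u v h) ->
  colorable q E (good (mv x u v h)) -> colorable q E (good x).
Proof.
move=> x0 x1 uv h0 h_eta hv px px' [col rb].
set x' := mv x u v h in px' rb *.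
have x'0 : nneg x' by apply: nneg_mv => //; [exact: addr_ge0 | rewrite subr_ge0].
have x'1 : tot x' = 1 by rewrite tot_mv.
pose S := good x :&: good x'.
pose y i := if i \in S then x i else 0.
have y0 : nneg y by move=> i; rewrite /y; case: ifP.
have supp_y : supp y \subset S.
  by apply/subsetP => i; rewrite inE /y; case: ifP => // _; rewrite eqxx.
have loss : \sum_(i in ~: S) x i <= 3 * eta.
  have -> : 3 * eta = eta + (eta + eta) by ring.
  have bad := low_degree_mass adm isT rq Er Ef x0 x1 eta0 eta1 eps_eta px.
  have bad' := low_degree_mass adm isT rq Er Ef x'0 x'1 eta0 eta1 eps_eta px'.
  have bad_h : \sum_(i | i == v) h <= eta by rewrite big_pred1_eq.
  apply: le_trans (lerD bad (lerD bad' bad_h)).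
  rewrite big_mkcond [X in _ <= X + _]big_mkcond [X in _ <= _ + (X + _)]big_mkcond.
  rewrite [X in _ <= _ + (_ + X)]big_mkcond -!big_split; apply: ler_sum => i _ /=.
  rewrite -/(low x i) -/(low x' i).
  have t1 : 0 <= (if low x i then x i else 0) by case: ifP.
  have t2 : 0 <= (if low x' i then x' i else 0) by case: ifP.
  have t3 : 0 <= (if i == v then h else 0) by case: ifP.
  case: ifP => [|_]; last by rewrite !addr_ge0.
  rewrite !inE negb_and !negb_and !negbK => /orP[/orP[/eqP xi|lx]|].
  - by rewrite [leLHS]xi; apply: addr_ge0 => //; apply: addr_ge0.
  - by rewrite lx lerDl addr_ge0.
  have x_x' : x i <= x' i + (if i == v then h else 0).
    rewrite /x' /mv; case: (eqVneq i u) => [->|iu].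
      by rewrite (negbTE uv) addr0 lerDl.
    by case: (eqVneq i v) => [->|iv]; rewrite ?subrK ?addr0.
  case/orP => [/eqP x'i|lx'].
    by apply: le_trans x_x' _; rewrite [in leLHS]x'i add0r addrA lerDr addr_ge0.
  by rewrite lx'; apply: le_trans x_x' _; rewrite lerDr.
apply: (@extension R Ff s q adm rq V E Er Ef y col eta c1 (good x)) => //.
- by rewrite -x1; apply: ler_sum => i _; rewrite /y; case: ifP.
- have -> : tot y = tot x - \sum_(i in ~: S) x i.
    rewrite /tot [X in _ = X - _](bigID (mem S)) /= [X in _ = _ + X - _](eq_bigl (mem (~: S))).
      by rewrite addrK [RHS]big_mkcond.
    by move=> i; rewrite !inE.
  by rewrite x1 lerD2l lerN2; apply: le_trans loss _; rewrite ler_pM2r // ler_nat.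
- exact: ltW.
- move=> e eE es; apply: rb => //; apply: subset_trans es _; apply: subset_trans supp_y _.
  exact: subsetIr.
- by apply: subset_trans supp_y _; exact: subsetIl.
move=> w; rewrite inE /low -leNgt => /andP[_ dw].
have : dpol (ind E) w x <= dpol (ind E) w y + 3 * eta.
  rewrite !dpol_link; have l0 e : 0 <= link w (ind E) e :> R.
    by rewrite /link; case: ifP => // _; exact: ind_ge0.
  apply: le_trans (pol_restrict S x0 l0) _; rewrite lerD2l; apply: le_trans loss.
  apply: ler_sum => i _; rewrite ler_piMr // dpol_link.
  apply: (pol_le1 (unif_link (unif_link (unif_ind Er)))); rewrite ?x1 // => e.
  by rewrite /link /ind; case: ifP => // _; case: ifP => // _; rewrite lern1; case: (_ \in _).
move: dw; set a := dpol _ _ _; set b := dpol _ _ _ => h3 h4.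
have : r%:R * lm - eta - 3 * eta <= b by rewrite lerBlDr; apply: le_trans h3 h4.
apply: le_trans; rewrite -addrA lerD2l -opprD lerN2.
have -> : 5 * eta = eta + 3 * eta + eta by ring.
by rewrite lerDl ltW.
Qed.

Lemma card_colorable (x : V -> R) : #|supp x| = q -> colorable q E (good x).
Proof.
move=> sq; have q0 : (0 < q)%N by exact: leq_trans rq.
pose phi v : 'I_q := insubd (Ordinal q0) (index v (enum (supp x))).
exists phi => e _ es u v ue ve.
have sub w : w \in e -> w \in supp x.
  by move=> /(subsetP es); rewrite !inE => /andP[].
have val_phi w : w \in e -> val (phi w) = index w (enum (supp x)).
  by move=> /sub ws; rewrite val_insubd -[X in (_ < X)%N]sq cardE index_mem mem_enum ws.
move/(congr1 val); rewrite !val_phi // => idx.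
by rewrite -(@nth_index _ u u (enum (supp x))) ?mem_enum ?sub // idx nth_index ?mem_enum ?sub.
Qed.

Section Discrete.
Variable n : nat.
Hypotheses (n0 : (0 < n)%N) (n_eta : n%:R^-1 <= eta).
Implicit Types (k : {ffun V -> nat}).

(* With weights in multiples of 1/n, moving the mass of one vertex to another in
   steps of size 1/n changes the set of good vertices only slightly each time. *)
Definition wt k (i : V) : R := (k i)%:R / n%:R.

Let nR : 0 < n%:R :> R. Proof. by rewrite ltr0n. Qed.

Lemma wt_ge0 k : nneg (wt k).
Proof. by move=> i; rewrite divr_ge0 ?ler0n. Qed.

Lemma supp_wt k : supp (wt k) = [set i | k i != 0%N].
Proof.
by apply/setP => i; rewrite !inE /wt mulf_eq0 invr_eq0 (gt_eqF nR) orbF pnatr_eq0.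
Qed.

Lemma tot_wt k : (\sum_i k i)%N = n -> tot (wt k) = 1.
Proof. by move=> kn; rewrite /tot -mulr_suml -natr_sum kn divff // gt_eqF. Qed.

Definition shift_unit k u v : {ffun V -> nat} :=
  [ffun i => if i == u then (k u).+1 else if i == v then (k v).-1 else k i].

Lemma wt_shift k u v : u != v -> k v != 0%N -> wt (shift_unit k u v) =1 mv (wt k) u v n%:R^-1.
Proof.
move=> uv kv i; rewrite /wt /mv ffunE; case: eqP => _.
  by rewrite -natr1 mulrDl mul1r.
case: eqP => // _; rewrite -{2}(prednK (_ : 0 < k v)%N) ?lt0n //.
by rewrite -natr1 mulrDl mul1r addrK.
Qed.

Lemma sum_shift k u v : u != v -> k v != 0%N ->
  (\sum_i shift_unit k u v i = \sum_i k i)%N.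
Proof.
move=> uv kv; have vu : v != u by rewrite eq_sym.
rewrite (bigD1 u) // (bigD1 v) //= [RHS](bigD1 u) // [in RHS](bigD1 v) //= !ffunE eqxx (negbTE vu) eqxx.
rewrite (eq_bigr k); first by rewrite -{2}(prednK (_ : 0 < k v)%N) ?lt0n // !addSn addnS.
by move=> i /andP[iu iv]; rewrite ffunE (negbTE iu) (negbTE iv).
Qed.

Lemma pol_ext g (x x' : V -> R) : x =1 x' -> pol g x = pol g x'.
Proof. by move=> xx; apply: pol_eq => e _ i _. Qed.

Lemma dpol_ext g v (x x' : V -> R) : x =1 x' -> dpol g v x = dpol g v x'.
Proof. by move=> xx; rewrite !dpol_link; apply: pol_ext. Qed.

Lemma good_ext (x x' : V -> R) : x =1 x' -> good x = good x'.
Proof. by move=> xx; apply/setP => v; rewrite !inE xx /low (dpol_ext _ _ xx). Qed.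

(** Outer induction on the size of the support, inner induction on the units left at [b]. Pair and
    direction stay fixed until [b] is empty, since [dpol_mv] preserves the order of the two
    derivatives. The recursion ends at a covered support, whose [q] vertices get distinct colours,
    and [good_step] returns the colouring. *)
Lemma discrete_colorable k : (\sum_i k i)%N = n -> lm - eps <= pol (ind E) (wt k) ->
  colorable q E (good (wt k)).
Proof.
have [N] := ubnP #|supp (wt k)|; elim: N k => // N IH k; rewrite ltnS => kN kn pk.
have [/forall_inP cov|] := boolP [forall u in supp (wt k), forall v in supp (wt k),
  (u != v) ==> [exists e in E, [&& e \subset supp (wt k), u \in e & v \in e]]].
  apply: card_colorable; apply: cov_card => //; [exact: wt_ge0 | exact: tot_wt |].
  move=> u v us vs uv.
  have /forall_inP/(_ v vs)/implyP/(_ uv)/exists_inP[e eE /and3P[? ? ?]] := cov u us.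
  by exists e.
rewrite negb_forall_in => /exists_inP[u us]; rewrite negb_forall_in => /exists_inP[v vs].
rewrite negb_imply negb_exists_in => /andP[uv /forall_inP unc].
have [a [b [ab as_ bs {}unc le_ba]]] : exists a b, [/\ a != b, a \in supp (wt k), b \in supp (wt k),
    (forall e, e \in E -> a \in e -> b \in e -> ~~ (e \subset supp (wt k))) &
    dpol (ind E) b (wt k) <= dpol (ind E) a (wt k)].
  have [le|/ltW le] := lerP (dpol (ind E) v (wt k)) (dpol (ind E) u (wt k)).
    by exists u, v; split=> // e /unc h ue ve; move: h; rewrite ue ve !andbT.
  exists v, u; split=> //; first by rewrite eq_sym.
  by move=> e /unc h ve ue; move: h; rewrite ue ve !andbT.
have [m] := ubnP (k b); clear u v us vs uv.
elim: m k kN kn pk as_ bs unc le_ba => // m IHm k kN kn pk as_ bs unc le_ba; rewrite ltnS => km.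
have kb : k b != 0%N by move: bs; rewrite supp_wt inE.
set k' := shift_unit k a b; have kk' : wt k' =1 _ := wt_shift ab kb.
have k'n : (\sum_i k' i)%N = n by rewrite sum_shift.
have sub : supp (wt k') \subset supp (wt k).
  rewrite !supp_wt; apply/subsetP => i; rewrite !inE ffunE.
  case: (eqVneq i a) => [-> _|_]; first by move: as_; rewrite supp_wt inE.
  by case: (eqVneq i b) => [->|].
have dpol_eq c : (c == a) || (c == b) -> dpol (ind E) c (wt k') = dpol (ind E) c (wt k).
  by move=> cab; rewrite (dpol_ext _ _ kk') dpol_mv.
have pk' : lm - eps <= pol (ind E) (wt k').
  apply: le_trans pk _; rewrite (pol_ext _ kk') pol_mv // ddpol_eq0 ?mulr0 ?subr0.
    by rewrite lerDl mulr_ge0 ?subr_ge0 // invr_ge0.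
  move=> e ae be es; rewrite /ind; case: (boolP (e \in E)) => // eE.
  have := unc e eE ae be; suff -> : e \subset supp (wt k) by [].
  apply: subset_trans es _; rewrite !subUset !sub1set as_ bs; exact: subxx.
apply: (good_step (wt_ge0 k) (tot_wt kn) ab (h := n%:R^-1)); rewrite ?invr_ge0 //.
- by rewrite /wt -[leLHS]mul1r ler_pM2r ?invr_gt0 // ler1n lt0n.
- by rewrite -(pol_ext _ kk').
rewrite -(good_ext kk'); have [k1|k1] := eqVneq (k b) 1%N.
  apply: IH => //; apply: leq_trans kN; apply: proper_card; apply/properP; split=> //.
  by exists b => //; rewrite supp_wt inE ffunE [b == a]eq_sym (negbTE ab) eqxx k1.
have k'b : k' b = (k b).-1 by rewrite ffunE [b == a]eq_sym (negbTE ab) eqxx.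
have bs' : b \in supp (wt k') by rewrite supp_wt inE k'b; case: (k b) kb k1 => [|[|]].
apply: IHm => //.
- exact: leq_trans (subset_leq_card sub) kN.
- by rewrite supp_wt inE ffunE eqxx.
- by move=> e eE ae be; apply: contra (unc e eE ae be) => es; exact: subset_trans sub.
- by rewrite !dpol_eq ?eqxx ?orbT.
- by rewrite k'b prednK // lt0n.
Qed.

End Discrete.
End Stability.

Section MainStability.
Variables (R : archiRealFieldType) (Ff : forbids) (s q : nat).
Notation r := s.+2.
Hypotheses (adm : admissible R Ff r q) (rq : (r < q)%N).

Theorem degree_stability : exists (eps : R) (n0 : nat), 0 < eps /\
  forall (V : finType) (E : {set {set V}}), (n0 <= #|V|)%N -> uniform r E -> core_free Ff E ->
    (forall v, (r%:R * lam R q r - eps) * #|V|%:R ^+ s.+1 <= #|[set e in E | v \in e]|%:R) ->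
    colorable q E setT.
Proof.
have r2q : (2 <= r)%N by [].
have q0 : (0 < q)%N by exact: leq_trans rq.
have [cM cM0 HM] := full_stability R r2q (ltnW rq).
have [cL cL0 HL] := adm_lagrangian adm.
have l0 : 0 < lam R q r by rewrite lam_gt0 // ltnW.
have w0 : 0 < (2 * q%:R)^-1 :> R by rewrite invr_gt0 mulr_gt0 // ltr0n.
have w1 : (2 * q%:R)^-1 <= 1 :> R.
  by rewrite invf_le1 ?mulr_gt0 ?ltr0n // -natrM ler1n muln_gt0.
have q0R : 0 < q%:R :> R by rewrite ltr0n.
have [eta [c1 [[eta0 eta1] c10 eta_c h1 h2]]] := extension_constants q0R w0 w1 l0 cM0 (isT : (0 < r)%N).
pose eps := Num.min (eta ^+ 2 / 4) (cL / 2).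
have eps0 : 0 < eps by rewrite lt_min !divr_gt0 // exprn_gt0.
have eps_eta : eps < eta ^+ 2 / 2.
  apply: le_lt_trans (_ : eta ^+ 2 / 4 < _); first by rewrite ge_min lexx.
  by rewrite ltr_pM2l ?exprn_gt0 // ltf_pV2 ?posrE // ltr_nat.
have eps_L : eps < cL.
  apply: le_lt_trans (_ : cL / 2 < _); first by rewrite ge_min lexx orbT.
  by rewrite ltr_pdivrMr // ltr_pMr // ltr1n.
have stab (W : finType) (X : {set W}) (x : W -> R) : nneg x ->
    \sum_(i in X) x i <= 1 -> (#|X| <= q)%N -> lam R q r - 10 * eta <= e_ X r x ->
    #|X| = q /\ forall i, i \in X -> (2 * q%:R)^-1 <= x i.
  move=> x0 x1 Xq le_e; apply: HM => //; apply: lt_le_trans le_e.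
  by rewrite ltrD2l ltrN2.
(* [eta] makes every vertex good at the uniform weights, and [eps] makes the polynomial there
   near-optimal. *)
pose e0 := Num.min eta eps.
have [n1 n1_eta] : exists n1 : nat, forall n, (n1 <= n)%N -> (0 < n)%N -> n%:R^-1 <= eta.
  exists (Num.bound eta^-1) => n n1n n0.
  rewrite -[leRHS]invrK lef_pV2 ?posrE ?invr_gt0 ?ltr0n //.
  apply: le_trans (ltW (archi_boundP _)) _; first by rewrite invr_ge0 ltW.
  by rewrite ler_nat.
exists e0, (maxn 1 n1); split; first by rewrite lt_min eta0.
move=> V E; rewrite geq_max => /andP[n0 n1n] Er Ef deg.
set n := #|V| in n0 n1n deg; have nR : 0 < n%:R :> R by rewrite ltr0n.
pose k : {ffun V -> nat} := [ffun=> 1%N].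
have kn : (\sum_i k i)%N = n.
  by rewrite (eq_bigr (fun=> 1%N)) ?sum1_card // => i _; rewrite ffunE.
have dk v : r%:R * lam R q r - e0 <= dpol (ind E) v (wt R n k).
  rewrite -(ler_pM2r (exprn_gt0 s.+1 nR)); apply: le_trans (deg v) _.
  rewrite le_eqVlt; apply/orP; left; apply/eqP.
  rewrite /dpol mulr_suml -sum1dep_card natr_sum big_mkcond [RHS]big_mkcond.
  apply: eq_bigr => e _; rewrite /ind; case: (boolP (v \in e)) => ve; last by rewrite andbF.
  case: (boolP (e \in E)) => eE; last by rewrite !mul0r.
  rewrite mul1r /mon (eq_bigr (fun=> n%:R^-1)); last by move=> i _; rewrite /wt ffunE mul1r.
  rewrite prodr_const; have := Er e eE; rewrite (cardsD1 v) ve add1n => -[->].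
  by rewrite -exprMn mulVf ?expr1n // gt_eqF.
have tk := tot_wt R n0 kn; have k0 := @wt_ge0 R V n k.
have e0_eta : e0 <= eta by rewrite ge_min lexx.
have e0_eps : e0 <= eps by rewrite ge_min lexx orbT.
have pk : lam R q r - eps <= pol (ind E) (wt R n k).
  have r0 : 0 < r%:R :> R by rewrite ltr0n.
  rewrite -(ler_pM2l r0) -euler; last exact: unif_ind.
  apply: (@le_trans _ _ (\sum_i wt R n k i * (r%:R * lam R q r - e0))).
    rewrite -mulr_suml -/(tot _) tk mul1r mulrBr lerD2l lerN2 (le_trans e0_eps) //.
    by rewrite ler_peMl ?ltW // ltr1n.
  by apply: ler_sum => i _; rewrite ler_wpM2l.
have [phi rb] : colorable q E (good s q E eta (wt R n k)).
  apply: (@discrete_colorable R Ff s q adm rq V E Er Ef eta c1 eps) => //.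
    by move=> x x0 x1 cov le; apply: (covered_card adm _ rq Er Ef HL) => //; apply: lt_le_trans le; rewrite ltrD2l ltrN2.
  exact: n1_eta.
exists phi => e eE _; apply: rb => //; apply/subsetP => v _.
rewrite inE /wt ffunE mul1r invr_eq0 gt_eqF //= -leNgt; apply: le_trans (dk v).
by rewrite lerD2l lerN2.
Qed.

End MainStability.

(** * Matchings *)

Section Matchings.
Variable V : finType.
Implicit Types (E : {set {set V}}) (e f T U X Y : {set V}) (u v : V).

Definition has_matching t E := exists M : 'I_t -> {set V},
  (forall i, M i \in E) /\ (forall i j, i != j -> [disjoint M i & M j]).

Lemma has_matchingS t E f : f \in E ->
  has_matching t [set e in E | [disjoint f & e]] -> has_matching t.+1 E.
Proof.
move=> fE [M [ME Md]].
exists (fun i => if unlift ord0 i is Some j then M j else f); split.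
  move=> i; case: unliftP => [j _|_] //.
  by have := ME j; rewrite inE => /andP[].
have fM j : [disjoint f & M j] by have := ME j; rewrite inE => /andP[].
move=> i j; case: unliftP => [i' ->|->]; case: unliftP => [j' ->|->] ij.
- by apply: Md; apply: contraNneq ij => ->.
- by rewrite disjoint_sym.
- by [].
- by rewrite eqxx in ij.
Qed.

Lemma has_matching_sub t E E' : E \subset E' -> has_matching t E -> has_matching t E'.
Proof. by move=> /subsetP EE [M [ME Md]]; exists M; split=> // i; apply: EE. Qed.

Lemma has_matching0 E : has_matching 0 E.
Proof. by exists (fun=> set0); split=> -[]. Qed.

Lemma complete_matching t k E Y : complete_on k E Y -> (k * t <= #|Y|)%N -> has_matching t E.
Proof.
elim: t E Y => [|t IH] E Y cY; first by move=> _; exact: has_matching0.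
rewrite mulnS => kY.
have [||f [_ fY fk]] := @subset_between V set0 Y k; first exact: sub0set.
  by rewrite cards0 /= (leq_trans _ kY) // leq_addr.
apply: (@has_matchingS _ _ f); first exact: cY.
apply: (IH _ (Y :\: f)).
  move=> e eY ek; move: eY; rewrite subsetD inE disjoint_sym => /andP[eY ->].
  by rewrite cY.
by rewrite cardsD (setIidPr fY) fk leq_subRL // (leq_trans _ kY) // leq_addr.
Qed.

(** An edge leaving [K] meets it in at most k - 1 vertices; the vertices left in [K], at least k t
    of them, carry [t] disjoint edges. *)
Lemma complete_absorbs t k E K e : complete_on k E K -> #|K| = (k * t.+1).-1 -> (0 < k)%N ->
  ~ has_matching t.+1 E -> e \in E -> #|e| = k -> e \subset K.
Proof.
move=> cK Kc k0 nm eE ek; apply/negPn/negP => eK; apply: nm.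
apply: (has_matchingS eE); apply: (@complete_matching _ k _ (K :\: e)).
  move=> f fK fk; move: fK; rewrite subsetD inE disjoint_sym => /andP[fK ->].
  by rewrite cK.
have lt : (#|K :&: e| < k)%N.
  rewrite -ek; apply: proper_card; rewrite properE subsetIr /=.
  by apply: contra eK => /subset_trans; apply; apply: subsetIl.
rewrite cardsD Kc mulnS; move: lt k0; clear; move: #|_| => a; lia.
Qed.

(** A first block containing [u] but not [v] leaves only blocks that avoid [u]. *)
Lemma separated_matching t k E X u v : (0 < k)%N -> (2 <= t)%N -> #|X| = (k * t)%N ->
  u \in X -> v \in X -> u != v ->
  (forall e, e \subset X -> #|e| = k -> ~~ ((u \in e) && (v \in e)) -> e \in E) ->
  has_matching t E.
Proof.
case: t => [|[|t]] // k0 _ Xc uX vX uv h.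
have [||f [uf fX fk]] := @subset_between V [set u] (X :\ v) k.
- by rewrite sub1set !inE uv uX.
- by rewrite cards1 k0; move: Xc; rewrite (cardsD1 v) vX !mulnS; move: k0; clear; lia.
move: fX; rewrite subsetD1 => /andP[fX vf].
apply: (@has_matchingS _ _ f); first by apply: h; rewrite // (negbTE vf) andbF.
apply: (@complete_matching _ k _ (X :\: f)).
  move=> e eX ek; move: eX; rewrite subsetD inE disjoint_sym => /andP[eX fe].
  rewrite fe h //; apply/negP => /andP[ue _].
  by have := disjointFr fe (subsetP uf u (set11 u)); rewrite ue.
by rewrite cardsD (setIidPr fX) fk Xc [(k * t.+2)%N]mulnS addKn.
Qed.

End Matchings.

(** * Shifting towards heavy vertices *)

Section Shifting.
Variable V : finType.
Implicit Types (E : {set {set V}}) (e f T U X Y : {set V}) (u v : V).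

Definition swap u v e : {set V} := tperm u v @: e.

Lemma swapK u v : involutive (swap u v).
Proof.
move=> e; rewrite /swap -imset_comp -[RHS]imset_id; apply: eq_imset => i /=.
exact: tpermK.
Qed.

Lemma card_swap u v e : #|swap u v e| = #|e|.
Proof. by rewrite card_imset //; exact: perm_inj. Qed.

Lemma mem_swap u v e i : (i \in swap u v e) = (tperm u v i \in e).
Proof. by rewrite /swap -{1}(tpermK u v i) mem_imset //; exact: perm_inj. Qed.

Lemma swap_id u v e : u \notin e -> v \notin e -> swap u v e = e.
Proof.
move=> ue ve; apply/setP => i; rewrite mem_swap.
by case: tpermP => [->|->|] //; rewrite (negbTE ue) (negbTE ve).
Qed.

Lemma swapE u v e : v \in e -> u \notin e -> swap u v e = u |: e :\ v.
Proof.
move=> ve ue; apply/setP => i; rewrite mem_swap !inE.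
case: tpermP => [->|->|/eqP/negbTE -> /eqP/negbTE ->] //; first by rewrite ve eqxx.
by rewrite (negbTE ue) eqxx /= orbF; apply/esym/negbTE; apply: contraNneq ue => <-.
Qed.

Lemma disjoint_swap u v e f : [disjoint swap u v e & swap u v f] = [disjoint e & f].
Proof.
have key e' f' : [disjoint e' & f'] -> [disjoint swap u v e' & swap u v f'].
  move=> d; rewrite disjoint_subset; apply/subsetP => i; rewrite inE /= !mem_swap => ie.
  by rewrite (disjointFr d ie).
by apply/idP/idP => [/key|/key //]; rewrite !swapK.
Qed.

Definition moved u v E e := [&& v \in e, u \notin e & swap u v e \notin E].
Definition shift_edge u v E e := if moved u v E e then swap u v e else e.
Definition shift u v E := [set shift_edge u v E e | e in E].

Lemma shift_edge_inj u v E : {in E &, injective (shift_edge u v E)}.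
Proof.
move=> e f eE fE; rewrite /shift_edge.
case: ifP => [/and3P[_ _ se]|_]; case: ifP => [/and3P[_ _ sf]|_] //.
- exact: inv_inj (swapK u v) _ _.
- by move=> ef; rewrite ef fE in se.
- by move=> ef; rewrite -ef eE in sf.
Qed.

(** If the matching uses an edge outside [E], that edge was shifted and contains [u], so all others
    avoid [u]; those containing [v] were left in place because their swap lies in [E]. Swapping [u]
    and [v] throughout therefore gives a matching in [E]. *)
Lemma shift_matching t u v E : ~ has_matching t E -> ~ has_matching t (shift u v E).
Proof.
move=> nm [M [ME Md]]; apply: nm.
have disj i j a : a \in M i -> a \in M j -> i = j.
  by move=> ai aj; apply/eqP/negPn/negP => /Md d; rewrite (disjointFr d ai) in aj.
have ex i : exists2 e, e \in E & M i = shift_edge u v E e by apply/imsetP/ME.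
case: (pickP [pred i | M i \notin E]) => [i0 /= Mi0|allE]; last first.
  by exists M; split=> // i; have := allE i => /= /negbT; rewrite negbK.
have [e0 e0E Me0] := ex i0.
have mv0 : moved u v E e0 by apply: contraNT Mi0 => h; rewrite Me0 /shift_edge (negbTE h).
have Mi0' : M i0 = swap u v e0 by rewrite Me0 /shift_edge mv0.
have [ve0 ue0 se0] := and3P mv0.
have uM0 : u \in M i0 by rewrite Mi0' mem_swap tpermL.
have vM0 : v \notin M i0 by rewrite Mi0' mem_swap tpermR.
exists (fun i => swap u v (M i)); split=> [i|i j ij]; last by rewrite disjoint_swap Md.
have [->|ii0] := eqVneq i i0; first by rewrite Mi0' swapK.
have uM : u \notin M i by apply: contra ii0 => uM; apply/eqP/(disj _ _ u).
have [e eE Me] := ex i.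
have nmv : ~~ moved u v E e.
  apply/negP => mv; have := uM; rewrite Me /shift_edge mv mem_swap tpermL.
  by case/and3P: mv => ->.
have Mie : M i = e by rewrite Me /shift_edge (negbTE nmv).
have [vM|vM] := boolP (v \in M i); last by rewrite swap_id // Mie.
by move: nmv; rewrite /moved -Mie vM uM /= negbK.
Qed.

Lemma swap_eq u v e : u != v -> v \in e -> u \notin e -> swap u v e :\ u = e :\ v.
Proof.
move=> uv ve ue; rewrite swapE // setU1K // !inE negb_and (negbTE ue) orbT //.
Qed.

Variable rho : V -> nat.

(** Small rank will stand for large weight, so edges move towards heavier vertices. *)
Definition shifted T E := forall u v e, u \in T -> v \in T -> (rho u < rho v)%N -> e \in E ->
  v \in e -> u \notin e -> swap u v e \in E.

Lemma shiftedP T E : reflect (shifted T E) [forall u in T, forall v in T, forall e in E,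
  [&& (rho u < rho v)%N, v \in e & u \notin e] ==> (swap u v e \in E)].
Proof.
apply: (iffP forall_inP) => [h u v e uT vT uv eE ve ue|h u uT].
  have /forall_inP/(_ v vT)/forall_inP/(_ e eE)/implyP := h u uT.
  by apply; rewrite uv ve ue.
apply/forall_inP => v vT; apply/forall_inP => e eE; apply/implyP => /and3P[uv ve ue].
exact: h.
Qed.

(** Every effective shift lowers the sum of the ranks over all edges, so the process ends; it
    replaces a weight by one at least as large, so the polynomial does not decrease. *)
Lemma shifting (R : realFieldType) t k T E (x : V -> R) : nneg x ->
  (forall u v, u \in T -> v \in T -> (rho u < rho v)%N -> x v <= x u) ->
  uniform k E -> (forall e, e \in E -> e \subset T) -> ~ has_matching t E ->
  exists E', [/\ uniform k E' /\ (forall e, e \in E' -> e \subset T), ~ has_matching t E',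
    pol (ind E) x <= pol (ind E') x & shifted T E'].
Proof.
move=> x0 xrho; have [n] := ubnP (\sum_(e in E) \sum_(i in e) rho i)%N.
elim: n E => // n IH E; rewrite ltnS => le_n Ek ET nm.
have [/shiftedP sh|] := boolP [forall u in T, forall v in T, forall e in E,
  [&& (rho u < rho v)%N, v \in e & u \notin e] ==> (swap u v e \in E)].
  by exists E.
rewrite negb_forall_in => /exists_inP[u uT]; rewrite negb_forall_in => /exists_inP[v vT].
rewrite negb_forall_in => /exists_inP[e0 e0E]; rewrite negb_imply => /andP[/and3P[uv ve0 ue0] se0].
have nuv : u != v by apply: contraTneq uv => ->; rewrite ltnn.
have mv0 : moved u v E e0 by apply/and3P.
have [|||| E' [Ek' nm' le' sh]] := IH (shift u v E).
- rewrite big_imset /=; last exact: shift_edge_inj.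
  apply: leq_trans le_n; rewrite (bigD1 e0) //= [X in (_ < X)%N](bigD1 e0) //=.
  have lt e : moved u v E e -> (\sum_(i in swap u v e) rho i < \sum_(i in e) rho i)%N.
    move=> /and3P[ve ue _]; have us : u \in swap u v e by rewrite mem_swap tpermL.
    by rewrite (big_setD1 u us) [X in (_ < X)%N](big_setD1 v ve) /= swap_eq // ltn_add2r.
  rewrite -addSn leq_add //; first by rewrite /shift_edge mv0 lt.
  by apply: leq_sum => e _; rewrite /shift_edge; case: ifP => // /lt /ltnW.
- by move=> _ /imsetP[e eE ->]; rewrite /shift_edge; case: ifP => _; rewrite ?card_swap Ek.
- move=> _ /imsetP[e eE ->]; rewrite /shift_edge; case: ifP => [/and3P[ve ue _]|_]; last exact: ET.
  by rewrite swapE // subUset sub1set uT (subset_trans (subD1set _ _)) ?ET.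
- exact: shift_matching.
exists E'; split=> //; apply: le_trans le'; rewrite !polE big_imset /=; last exact: shift_edge_inj.
apply: ler_sum => e _; rewrite /shift_edge; case: ifP => // /and3P[ve ue _].
have us : u \in swap u v e by rewrite mem_swap tpermL.
by rewrite (monD1 _ ve) (monD1 _ us) swap_eq // ler_wpM2r ?mon_ge0 // xrho.
Qed.

(** [y] and [z] have the two largest ranks, so exchanging them one at a time for elements of [f]
    outside [e] is always a legal shift. *)
Lemma shift_chain T E e f y z : shifted T E -> f \subset T -> (forall e, e \in E -> e \subset T) ->
  (forall i, i \in T -> i != y -> i != z -> (rho i < rho y)%N) -> (rho y <= rho z)%N ->
  e \in E -> #|e| = #|f| -> e :\: f \subset [set y; z] -> [disjoint f :\: e & [set y; z]] -> f \in E.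
Proof.
move=> sh fT ET top yz; have [n] := ubnP #|e :\: f|; elim: n e => // n IH e; rewrite ltnS.
move=> le_n eE ef e_yz f_yz.
have [/eqP|] := posnP #|e :\: f|.
  rewrite cards_eq0 setD_eq0 => sub; have -> : f = e; last by [].
  by apply/eqP; rewrite eq_sym eqEcard sub ef leqnn.
case/card_gt0P => v /[!inE] /andP[vf ve].
have /card_gt0P[u] : (0 < #|f :\: e|)%N.
  have := cardsID f e; have := cardsID e f; rewrite setIC ef => <- /eqP.
  rewrite eqn_add2l => /eqP <-; apply/card_gt0P; exists v.
  by rewrite inE vf ve.
rewrite inE => /andP[ue uf].
have uyz : u \notin [set y; z].
  by apply/negP => h; have := disjointFl f_yz h; rewrite inE ue uf.
have vyz : v \in [set y; z] by rewrite (subsetP e_yz) // inE vf ve.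
have uv : (rho u < rho v)%N.
  move: uyz; rewrite !inE negb_or => /andP[uy uz].
  have lt := top u (subsetP fT _ uf) uy uz.
  by move: vyz; rewrite !inE => /orP[]/eqP ->; rewrite // (leq_trans lt).
have sE : swap u v e \in E.
  by apply: (sh u v) => //; [exact: (subsetP fT) | exact: (subsetP (ET e eE))].
apply: (IH (swap u v e)) => //.
- apply: leq_trans le_n; apply: proper_card; apply/properP; split; last first.
    exists v; rewrite !inE ?vf ?ve // swapE // !inE eqxx /=.
    by rewrite orbF; apply: contraNneq ue => <-.
  apply/subsetP => i; rewrite swapE // !inE => /andP[fi /predU1P[iu|/andP[_ ->]]].
    by rewrite iu uf in fi.
  by rewrite fi.
- by rewrite card_swap.
- apply: subset_trans e_yz; apply/subsetP => i; rewrite swapE // !inE => /andP[fi /predU1P[iu|/andP[_ ->]]].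
    by rewrite iu uf in fi.
  by rewrite fi.
- apply: disjointWl f_yz; apply/subsetP => i; rewrite swapE // !inE negb_or negb_and negbK.
  move=> /andP[/andP[iu /orP[/eqP iv|->]] fi] //.
  by rewrite iv (negbTE vf) in fi.
Qed.

End Shifting.

Section Peeling.
Variable V : finType.
Implicit Types (E : {set {set V}}) (e f T U X Y : {set V}) (u v : V).

Lemma weight_rank (R : realFieldType) (x : V -> R) : exists rho : V -> nat,
  injective rho /\ forall u v, (rho u < rho v)%N -> x v <= x u.
Proof.
pose s := sort (fun a b => x b <= x a) (enum V).
have ms v : v \in s by rewrite mem_sort mem_enum.
exists (fun v => index v s); split=> [u v uv|u v uv].
  by rewrite -(nth_index u (ms u)) uv nth_index.
have tr : transitive (fun a b => x b <= x a) by move=> b a c /= ba cb; exact: le_trans ba.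
have so : sorted (fun a b => x b <= x a) s by apply: sort_sorted => a b; exact: le_total.
by have := sorted_ltn_index tr so; apply=> //; exact: uv.
Qed.

Lemma top_two (rho : V -> nat) T : injective rho -> (2 <= #|T|)%N -> exists y z,
  [/\ y \in T, z \in T, y != z, (rho y < rho z)%N &
   forall i, i \in T -> i != y -> i != z -> (rho i < rho y)%N].
Proof.
move=> rinj T2; have [z0 z0T] : exists z0, z0 \in T by apply/card_gt0P; exact: leq_trans T2.
pose z := [arg max_(i > z0 in T) rho i].
have [zT zmax] : z \in T /\ forall i, i \in T -> (rho i <= rho z)%N.
  by rewrite /z; case: arg_maxnP => // i iT h; split=> // j /h.
have [y0 y0T] : exists y0, y0 \in T :\ z.
  by apply/card_gt0P; move: T2; rewrite (cardsD1 z) zT.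
pose y := [arg max_(i > y0 in T :\ z) rho i].
have [yT ymax] : y \in T :\ z /\ forall i, i \in T :\ z -> (rho i <= rho y)%N.
  by rewrite /y; case: arg_maxnP => // i iT h; split=> // j /h.
have lt a b : a != b -> (rho a <= rho b)%N -> (rho a < rho b)%N.
  by move=> ab; rewrite leq_eqVlt => /predU1P[/rinj /eqP|//]; rewrite (negbTE ab).
have /setD1P[yz yT'] := yT; exists y, z; split=> //; first by rewrite lt ?zmax.
by move=> i iT iy iz; apply: lt => //; apply: ymax; rewrite !inE iz.
Qed.

(** If some edge contains the two lightest vertices, then by shifting every k-set in [T] through the
    heaviest vertex [o] is an edge. A matching of size [t] avoiding [o] would leave room in [T] for
    one more edge through [o]. *)
Lemma peel rho k t T E y z : injective rho -> shifted rho T E -> uniform k E ->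
  (forall e, e \in E -> e \subset T) -> (1 < k <= 3)%N -> (k * t.+1 <= #|T|)%N ->
  y \in T -> z \in T -> y != z -> (rho y < rho z)%N ->
  (forall i, i \in T -> i != y -> i != z -> (rho i < rho y)%N) ->
  ~ has_matching t.+1 E ->
  (forall e, e \in E -> y \in e -> z \in e -> False) \/
  exists2 o, o \in T & (forall i, i \in T -> (rho o <= rho i)%N) /\
    ~ has_matching t [set e in E | o \notin e].
Proof.
move=> rinj sh Ek ET /andP[k1 k3] kT yT zT yz ryz top nm.
case: (pickP [pred e in E | (y \in e) && (z \in e)]) => [e /and3P[eE ye ze]|h]; last first.
  by left=> e eE ye ze; have := h e; rewrite /= eE ye ze.
right; pose o := [arg min_(i < y in T) rho i].
have [oT omin] : o \in T /\ forall i, i \in T -> (rho o <= rho i)%N.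
  by rewrite /o; case: arg_minnP => // i iT hi; split=> // j /hi.
exists o => //; split=> //.
case: t kT nm => [|t] kT nm; first by case: nm; apply: has_matchingS eE (has_matching0 _).
have T3 : (3 <= #|T|)%N by apply: leq_trans kT; rewrite mulnS; move: k1; clear; lia.
have [w wT] : exists w, w \in T :\ y :\ z.
  apply/card_gt0P; have zTy : z \in T :\ y by rewrite !inE eq_sym yz.
  by move: T3; rewrite (cardsD1 y) yT (cardsD1 z (T :\ y)) zTy.
have /setD1P[wz /setD1P[wy wT']] := wT.
have roy : (rho o < rho y)%N by apply: leq_ltn_trans (omin w wT') (top w wT' wy wz).
have oy : o != y by apply: contraTneq roy => ->; rewrite ltnn.
have oz : o != z by apply: contraTneq (ltn_trans roy ryz) => ->; rewrite ltnn.
(* Uniformity at most 3 is decisive: either the edge is the pair itself, or its third vertex is [o]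
   or can be shifted to [o]. *)
have [e1 [e1E e1o ye1 ze1]] : exists e1, [/\ e1 \in E, e1 \subset [set o; y; z], y \in e1 & z \in e1].
  have [sub|/subsetPn[a ae]] := boolP (e \subset [set y; z]).
    by exists e; split=> //; apply: subset_trans sub _; rewrite -setUA subsetUr.
  rewrite !inE negb_or => /andP[ay az].
  have oyz3 : #|[set o; y; z]| = 3.
    by rewrite -setUA cardsU1 cards2 !inE negb_or oy oz yz.
  have full3 e' : e' \in E -> o \in e' -> y \in e' -> z \in e' -> e' \subset [set o; y; z].
    move=> e'E oe ye' ze'; suff -> : [set o; y; z] = e' by [].
    apply/eqP; rewrite eqEcard (Ek e' e'E) oyz3 k3 andbT.
    by rewrite !subUset !sub1set oe ye' ze'.
  have [oe|oe] := boolP (o \in e); first by exists e; split=> //; exact: full3.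
  have aT : a \in T by exact: (subsetP (ET e eE)).
  have oa : o != a by apply: contraNneq oe => ->.
  have roa : (rho o < rho a)%N.
    by rewrite ltn_neqAle omin // andbT; apply: contraNneq oa => /rinj ->.
  have sE : swap o a e \in E by apply: sh.
  have ys : y \in swap o a e by rewrite swapE // !inE (eq_sym y a) ay ye orbT.
  have zs : z \in swap o a e by rewrite swapE // !inE (eq_sym z a) az ze orbT.
  exists (swap o a e); split=> //; apply: full3 => //.
  by rewrite mem_swap tpermL.
have star f : f \subset T -> #|f| = k -> o \in f -> f \in E.
  move=> fT fk of_; apply: (shift_chain sh fT ET top (ltnW ryz) e1E); first by rewrite Ek.
    apply/subsetP => i /setDP[ie nf]; have := subsetP e1o i ie.
    by rewrite !inE -orbA => /predU1P[io|//]; rewrite io of_ in nf.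
  rewrite disjoint_subset; apply/subsetP => i; rewrite !inE => /andP[ie _].
  by apply: contra ie => /orP[]/eqP ->.
move=> [M [ME Md]]; apply: nm.
pose U := \bigcup_(i < t.+1) M i.
have Uk : (#|U| <= k * t.+1)%N.
  rewrite mulnC -[X in (_ <= X * _)%N]card_ord -sum_nat_const.
  apply: leq_trans (_ : (\sum_(i < t.+1) #|M i| <= _)%N).
    rewrite /U; elim/big_rec2: _ => [|i n Y _ IH]; first by rewrite cards0.
    by apply: leq_trans (leq_card_setU _ _) _; rewrite leq_add2l.
  by apply: leq_sum => i _; have := ME i; rewrite inE => /andP[/Ek ->].
have oU : o \notin U.
  by apply/negP => /bigcupP[i _ oM]; have := ME i; rewrite inE oM andbF.
have [||f [of_ fU fk]] := @subset_between V [set o] (T :\: U) k.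
- by rewrite sub1set inE oU oT.
- rewrite cards1 (ltnW k1) /= cardsD.
  have : (#|T :&: U| <= k * t.+1)%N by apply: leq_trans Uk; apply: subset_leq_card; exact: subsetIr.
  by move: kT; rewrite [(k * t.+2)%N]mulnS; clear; lia.
move: fU; rewrite subsetD => /andP[fT fU].
apply: (@has_matchingS _ _ _ f); first by apply: star => //; rewrite (subsetP of_) ?set11.
exists M; split=> // i; rewrite inE; have := ME i; rewrite inE => /andP[-> _] /=.
by apply: disjointWr fU; apply: (bigcup_sup i).
Qed.

End Peeling.

Section PeelGap.
Variable R : realFieldType.

Lemma lam_graph t : (0 < t)%N -> lam R (2 * t).-1 2 = (t%:R - 1) / (2 * t%:R - 1).
Proof.
case: t => // t _; have -> : (2 * t.+1).-1 = (2 * t).+1 by rewrite mulnS.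
have t0 : 0 <= t%:R :> R by rewrite ler0n.
rewrite /lam; have : 2 * 'C((2 * t).+1, 2)%:R = (2 * t).+1%:R * (2 * t)%:R :> R.
  by rewrite -!natrM -[(2 * 'C(_, _))%N]mul_bin_diag bin1.
rewrite -!natr1 natrM => h.
have -> : 'C((2 * t).+1, 2)%:R = (2 * t%:R + 1) * t%:R :> R by lra.
by field; do ?(apply/andP; split); apply: lt0r_neq0; lra.
Qed.

Lemma lam_triple t : (0 < t)%N ->
  lam R (3 * t).-1 3 = (3 * t%:R - 2) * (t%:R - 1) / (2 * (3 * t%:R - 1) ^+ 2).
Proof.
case: t => // t _; have -> : (3 * t.+1).-1 = (3 * t).+2 by rewrite mulnS.
have t0 : 0 <= t%:R :> R by rewrite ler0n.
rewrite /lam; have : 6 * 'C((3 * t).+2, 3)%:R = (3 * t).+2%:R * ((3 * t).+1%:R * (3 * t)%:R) :> R.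
  rewrite -!natrM; congr (_%:R); have h1 := mul_bin_diag (3 * t).+2 2.
  have h2 := mul_bin_diag (3 * t).+1 1; rewrite bin1 /= in h1 h2.
  by move: h1 h2; rewrite /=; nia.
rewrite -!natr1 natrM => h.
have -> : 'C((3 * t).+2, 3)%:R = (3 * t%:R + 2) * (3 * t%:R + 1) * t%:R / 2 :> R by lra.
by field; do ?(apply/andP; split); apply: lt0r_neq0; lra.
Qed.

(** [a] stands for the weight of the heaviest vertex: edges through it weigh at most the first term,
    the others contain no matching of size [t] and live on weight 1 - a. The target is the
    Lagrangian for forbidden matchings of size t + 1. *)
Definition peel_gap k t := exists2 d : R, 0 < d & forall a : R, 0 <= a <= 1 ->
  a * ((1 - a) ^+ k.-1 / (k.-1)`!%:R) + lam R (k * t).-1 k * (1 - a) ^+ k <= lam R (k * t.+1).-1 k - d.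

(** The left-hand side is quadratic in a, and the chosen constant is the exact distance to the
    target from its maximum, at 1 - a = (2T - 1)/(2T). The difference is then a positive multiple of
    a square. *)
Lemma peel_gap2 t : (0 < t)%N -> peel_gap 2 t.
Proof.
move=> t0; have T1 : 1 <= t%:R :> R by rewrite ler1n.
rewrite /peel_gap !lam_graph // -[t.+1%:R]natr1; set T := t%:R in T1 *.
exists (4 * T * (2 * T + 1))^-1; first by rewrite invr_gt0 !mulr_gt0; lra.
move=> a _; rewrite -[(2.-1)`!]/1%N -subr_ge0.
rewrite [leRHS](_ : _ = T / (2 * T - 1) * (1 - a - (2 * T - 1) / (2 * T)) ^+ 2).
  by rewrite mulr_ge0 ?sqr_ge0 // divr_ge0; lra.
  by field; do ?(apply/andP; split); apply: lt0r_neq0; lra.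
Qed.

(* With b = 1 - a the left-hand side is b^2/2 - nu b^3, whose maximum over
   b >= 0 is 1 / (54 nu^2), attained at b = 1 / (3 nu). *)
Lemma peel_gap3 t : (0 < t)%N -> peel_gap 3 t.
Proof.
move=> t0; have T1 : 1 <= t%:R :> R by rewrite ler1n.
rewrite /peel_gap !lam_triple // -[t.+1%:R]natr1; set T := t%:R in T1 *.
pose nu := (2 * T - 1) * (3 * T + 1) / (2 * (3 * T - 1) ^+ 2).
have nu0 : 0 < nu by rewrite divr_gt0 ?mulr_gt0 ?exprn_gt0 //; lra.
pose l := (3 * (T + 1) - 2) * (T + 1 - 1) / (2 * (3 * (T + 1) - 1) ^+ 2).
exists (l - (54 * nu ^+ 2)^-1).
  rewrite subr_gt0 /l /nu.
  have -> : (54 * ((2 * T - 1) * (3 * T + 1) / (2 * (3 * T - 1) ^+ 2)) ^+ 2)^-1 =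
    (2 * (3 * T - 1) ^+ 4) / (27 * (2 * T - 1) ^+ 2 * (3 * T + 1) ^+ 2).
    by field; do ?(apply/andP; split); apply: lt0r_neq0; lra.
  rewrite ltr_pdivrMr; last by rewrite !mulr_gt0 ?exprn_gt0 //; lra.
  rewrite mulrAC ltr_pdivlMr; last by rewrite !mulr_gt0 ?exprn_gt0 //; lra.
  (* Written in u = T - 1, the difference has only positive coefficients. *)
  rewrite -subr_gt0; have [u uE] : exists u, T = 1 + u by exists (T - 1); ring.
  have u0 : 0 <= u by lra.
  have -> : (3 * (T + 1) - 2) * (T + 1 - 1) * (27 * (2 * T - 1) ^+ 2 * (3 * T + 1) ^+ 2) -
      2 * (3 * T - 1) ^+ 4 * (2 * (3 * (T + 1) - 1) ^+ 2) =
      729 * u ^+ 4 + 2349 * u ^+ 3 + 2484 * u ^+ 2 + 1008 * u + 128 by rewrite uE; ring.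
  by rewrite ltr_wpDl // !addr_ge0 // mulr_ge0 // exprn_ge0.
move=> a /andP[a0 a1]; rewrite [leRHS](_ : _ = (54 * nu ^+ 2)^-1); last exact: subKr.
rewrite -subr_ge0.
have -> : (3 * T - 2) * (T - 1) / (2 * (3 * T - 1) ^+ 2) = 1 / 2 - nu.
  by rewrite /nu; field; do ?(apply/andP; split); apply: lt0r_neq0; lra.
have nz : nu != 0 by exact: lt0r_neq0.
rewrite -[(3.-1)`!]/2%N.
rewrite [leRHS](_ : _ = nu * (1 - a - (3 * nu)^-1) ^+ 2 * (1 - a + (6 * nu)^-1)); last by field.
apply: mulr_ge0; first by rewrite mulr_ge0 ?sqr_ge0 // ltW.
by apply: addr_ge0; rewrite ?subr_ge0 // invr_ge0 mulr_ge0 // ltW.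
Qed.

End PeelGap.

(** * Lagrangians of hypergraphs without a large matching *)

Section NearComplete.
Variable R : realFieldType.

(** Stability gives every vertex of [K] weight at least 1/(2q), so a k-set missing from [E] costs
    [w]. The vertices outside [K] have mass at most c/l and cannot compensate, because c + c/l <=
    w. *)
Lemma near_complete q k : (2 <= k)%N -> (k <= q)%N -> exists2 c : R, 0 < c &
  forall (V : finType) (E : {set {set V}}) (K : {set V}) (x : V -> R), uniform k E ->
    nneg x -> tot x = 1 -> (#|K| <= q)%N -> lam R q k - c < e_ K k x ->
    lam R q k - c < pol (ind E) x -> #|K| = q /\ complete_on k E K.
Proof.
move=> k2 kq; have [c1 c10 H] := full_stability R k2 kq.
have q0 : (0 < q)%N by apply: leq_trans kq; exact: ltnW.
have l0 : 0 < lam R q k by exact: lam_gt0.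
set l := lam R q k in l0 H *.
have w0 : 0 < (2 * q%:R)^-1 :> R by rewrite invr_gt0 mulr_gt0 // ltr0n.
pose w := ((2 * q%:R)^-1 : R) ^+ k; have w00 : 0 < w by rewrite exprn_gt0.
pose c := Num.min c1 (w * l / (1 + l)).
have l1 : 0 < 1 + l by rewrite addr_gt0.
have c0 : 0 < c by rewrite lt_min c10 divr_gt0 // mulr_gt0.
have cw : c + c / l <= w.
  have : c <= w * l / (1 + l) by rewrite ge_min lexx orbT.
  rewrite ler_pdivlMr // => h; rewrite -(ler_pM2r l0) mulrDl divfK ?gt_eqF //.
  by rewrite addrC -[X in X + _]mulr1 -mulrDr.
exists c => // V E K x Ek x0 x1 Kq lt_e lt_p.
have s1 : \sum_(i in K) x i <= 1.
  by rewrite -x1 /tot [leRHS](bigID (mem K)) /= lerDl sumr_ge0.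
have [|Kc wK] := H V K x x0 s1 Kq.
  by apply: le_lt_trans lt_e; rewrite lerD2l lerN2 ge_min lexx.
split=> // e eK ek; apply/negPn/negP => eE.
have k0 : (0 < k)%N by exact: ltnW.
have h1 : pol (ind [set f in E | f \subset K]) x + w <= e_ K k x.
  rewrite (polID (full K k) (fun f => f \in E)); apply: lerD.
    apply: pol_le => // f; rewrite /ind ler_nat !inE.
    by case: (boolP (f \in E)) => // fE; rewrite (Ek f fE) eqxx andbT andbT.
  have := pol_ge_mon e x0 (ind_ge0 R [set f in full K k | f \notin E]).
  apply: le_trans; rewrite /ind !inE eK ek eqxx eE mul1r /w -ek.
  by apply: mon_ge; [exact: ltW | move=> i /(subsetP eK) /wK].
have h2 : pol (ind [set f in E | ~~ (f \subset K)]) x <= \sum_(i in ~: K) x i.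
  have uE : unif k (ind [set f in E | ~~ (f \subset K)] : _ -> R).
    by apply: unif_ind => f; rewrite inE => /andP[/Ek].
  apply: le_trans (pol_le_cover (P := ~: K) x0 (ind_ge0 R _) _) _.
    move=> f _; rewrite /ind pnatr_eq0 eqb0 negbK inE => /andP[_ /subsetPn[i fi iK]].
    by exists i => //; rewrite inE.
  apply: ler_sum => i _; rewrite ler_piMr // dpol_link.
  case: (k) k0 uE => // k' _ uE; apply: (pol_le1 (unif_link uE)); rewrite ?x1 // => f.
  by rewrite /link /ind; case: ifP => // _; rewrite lern1; case: (_ \in _).
have h3 : e_ K k x <= l * \sum_(i in K) x i.
  apply: le_trans (full_lam x0 Kq k0) _; apply: ler_wpM2l; first exact: ltW.
  by rewrite -[leRHS]expr1 ler_wiXn2l // sumr_ge0.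
have h3' : e_ K k x <= l by apply: le_trans h3 _; rewrite ler_piMr // ltW.
have h4 : \sum_(i in ~: K) x i = 1 - \sum_(i in K) x i.
  rewrite -x1 /tot [X in _ = X - _](bigID (mem K)) /= addrAC subrr add0r.
  by apply: eq_bigl => i; rewrite inE.
have h5 : 1 - \sum_(i in K) x i <= c / l.
  rewrite ler_pdivlMr // mulrBl mul1r lerBlDr addrC -lerBlDr mulrC.
  exact: le_trans (ltW lt_e) h3.
have : pol (ind E) x <= l - c.
  rewrite (polID E (fun f => f \subset K)); apply: le_trans (lerD (lexx _) h2) _.
  rewrite h4; apply: le_trans (lerD (lexx _) h5) _.
  rewrite -lerBrDr; apply: le_trans (_ : e_ K k x - w <= _); first by rewrite lerBrDr.
  apply: le_trans (lerD h3' (lexx _)) _; rewrite -addrA lerD2l -opprD lerN2.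
  exact: cw.
by rewrite leNgt lt_p.
Qed.

End NearComplete.

Section MatchingLagrangian.
Variable R : realFieldType.

Definition matching_bound k t := forall (V : finType) (E : {set {set V}}) (x : V -> R),
  uniform k E -> ~ has_matching t E -> nneg x ->
  pol (ind E) x <= lam R (k * t).-1 k * tot x ^+ k.

Definition matching_stable k t (c : R) :=
  forall (V : finType) (E : {set {set V}}) (T : {set V}) (x : V -> R),
    uniform k E -> (forall e, e \in E -> e \subset T) -> ~ has_matching t E ->
    nneg x -> supp x \subset T -> tot x = 1 -> lam R (k * t).-1 k - c < pol (ind E) x ->
    exists2 K : {set V}, K \subset T & #|K| = (k * t).-1 /\ complete_on k E K.

Lemma matching_bound1 k : (0 < k)%N -> matching_bound k 1.
Proof.
move=> k0 V E x Ek nm x0; rewrite polE big1 => [|e eE].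
  by rewrite mulr_ge0 ?lam_ge0 // exprn_ge0 // sumr_ge0.
by case: nm; apply: has_matchingS eE (has_matching0 _).
Qed.

Lemma merge_uncovered (V : finType) (E : {set {set V}}) (T : {set V}) (x : V -> R) y z : nneg x ->
  supp x \subset T -> y \in T -> z \in T -> y != z ->
  (forall e, e \in E -> y \in e -> z \in e -> False) ->
  exists b x', [/\ b \in T, nneg x', tot x' = tot x, supp x' \subset T :\ b &
    pol (ind E) x <= pol (ind E) x'].
Proof.
move=> x0 xT yT zT yz unc.
have out b : b \in T -> b \notin supp x -> exists b x', [/\ b \in T, nneg x', tot x' = tot x,
    supp x' \subset T :\ b & pol (ind E) x <= pol (ind E) x'].
  by move=> bT bx; exists b, x; split=> //; rewrite subsetD1 xT.
have [yx|/(out y yT) //] := boolP (y \in supp x).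
have [zx|/(out z zT) //] := boolP (z \in supp x).
have [|a [b [ab y0 ys le]]] := @merge R V (ind E) x y z x0 yz yx zx.
  by move=> e ye ze _; rewrite /ind; case: (boolP (e \in E)) => // eE; case: (unc e).
exists b, (mv x a b (x b)); split=> //.
- by case: ab => -[_ ->].
- by rewrite tot_mv //; case: ab => -[-> ->] //; rewrite eq_sym.
- exact: subset_trans ys (setSD _ xT).
Qed.

Definition erase (V : finType) (o : V) (x : V -> R) i := if i == o then 0 else x i.

Lemma erase_ge0 (V : finType) (o : V) (x : V -> R) : nneg x -> nneg (erase o x).
Proof. by move=> x0 i; rewrite /erase; case: ifP. Qed.

Lemma tot_erase (V : finType) (o : V) (x : V -> R) : tot (erase o x) = tot x - x o.
Proof.
rewrite /tot [X in _ = X - _](bigD1 o) //= addrAC subrr add0r big_mkcond [RHS]big_mkcond.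
by apply: eq_bigr => i _; rewrite /erase; case: eqP.
Qed.

Lemma supp_erase (V : finType) (o : V) (x : V -> R) : supp (erase o x) \subset supp x :\ o.
Proof. by apply/subsetP => i; rewrite !inE /erase; case: (eqVneq i o) => //=; rewrite eqxx. Qed.

Lemma pol_erase (V : finType) (o : V) (g : {set V} -> R) x :
  (forall e, g e != 0 -> o \notin e) -> pol g x = pol g (erase o x).
Proof.
by move=> h; apply: pol_eq => e /h oe i ie; rewrite /erase; case: eqP => // io; rewrite -io ie in oe.
Qed.

Lemma pol_split_erase (V : finType) (E : {set {set V}}) o (x : V -> R) :
  pol (ind E) x = x o * pol (ind (link_set o E)) (erase o x) +
    pol (ind [set e in E | o \notin e]) (erase o x).
Proof.
rewrite (pol_split _ _ o) dpol_indE -!pol_erase.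
- congr (_ + _); apply: eq_pol => e; rewrite /ind inE.
  by case: (o \in e); rewrite ?andbF ?andbT.
- by move=> e; rewrite /ind pnatr_eq0 eqb0 negbK inE => /andP[].
- by move=> e; rewrite /ind pnatr_eq0 eqb0 negbK inE => /andP[].
Qed.

Lemma star_split (V : finType) (E : {set {set V}}) k o (x : V -> R) : uniform k.+1 E -> nneg x ->
  pol (ind E) x <= x o * ((tot x - x o) ^+ k / k`!%:R) +
    pol (ind [set e in E | o \notin e]) (erase o x).
Proof.
move=> Ek x0; rewrite (pol_split_erase E o) lerD2r ler_wpM2l // -tot_erase.
apply: (pol_le_tot (unif_ind (uniform_link Ek)) (erase_ge0 _ x0)) => e.
by rewrite /ind lern1; case: (_ \in _).
Qed.

Lemma star_bound (V : finType) (E : {set {set V}}) k t o (x : V -> R) :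
  matching_bound k.+1 t -> uniform k.+1 E -> ~ has_matching t [set e in E | o \notin e] ->
  nneg x -> tot x = 1 ->
  pol (ind E) x <= x o * ((1 - x o) ^+ k / k`!%:R) + lam R (k.+1 * t).-1 k.+1 * (1 - x o) ^+ k.+1.
Proof.
move=> Bd Ek nm x0 x1; apply: le_trans (star_split o Ek x0) _.
rewrite x1 lerD2l -[X in _ <= _ * (X - _) ^+ _]x1 -tot_erase; apply: Bd nm (erase_ge0 _ x0).
by move=> e; rewrite inE => /andP[/Ek].
Qed.

Lemma supported_complete k t (V : finType) (E : {set {set V}}) (K : {set V}) (x : V -> R) : nneg x -> (0 < k)%N ->
  uniform k E -> ~ has_matching t.+1 E -> #|K| = (k * t.+1).-1 -> complete_on k E K ->
  pol (ind E) x <= e_ K k x.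
Proof.
move=> x0 k0 Ek nm Kc cK; apply: pol_le => // e; rewrite /ind ler_nat inE.
case: (boolP (e \in E)) => // eE.
by rewrite (complete_absorbs cK Kc k0 nm eE) ?Ek ?eqxx.
Qed.

(** Induction on the size of [T], each time after shifting. Merging the two lightest vertices
    removes one vertex of [T]; the other alternative of [peel] keeps the polynomial below the
    assumed value, by [peel_gap]. Once [T] has at most [q] vertices, [near_complete] applies. *)
Lemma matching_stableS k t : (1 < k <= 3)%N -> (0 < t)%N -> peel_gap R k t -> matching_bound k t ->
  exists2 c, 0 < c & matching_stable k t.+1 c.
Proof.
case: k => // k /andP[k1 k3] t0 [d d0 Hd] Bd; set q := (k.+1 * t.+1).-1.
have k0 : (0 < k.+1)%N by [].
have kq : (k.+1 <= q)%N by rewrite /q mulnS; move: k1 t0; clear; nia.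
have qS : (k.+1 * t.+1)%N = q.+1 by rewrite /q prednK // muln_gt0 k0.
have [c1 c10 H] := near_complete R k1 kq.
exists (Num.min c1 d); first by rewrite lt_min c10.
move=> V E T; have [n] := ubnP #|T|; elim: n T E => // n IH T E; rewrite ltnS => Tn x Ek ET nm x0 xT x1 lt.
have lt1 : lam R q k.+1 - c1 < pol (ind E) x.
  by apply: le_lt_trans lt; rewrite lerD2l lerN2 ge_min lexx.
have [Tq|Tq] := leqP #|T| q.
  have ltT : lam R q k.+1 - c1 < e_ T k.+1 x.
    apply: lt_le_trans lt1 _; apply: pol_le => // e; rewrite /ind ler_nat inE.
    by case: (boolP (e \in E)) => // eE; rewrite ET // Ek // eqxx.
  by have [Kc cK] := H V E T x Ek x0 x1 Tq ltT lt1; exists T.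
have [rho [rinj rx]] := weight_rank x.
have [E' [[Ek' ET'] nm' le sh]] := shifting x0 (fun u v _ _ => rx u v) Ek ET nm.
have T2 : (2 <= #|T|)%N by apply: leq_trans Tq; rewrite (leq_trans k1) // leqW.
have [y [z [yT zT yz ryz top]]] := top_two rinj T2.
have kT : (k.+1 * t.+1 <= #|T|)%N by rewrite qS.
have k13 : (1 < k.+1 <= 3)%N by rewrite k1.
have [unc|[o oT [_ nmo]]] := peel rinj sh Ek' ET' k13 kT yT zT yz ryz top nm'.
  have [b [x' [bT x'0 x'1 x'T le']]] := merge_uncovered x0 xT yT zT yz unc.
  have eqr : pol (ind (restr E' (T :\ b))) x' = pol (ind E') x'.
    apply: pol_eq_supp => // e es; rewrite /ind inE.
    by rewrite (subset_trans es x'T) andbT.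
  have [||||||K KT [Kc cK]] := IH (T :\ b) (restr E' (T :\ b)) _ x' _ _ _ x'0 x'T.
  - by apply: leq_trans Tn; rewrite [X in (_ < X)%N](cardsD1 b) bT.
  - by move=> e; rewrite inE => /andP[/Ek'].
  - by move=> e; rewrite inE => /andP[].
  - by move=> h; apply: nm'; apply: has_matching_sub h; apply/subsetP => e; rewrite inE => /andP[].
  - by rewrite x'1.
  - by rewrite eqr (lt_le_trans lt) // (le_trans le).
  have cK' : complete_on k.+1 E' K by move=> e eK ek; have := cK e eK ek; rewrite inE => /andP[].
  exists K; first by apply: subset_trans KT _; exact: subD1set.
  (* [K] is complete in the shifted family only. As the shifted polynomial dominates at [x],
     [near_complete] with these original weights makes [K] complete in [E] too. *)
  have ltK : lam R q k.+1 - c1 < e_ K k.+1 x.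
    by apply: lt_le_trans (le_trans le (supported_complete x0 k0 Ek' nm' Kc cK')).
  by apply: (H V E K x) => //; rewrite Kc.
have : pol (ind E) x <= lam R q k.+1 - d.
  apply: le_trans le _.
  apply: le_trans (star_bound Bd Ek' nmo x0 x1) (Hd _ _).
  by rewrite x0 /= -x1 /tot (bigD1 o) //= lerDl sumr_ge0.
by rewrite leNgt (le_lt_trans _ lt) // lerD2l lerN2 ge_min lexx orbT.
Qed.

Lemma matching_boundS k t c : (1 < k)%N -> 0 < c -> matching_stable k t.+1 c -> matching_bound k t.+1.
Proof.
move=> k1 c0 H V E x Ek nm; move: x; have k0 : (0 < k)%N by exact: ltnW.
apply: pol_homogeneous => //; first exact: unif_ind.
move=> x x0 x1; rewrite leNgt; apply/negP => lt.
have lt' : lam R (k * t.+1).-1 k - c < pol (ind E) x by apply: lt_trans lt; rewrite ltrBlDr ltrDl.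
have [K _ [Kc cK]] := H V E setT x Ek (fun e _ => subsetT e) nm x0 (subsetT _) x1 lt'.
have := le_trans (supported_complete x0 k0 Ek nm Kc cK) (full_lam x0 (leqnn _) k0).
rewrite Kc leNgt => /negP; apply; apply: le_lt_trans lt.
rewrite ler_piMr ?lam_ge0 // exprn_ile1 ?sumr_ge0 //.
by rewrite -x1 /tot [leRHS](bigID (mem K)) /= lerDl sumr_ge0.
Qed.

Lemma peel_gap_le3 k t : (1 < k <= 3)%N -> (0 < t)%N -> peel_gap R k t.
Proof. by case: k => [|[|[|[|]]]] // _; [exact: peel_gap2 | exact: peel_gap3]. Qed.

Lemma matching_boundP k t : (1 < k <= 3)%N -> (0 < t)%N -> matching_bound k t.
Proof.
move=> k13; have /andP[k1 _] := k13; case: t => // t _; elim: t => [|t IH].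
  by apply: matching_bound1; exact: ltnW.
have [c c0 H] := matching_stableS k13 (ltn0Sn t) (peel_gap_le3 k13 (ltn0Sn t)) IH.
exact: matching_boundS c0 H.
Qed.

Lemma matching_stableP k t : (1 < k <= 3)%N -> (1 < t)%N -> exists2 c, 0 < c & matching_stable k t c.
Proof.
case: t => [|[|t]] // k13 _.
exact: matching_stableS (peel_gap_le3 k13 (ltn0Sn t)) (matching_boundP k13 (ltn0Sn t)).
Qed.

End MatchingLagrangian.

(** * Matchings under capped weights *)

Section Averaging.

Lemma swap_invariant (V : finType) (N : {set V} -> nat) (e f : {set V}) :
  (forall u v g, N (swap u v g) = N g) -> #|e| = #|f| -> N e = N f.
Proof.
move=> Ninv; have [n] := ubnP #|e :\: f|; elim: n e => // n IH e; rewrite ltnS => le_n ef.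
have [/eqP|] := posnP #|e :\: f|.
  rewrite cards_eq0 setD_eq0 => sub; congr N.
  by apply/eqP; rewrite eqEcard sub ef leqnn.
case/card_gt0P => v /[!inE] /andP[vf ve].
have /card_gt0P[u] : (0 < #|f :\: e|)%N.
  have := cardsID f e; have := cardsID e f; rewrite setIC ef => <- /eqP.
  rewrite eqn_add2l => /eqP <-; apply/card_gt0P; exists v.
  by rewrite inE vf ve.
rewrite inE => /andP[ue uf]; rewrite -(Ninv u v e); apply: IH; last by rewrite card_swap.
apply: leq_trans le_n; apply: proper_card; apply/properP; split; last first.
  exists v; rewrite !inE ?vf ?ve // swapE // !inE eqxx /=.
  by rewrite orbF; apply: contraNneq ue => <-.
apply/subsetP => i; rewrite swapE // !inE => /andP[fi /predU1P[iu|/andP[_ ->]]].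
  by rewrite iu uf in fi.
by rewrite fi.
Qed.

Variables (t k : nat).
Let U := ('I_t * 'I_k)%type.
Let B (i : 'I_t) : {set U} := [set (i, j) | j : 'I_k].

Let card_B i : #|B i| = k.
Proof. by rewrite card_imset ?card_ord // => j j' []. Qed.

Let hits (e : {set U}) := (\sum_(s : {perm U}) \sum_i (s @: B i == e))%N.

Let hits_swap u v e : hits (swap u v e) = hits e.
Proof.
rewrite /hits (reindex_inj (mulIg (tperm u v))); apply: eq_bigr => s _.
apply: eq_bigr => i _; congr nat_of_bool.
rewrite -(inj_eq (inv_inj (swapK u v)) (s @: B i)); congr (_ == _).
by rewrite /swap -imset_comp; apply: eq_imset => p; rewrite permM.
Qed.

(* Among the t blocks of a uniformly random partition of U into k-sets, at most
   t - 1 are edges, while every k-set is equally likely to be a block. *)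
Lemma perfect_average (E : {set {set U}}) : (0 < t)%N -> (0 < k)%N -> uniform k E ->
  ~ has_matching t E -> (#|E| <= 'C((k * t).-1, k))%N.
Proof.
move=> t0 k0 Ek nm; pose S := #|{perm U}|; pose K := full [set: U] k.
have S0 : (0 < S)%N by apply/card_gt0P; exists 1%g.
have sumE (F : {set {set U}}) : (\sum_(e in F) hits e = \sum_(s : {perm U}) \sum_i ((s @: B i : {set U}) \in F))%N.
  rewrite /hits exchange_big; apply: eq_bigr => s _.
  rewrite exchange_big; apply: eq_bigr => i _.
  rewrite -big_mkcondr /= sum1dep_card; case: (boolP (_ \in F)) => h.
    rewrite -[RHS]/1%N -(cards1 (s @: B i)); apply: eq_card => e; rewrite !inE eq_sym.
    by case: eqP => [->|]; rewrite ?h ?andbF.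
  by apply: eq_card0 => e; rewrite !inE; apply: contraNF h => /andP[eF /eqP ->].
have hK : (\sum_(e in K) hits e = S * t)%N.
  rewrite sumE (eq_bigr (fun=> t)) ?sum_nat_const // => s _.
  rewrite (eq_bigr (fun=> 1%N)) ?sum1_card ?card_ord // => i _.
  by rewrite inE subsetT card_imset ?card_B ?eqxx //; exact: perm_inj.
have hE : (\sum_(e in E) hits e <= S * t.-1)%N.
  rewrite sumE -sum_nat_const; apply: leq_sum => s _.
  rewrite -ltnS prednK // ltnNge; apply/negP => le_t; apply: nm.
  exists (fun i => s @: B i); split=> [i|i j ij].
    apply/negPn/negP => nE; move: le_t; rewrite leqNgt => /negP; apply.
    apply: (@leq_ltn_trans (\sum_(j < t) if j != i then 1 else 0)).
      apply: leq_sum => j _; case: (eqVneq j i) => [->|_]; first by rewrite (negbTE nE).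
      by case: (_ \in _).
    by rewrite -big_mkcond (sum1_card (predC1 i)) cardC1 card_ord prednK.
  rewrite disjoint_subset; apply/subsetP => p /imsetP[_ /imsetP[a _ ->] ->].
  rewrite inE; apply/negP => /imsetP[_ /imsetP[b _ ->]] /perm_inj[/eqP].
  by rewrite (negbTE ij).
have [e0 e0K] : exists e0, e0 \in K by exists (B (Ordinal t0)); rewrite inE subsetT card_B eqxx.
have he (e : {set U}) : #|e| = k -> hits e = hits e0.
  move=> ek; apply: swap_invariant; first exact: hits_swap.
  by move: e0K; rewrite inE ek => /andP[_ /eqP].
move: hE hK; rewrite (eq_bigr (fun=> hits e0)) ?sum_nat_const => [hE|e /Ek /he //].
rewrite (eq_bigr (fun=> hits e0)) ?sum_nat_const => [hK|e]; last by rewrite inE => /andP[_ /eqP /he].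
have cK : #|K| = 'C(k * t, k).
  rewrite -[in RHS](card_ord k) -[in RHS](card_ord t) mulnC -card_prod -cardsT -cards_draws card_ord.
  by apply: eq_card => e; rewrite !inE.
have h0 : (0 < hits e0)%N.
  have : (0 < S * t)%N by rewrite muln_gt0 S0.
  by rewrite -hK muln_gt0 => /andP[].
have le1 : (#|E| * t <= #|K| * t.-1)%N.
  rewrite -(leq_pmul2l h0) -(leq_pmul2l S0).
  have := leq_mul hE (leqnn (#|K| * hits e0)); rewrite {1}hK.
  by apply: etrans; congr (_ <= _)%N; ring.
have le2 : ('C(k * t, k) * t.-1 = 'C((k * t).-1, k) * t)%N.
  apply/eqP; rewrite -(eqn_pmul2l k0).
  have kt0 : (0 < k * t)%N by rewrite muln_gt0 k0.
  have := mul_bin_down (k * t) k.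
  have -> : (k * t - k = k * t.-1)%N by rewrite -subn1 mulnBr muln1.
  by move=> h; apply/eqP; transitivity (k * t.-1 * 'C(k * t, k))%N; [ring | rewrite -h; ring].
by rewrite -(leq_pmul2r t0) -le2 -cK.
Qed.

End Averaging.

Lemma perfect_average_set (V : finType) (E : {set {set V}}) (T : {set V}) t k : (0 < t)%N -> (0 < k)%N ->
  #|T| = (k * t)%N -> uniform k E -> (forall e, e \in E -> e \subset T) ->
  ~ has_matching t E -> (#|E| <= 'C((k * t).-1, k))%N.
Proof.
move=> t0 k0 Tkt Ek ET nm; pose U := ('I_t * 'I_k)%type.
have cU : #|{: U}| = #|T| by rewrite card_prod !card_ord Tkt mulnC.
pose h (p : U) := enum_val (cast_ord cU (enum_rank p)).
have h_inj : injective h by move=> p p' /enum_val_inj /cast_ord_inj /enum_rank_inj.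
have hT : h @: setT = T.
  apply/eqP; rewrite eqEcard (card_imset _ h_inj) cardsT cU leqnn andbT.
  by apply/subsetP => _ /imsetP[p _ ->]; exact: enum_valP.
pose F := [set e : {set U} | h @: e \in E].
have EF : E = [set h @: (e : {set U}) | e in F].
  apply/setP => e; apply/idP/imsetP => [eE|[f]]; last by rewrite inE => fE ->.
  have ee : e = h @: (h @^-1: e).
    apply/setP => v; apply/idP/imsetP => [ve|[p]]; last by rewrite inE => pe ->.
    have /imsetP[p _ vp] : v \in h @: setT by rewrite hT (subsetP (ET e eE)).
    by exists p; rewrite // inE -vp.
  by exists (h @^-1: e) => //; rewrite inE -ee.
rewrite EF card_imset; last exact: imset_inj.
apply: perfect_average => //.
  by move=> e; rewrite inE => /Ek; rewrite card_imset.
move=> [M [MF Md]]; apply: nm; exists (fun i => h @: M i); split=> [i|i j ij].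
  by have := MF i; rewrite inE.
rewrite disjoint_subset; apply/subsetP => _ /imsetP[p pi ->]; rewrite inE mem_imset //.
by rewrite (disjointFr (Md i j ij) pi).
Qed.

Section CappedArith.
Variable R : realFieldType.
Implicit Types (a w s y A : R).

(** [k] is one less than the uniformity. This is an upper estimate: each of the [t] heavy vertices
    is charged with the bound for all k-sets on the remaining weight s - w. *)
Definition star_value k t w s : R := t%:R * w * ((s - w) ^+ k / k`!%:R).
Definition clique_value k t w : R := 'C((k * t).-1, k)%:R * w ^+ k.

Lemma clique_le_star k t w s : (0 < k)%N -> 0 <= w -> (k * t.+1)%:R * w <= s ->
  clique_value k t.+1 w <= star_value k.-1 t w s.
Proof.
case: k => // k _ w0 ws; rewrite /clique_value /star_value /=.
set n := (k.+1 * t.+1).-1.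
have nS : (k.+1 * t.+1)%N = n.+1 by rewrite /n prednK.
have sw : n%:R * w <= s - w by rewrite lerBrDr -[X in _ + X]mul1r -mulrDl natr1 -nS.
have h : ('C(n, k.+1) * k`! <= t * n ^ k)%N.
  have k0 : (0 < k.+1)%N by [].
  rewrite -(leq_pmul2l k0) mulnCA -factS bin_ffact ffactnSr.
  have -> : (n - k)%N = (k.+1 * t)%N by move: nS; rewrite mulnS; clear; lia.
  by rewrite [leqRHS]mulnA [leqRHS]mulnC leq_mul2r ffact_leq_exp orbT.
have f0 : 0 < k`!%:R :> R by rewrite ltr0n fact_gt0.
rewrite -(ler_pM2r f0) [leLHS]mulrAC -natrM.
rewrite -[leRHS]mulrA divfK ?gt_eqF //.
apply: le_trans (_ : (t * n ^ k)%:R * w ^+ k.+1 <= _); first by rewrite ler_wpM2r ?exprn_ge0 // ler_nat.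
rewrite natrM natrX -!mulrA ler_wpM2l // exprS mulrCA ler_wpM2l // -exprMn.
by rewrite lerXn2r // nnegrE ?mulr_ge0 // (le_trans _ sw) // mulr_ge0.
Qed.

Lemma star_step k a w s : (k <= 2)%N -> 0 <= a -> a <= w -> k.+1%:R * w <= s ->
  a * (s - a) ^+ k <= w * (s - w) ^+ k.
Proof.
case: k => [|[|[|]]] // _ a0 aw ws; rewrite ?expr0 ?mulr1 //.
  rewrite !expr1 -subr_ge0; have -> : w * (s - w) - a * (s - a) = (w - a) * (s - w - a) by ring.
  by rewrite mulr_ge0; lra.
rewrite -subr_ge0.
have -> : w * (s - w) ^+ 2 - a * (s - a) ^+ 2 = (w - a) * ((s - w - a) ^+ 2 - w * a) by ring.
rewrite mulr_ge0 ?subr_ge0 //; apply: le_trans (_ : w * w <= _); first by rewrite ler_wpM2l //; lra.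
by rewrite expr2 ler_pM; lra.
Qed.

Lemma add_smallest k A y : (k <= 1)%N -> 0 <= A -> 0 <= y ->
  A ^+ k.+1 / k.+1`!%:R + y * (A ^+ k / k`!%:R) <= (A + y) ^+ k.+1 / k.+1`!%:R.
Proof.
case: k => [|[|]] // _ A0 y0.
  by rewrite -[1`!]/1%N -[0`!]/1%N expr1 expr0 !divr1 mulr1 expr1.
rewrite -[2`!]/2%N -[1`!]/1%N expr1 divr1 -subr_ge0.
have -> : (A + y) ^+ 2 / 2%:R - (A ^+ 2 / 2%:R + y * A) = y ^+ 2 / 2%:R by field.
by rewrite divr_ge0 ?sqr_ge0.
Qed.

End CappedArith.

Section Capped.
Variable R : realFieldType.

(* The extremal configurations when no weight exceeds w: t vertices of weight w
   meeting every edge, and a clique on k (t + 1) - 1 vertices of weight w. *)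
Definition capped k t := forall (V : finType) (E : {set {set V}}) (T : {set V}) (x : V -> R) (w : R),
  uniform k E -> (forall e, e \in E -> e \subset T) -> ~ has_matching t.+1 E ->
  nneg x -> supp x \subset T -> 0 <= w -> (forall i, x i <= w) ->
  (k * t.+1).-1%:R * w <= tot x ->
  pol (ind E) x <= Num.max (star_value k.-1 t w (tot x)) (clique_value k t.+1 w).

Lemma capped_star k t (V : finType) (E : {set {set V}}) (T : {set V}) (x : V -> R) (w : R) :
  (0 < k)%N -> capped k t ->
  uniform k E -> (forall e, e \in E -> e \subset T) -> ~ has_matching t.+1 E ->
  nneg x -> supp x \subset T -> 0 <= w -> (forall i, x i <= w) ->
  (k * t.+1)%:R * w <= tot x ->
  pol (ind E) x <= star_value k.-1 t w (tot x).
Proof.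
move=> k0 cap Ek ET nm x0 xT w0 xw sw.
rewrite -[leRHS](@max_l _ R _ (clique_value k t.+1 w)); last exact: clique_le_star.
apply: (cap _ _ T) => //; apply: le_trans sw.
by apply: ler_wpM2r => //; rewrite ler_nat leq_pred.
Qed.

Lemma pol_card (V : finType) (E : {set {set V}}) k (x : V -> R) (w : R) : uniform k E -> nneg x ->
  (forall i, x i <= w) -> pol (ind E) x <= #|E|%:R * w ^+ k.
Proof.
move=> Ek x0 xw; rewrite polE mulr_natl -sumr_const; apply: ler_sum => e eE.
by rewrite -(Ek e eE) -prodr_const; apply: ler_prod => i _; rewrite x0 xw.
Qed.

(** When [T] has exactly k (t + 1) vertices, averaging over partitions bounds the number of edges;
    below that size there are too few k-sets altogether. *)
Lemma cap_small k t (V : finType) (E : {set {set V}}) (T : {set V}) (x : V -> R) (w : R) : (0 < k)%N ->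
  uniform k E -> (forall e, e \in E -> e \subset T) -> ~ has_matching t.+1 E ->
  nneg x -> 0 <= w -> (forall i, x i <= w) -> (#|T| <= k * t.+1)%N ->
  pol (ind E) x <= clique_value k t.+1 w.
Proof.
move=> k0 Ek ET nm x0 w0 xw; rewrite leq_eqVlt => Tkt.
apply: le_trans (pol_card Ek x0 xw) _; rewrite ler_wpM2r ?exprn_ge0 // ler_nat.
case/predU1P: Tkt => [Tkt|Tkt].
  exact: (perfect_average_set _ k0 Tkt Ek ET nm).
have sub : E \subset full T k by apply/subsetP => e eE; rewrite inE ET // Ek // eqxx.
apply: leq_trans (subset_leq_card sub) _.
have -> : #|full T k| = 'C(#|T|, k) by rewrite -cards_draws; apply: eq_card => e; rewrite !inE.
by apply: leq_bin2l; rewrite -ltnS prednK // muln_gt0 k0.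
Qed.

Lemma capped1 t : capped 1 t.
Proof.
move=> V E T x w E1 ET nm x0 xT w0 xw sw; rewrite le_max; apply/orP; left.
pose Y := [set v | [set v] \in E].
have cY : complete_on 1 E Y.
  by move=> e eY /eqP/cards1P[v ev]; move: eY; rewrite ev sub1set inE.
have Yt : (#|Y| <= t)%N.
  by rewrite leqNgt; apply/negP => lt; apply: nm; apply: (complete_matching cY); rewrite mul1n.
rewrite /star_value expr0 -[0`!]/1%N divr1 mulr1.
have EY : E \subset [set [set v] | v in Y].
  apply/subsetP => e eE; have /eqP/cards1P[v ev] := E1 e eE; apply/imsetP; exists v => //.
  by rewrite inE -ev.
apply: le_trans (pol_card E1 x0 xw) _; rewrite expr1 ler_wpM2r // ler_nat.
by apply: leq_trans (subset_leq_card EY) _; apply: leq_trans (leq_imset_card _ _) Yt.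
Qed.

(** A matching of size t + 1 in the link of the lightest vertex [z] covers at most k (t + 1)
    vertices, so at least t + 1 vertices of [T] remain, [z] among them or not. Shifting [z] to
    distinct ones of them extends the blocks to disjoint edges. *)
Lemma link_no_matching (V : finType) (rho : V -> nat) (T : {set V}) (E : {set {set V}}) z k t :
  injective rho -> shifted rho T E -> uniform k.+1 E -> (forall e, e \in E -> e \subset T) ->
  (k.+1 * t.+1 <= #|T|)%N -> z \in T -> (forall i, i \in T -> i != z -> (rho i < rho z)%N) ->
  ~ has_matching t.+1 E ->
  ~ has_matching t.+1 (link_set z E).
Proof.
move=> rinj sh Ek ET kT zT top nm [M [ME Md]]; apply: nm.
have {}ME i : z \notin M i /\ z |: M i \in E by have := ME i; rewrite inE => /andP.
pose U := \bigcup_(i < t.+1) M i.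
have Uk : (#|U| <= k * t.+1)%N.
  rewrite mulnC -[X in (_ <= X * _)%N]card_ord -sum_nat_const.
  apply: leq_trans (_ : (\sum_(i < t.+1) #|M i| <= _)%N).
    rewrite /U; elim/big_rec2: _ => [|i n Y _ IH]; first by rewrite cards0.
    by apply: leq_trans (leq_card_setU _ _) _; rewrite leq_add2l.
  apply: leq_sum => i _; have [zM zE] := ME i.
  by have := Ek _ zE; rewrite cardsU1 zM add1n => -[->].
have zU : z \notin U by apply/negP => /bigcupP[i _]; have [/negbTE -> _] := ME i.
pose W := T :\: U.
have zW : z \in W by rewrite inE zU zT.
have Wt : (t.+1 <= #|W|)%N.
  rewrite /W cardsD; have : (#|T :&: U| <= k * t.+1)%N.
    by apply: leq_trans Uk; apply: subset_leq_card; exact: subsetIr.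
  by move: kT; rewrite mulSn; clear; lia.
pose u (i : 'I_t.+1) := enum_val (widen_ord Wt i).
have u_inj : injective u by move=> i j /enum_val_inj /(congr1 val) /= /val_inj.
have uW i : u i \in W by exact: enum_valP.
have uU i : u i \notin U by have := uW i; rewrite inE => /andP[].
have uT i : u i \in T by have := uW i; rewrite inE => /andP[].
have uM i j : u i \notin M j.
  by apply: contra (uU i) => uM; apply/bigcupP; exists j.
exists (fun i => u i |: M i); split=> [i|i j ij].
  have [zM zE] := ME i; have [->//|uz] := eqVneq (u i) z.
  have -> : u i |: M i = swap (u i) z (z |: M i).
    by rewrite swapE ?setU11 ?setU1K // !inE negb_or uz uM.
  apply: sh; rewrite ?setU11 ?top // !inE negb_or uz uM //.
rewrite disjoint_subset; apply/subsetP => a; rewrite !inE negb_or => /predU1P[->|aM].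
  by rewrite uM andbT; apply: contraNneq ij => /u_inj ->.
rewrite (disjointFr (Md i j ij) aM) andbT.
by apply: contraTneq aM => ->.
Qed.

Lemma capped_t0 k : (0 < k)%N -> capped k 0.
Proof.
move=> k0 V E T x w Ek ET nm x0 xT w0 xw sw; rewrite polE big1 => [|e eE].
  by rewrite le_max; apply/orP; left; rewrite /star_value !mul0r.
by case: nm; apply: has_matchingS eE (has_matching0 _).
Qed.

(** Induction on the number of vertices plus the number of weights different from [w]. If [peel]
    removes the heaviest vertex, [capped] for the smaller [t] applies. Otherwise the two lightest
    vertices [y], [z] are uncovered: if [y] has weight [w], then [z] is removed and its link has
    smaller uniformity; if not, weight moves from [z] to [y] until [z] is empty or [y] is full. *)
Lemma cappedS k t : (0 < k <= 2)%N -> capped k t.+1 -> capped k.+1 t -> capped k.+1 t.+1.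
Proof.
case: k => // k /= k1 capk capt V E T x w.
have [n] := ubnP (#|T| + #|[set i in T | x i != w]|)%N.
elim: n T E x => // n IH T E x; rewrite ltnS => le_n Ek ET nm x0 xT w0 xw sw.
have [Tkt|Tkt] := leqP #|T| (k.+2 * t.+2).
  by rewrite le_max (cap_small _ Ek ET nm x0 w0 xw Tkt) ?orbT.
have [rho [rinj rx]] := weight_rank x.
have [E' [[Ek' ET'] nm' le sh]] := shifting x0 (fun u v _ _ => rx u v) Ek ET nm.
have T2 : (2 <= #|T|)%N by apply: leq_trans Tkt; rewrite ltnS muln_gt0.
have [y [z [yT zT yz ryz top]]] := top_two rinj T2.
have k13 : (1 < k.+2 <= 3)%N by [].
apply: le_trans le _; clear E Ek ET nm.
have [unc|[o oT [omin nmo]]] := peel rinj sh Ek' ET' k13 (ltnW Tkt) yT zT yz ryz top nm'; last first.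
  rewrite le_max; apply/orP; left.
  have xo i : x i <= x o.
    have [iT|iT] := boolP (i \in T); last first.
      suff -> : x i = 0 by [].
      by apply: contraNeq iT => xi; rewrite (subsetP xT) // inE.
    by have := omin i iT; rewrite leq_eqVlt => /predU1P[/rinj ->|/rx].
  have so : (k.+2 * t.+1)%:R * x o <= tot (erase o x).
    rewrite tot_erase lerBrDr -[X in _ + X]mul1r -mulrDl natr1; apply: le_trans sw.
    apply: ler_pM => //; rewrite ler_nat [(_ * t.+2)%N]mulnS; clear; lia.
  have xT' : supp (erase o x) \subset T.
    by apply: subset_trans (supp_erase o x) _; apply: subset_trans (subD1set _ _) xT.
  have h := @capped_star k.+2 t V [set e in E' | o \notin e] T (erase o x) (x o) isT capt.
  apply: le_trans (star_split o Ek' x0) _; apply: le_trans (lerD (lexx _) (h _ _ nmo (erase_ge0 _ x0) xT' (x0 o) _ so)) _.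
  - by move=> e; rewrite inE => /andP[/Ek'].
  - by move=> e; rewrite inE => /andP[/ET'].
  - by move=> i; rewrite /erase; case: ifP.
  have xo_s : x o <= tot x - x o.
    rewrite -tot_erase; apply: le_trans so; rewrite -[leLHS]mul1r; apply: ler_wpM2r => //.
    by rewrite ler1n muln_gt0.
  rewrite /star_value tot_erase -[t.+1%:R]natr1 /=.
  apply: (@le_trans _ _ ((t%:R + 1) * x o * ((tot x - x o) ^+ k.+1 / k.+1`!%:R))).
    have -> : (t%:R + 1) * x o * ((tot x - x o) ^+ k.+1 / k.+1`!%:R) =
      x o * ((tot x - x o) ^+ k.+1 / k.+1`!%:R) + t%:R * x o * ((tot x - x o) ^+ k.+1 / k.+1`!%:R) by ring.
    rewrite lerD2l; apply: ler_wpM2l; first by rewrite mulr_ge0.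
    apply: ler_wpM2r; first by rewrite invr_ge0.
    apply: lerXn2r; rewrite ?nnegrE; first by rewrite subr_ge0.
      exact: le_trans (x0 o) xo_s.
    by rewrite lerBlDr lerDl.
   rewrite -!mulrA; apply: ler_wpM2l; first exact: addr_ge0.
  rewrite !mulrA; apply: ler_wpM2r; first by rewrite invr_ge0.
  apply: star_step => //; apply: le_trans sw; apply: ler_wpM2r => //.
  by rewrite ler_nat !mulnS; clear; lia.
have dyz : dpol (ind E') z x <= dpol (ind E') y x.
  rewrite !dpol_link; apply: pol_le => // f; rewrite /link /ind.
  case: ifPn => zf; first by case: ifP.
  case: (boolP (z |: f \in E')) => [zE|_]; last by case: ifP.
  have yf : y \notin f by apply/negP => yf; apply: (unc _ zE); rewrite !inE ?eqxx ?yf ?orbT.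
  rewrite (negbTE yf); suff -> : y |: f \in E' by [].
  have -> : y |: f = swap y z (z |: f) by rewrite swapE ?setU11 ?setU1K // !inE negb_or yz yf.
  by apply: sh; rewrite ?setU11 // !inE negb_or yz yf.
have xzy : x z <= x y by exact: rx.
(* If the second lightest vertex has weight [w], so has every vertex of [T] except [z]. *)
have [xy_w|xy_w] := eqVneq (x y) w.
  have rtop i : i \in T -> i != z -> (rho i < rho z)%N.
    move=> iT iz; have [->//|iy] := eqVneq i y.
    exact: ltn_trans (top i iT iy iz) ryz.
  have all_w i : i \in T -> i != z -> x i = w.
    move=> iT iz; have [->//|iy] := eqVneq i y.
    by apply/le_anti; rewrite xw -xy_w rx ?top.
  have xT' : supp (erase z x) \subset T :\ z.
    exact: subset_trans (supp_erase z x) (setSD _ xT).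
  have s' : (k.+2 * t.+2)%:R * w <= tot (erase z x).
    have -> : tot (erase z x) = #|T :\ z|%:R * w.
      rewrite mulr_natl -sumr_const /tot big_mkcond [RHS]big_mkcond; apply: eq_bigr => i _ /=.
      rewrite !inE /erase; case: (eqVneq i z) => //= iz.
      case: ifPn => iT; first exact: all_w.
      by apply: contraNeq iT => xi; rewrite (subsetP xT) // inE.
    apply: ler_wpM2r => //; rewrite ler_nat -ltnS; apply: leq_trans Tkt _.
    by rewrite (cardsD1 z T) zT.
  have xw' i : erase z x i <= w by rewrite /erase; case: ifP.
  have rest : pol (ind [set e in E' | z \notin e]) (erase z x) <= star_value k.+1 t.+1 w (tot (erase z x)).
    rewrite -[leRHS](@max_l _ R _ (clique_value k.+2 t.+2 w)); last exact: clique_le_star.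
    apply: (IH (T :\ z)) => //.
    - apply: leq_trans le_n; rewrite [X in (_ < X + _)%N](cardsD1 z) zT add1n addSn ltnS leq_add2l.
      apply: subset_leq_card; apply/subsetP => i; rewrite !inE => /andP[/andP[iz iT]].
      by rewrite /erase (negbTE iz) iT.
    - by move=> e; rewrite inE => /andP[/Ek'].
    - by move=> e; rewrite inE subsetD1 => /andP[/ET' -> ->].
    - by move=> h; apply: nm'; apply: has_matching_sub h; apply/subsetP => e; rewrite inE => /andP[].
    - exact: erase_ge0.
    - by apply: le_trans s'; apply: ler_wpM2r => //; rewrite ler_nat leq_pred.
  have le_link : pol (ind (link_set z E')) (erase z x) <=
      star_value k t.+1 w (tot (erase z x)).
    apply: (@capped_star k.+1 t.+1 V _ (T :\ z)) => //.
    - exact: uniform_link.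
    - move=> e; rewrite inE => /andP[ze /ET']; rewrite subUset subsetD1 => /andP[_ ->].
      by rewrite ze.
    - exact: (link_no_matching rinj sh Ek' ET' (ltnW Tkt) zT rtop nm').
    - exact: erase_ge0.
    - by apply: le_trans s'; apply: ler_wpM2r => //; rewrite ler_nat leq_mul2r leqnSn orbT.
  rewrite le_max; apply/orP; left; rewrite (pol_split_erase E' z).
  apply: le_trans (lerD (ler_wpM2l (x0 z) le_link) rest) _.
  have -> : tot x = tot (erase z x) + x z by rewrite tot_erase subrK.
  set S := tot (erase z x); rewrite /star_value [S + _ - _]addrAC.
  rewrite [x z * _]mulrCA [leLHS]addrC -mulrDr; apply: ler_wpM2l; first by rewrite mulr_ge0.
  apply: add_smallest => //; rewrite subr_ge0; apply: le_trans s'.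
  by rewrite -[leLHS]mul1r; apply: ler_wpM2r => //; rewrite ler1n muln_gt0.
have xy_lt : x y < w by rewrite lt_def eq_sym xy_w xw.
pose h := Num.min (x z) (w - x y); pose x' := mv x y z h.
have h0 : 0 <= h by rewrite le_min x0 subr_ge0 xw.
have hz : h <= x z by rewrite ge_min lexx.
have hw : h <= w - x y by rewrite ge_min lexx orbT.
have zy : z != y by rewrite eq_sym.
have x'0 : nneg x' by apply: nneg_mv => //; [exact: addr_ge0 | rewrite subr_ge0].
have x'w i : x' i <= w.
  rewrite /x' /mv; case: eqP => _; first by rewrite addrC -lerBrDr.
  by case: eqP => // _; rewrite (le_trans _ (xw z)) // lerBlDr lerDl.
have x't : tot x' = tot x by rewrite tot_mv.
have le_p : pol (ind E') x <= pol (ind E') x'.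
  rewrite pol_mv // ddpol_eq0 ?mulr0 ?subr0 ?lerDl ?mulr_ge0 ?subr_ge0 //.
  by move=> e ye ze _; rewrite /ind; case: (boolP (e \in E')) => // eE; case: (unc e).
apply: le_trans le_p _; rewrite -x't.
have x'T : supp x' \subset T.
  apply/subsetP => i; rewrite inE /x' /mv; case: (eqVneq i y) => [->//|iy].
  by case: (eqVneq i z) => [->//|iz xi]; rewrite (subsetP xT) // inE.
have [xz_le|xz_gt] := leP (x z) (w - x y).
  have hE : h = x z by rewrite /h min_l.
  have x'z : x' z = 0 by rewrite /x' /mv (negbTE zy) eqxx hE subrr.
  have x'Tz : supp x' \subset T :\ z by rewrite subsetD1 x'T inE x'z eqxx.
  have <- : pol (ind (restr E' (T :\ z))) x' = pol (ind E') x'.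
    apply: pol_eq_supp => // e es; rewrite /ind inE.
    by rewrite (subset_trans es x'Tz) andbT.
  apply: (IH (T :\ z)) => //.
  - apply: leq_trans le_n; rewrite [X in (_ < X + _)%N](cardsD1 z) zT add1n addSn ltnS leq_add2l.
    apply: subset_leq_card; apply/subsetP => i; rewrite !inE => /andP[/andP[iz iT]].
    rewrite iT /x' /mv (negbTE iz) /=; case: (eqVneq i y) => [->//|//].
  - by move=> e; rewrite inE => /andP[/Ek'].
  - by move=> e; rewrite inE => /andP[].
  - by move=> h'; apply: nm'; apply: has_matching_sub h'; apply/subsetP => e; rewrite inE => /andP[].
  - by rewrite x't.
have hE : h = w - x y by rewrite /h min_r // ltW.
have x'y : x' y = w by rewrite /x' /mv eqxx hE addrC subrK.
apply: (IH T) => //; last by rewrite x't.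
apply: leq_trans le_n; rewrite ltn_add2l; apply: proper_card; apply/properP; split.
  apply/subsetP => i; rewrite !inE => /andP[-> /=]; have [->|iy] := eqVneq i y; first by [].
  have [->|iz] := eqVneq i z; last by rewrite /x' /mv (negbTE iy) (negbTE iz).
  by move=> _; rewrite lt_eqF // (le_lt_trans xzy).
by exists y; rewrite !inE yT ?x'y ?eqxx.
Qed.

Theorem cappedP k t : (0 < k <= 3)%N -> capped k t.
Proof.
have cap1 k' : (0 < k' <= 2)%N -> (forall t', capped k' t') -> forall t', capped k'.+1 t'.
  by move=> k12 IH; elim=> [|t' IHt]; [exact: capped_t0 | exact: cappedS].
have cap2 : forall t', capped 2 t' by apply: cap1 => // t'; exact: capped1.
by case: k => [|[|[|[|k]]]] // _; [exact: capped1 | exact: cap1].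
Qed.

End Capped.

From mathcomp Require Import all_classical all_reals all_analysis.
(* Restores the names of finset shadowed by classical_sets. *)
From mathcomp Require Import fintype finset.
Require Import Defs.

Import numFieldNormedType.Exports.

(** * Maximisers of the polynomial on the simplex *)

Section Maximum.
Variables (R : realType) (V : finType).

Let weight (r : 'rV[R]_#|V|) (i : V) : R := r ord0 (enum_rank i).

Let continuous_pol (g : {set V} -> R) : continuous (fun r => pol g (weight r)).
Proof.
apply: continuous_big => [|e _ r]; first exact: add_continuous.
apply: continuousM; first exact: cst_continuous.
apply: (@continuous_big R) => [|i _]; first exact: mul_continuous.
exact: coord_continuous.
Qed.

Lemma pol_max (g : {set V} -> R) (v0 : V) : exists x : V -> R, [/\ nneg x, tot x = 1 &
  forall y : V -> R, nneg y -> tot y = 1 -> pol g y <= pol g x].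
Proof.
pose A : set 'rV[R]_#|V| := [set r | forall i, `[0, 1]%classic (r ord0 i)]%classic.
pose B : set 'rV[R]_#|V| := [set r | tot (weight r) = 1]%classic.
have cA : compact A.
  by apply: (@rV_compact R _ (fun=> `[0, 1]%classic)) => i; exact: segment_compact.
have cB : closed B.
  have -> : B = ((fun r => tot (weight r)) @^-1` [set 1])%classic by [].
  apply: preimage_closed => [r _|]; last exact: closed_eq.
  apply: (@continuous_big R) => [|i _]; first exact: add_continuous.
  exact: coord_continuous.
have tot_le (y : V -> R) i : nneg y -> tot y = 1 -> y i <= 1.
  by move=> y0 <-; rewrite /tot (bigD1 i) //= lerDl sumr_ge0.
pose row_of (y : V -> R) : 'rV[R]_#|V| := \row_j y (enum_val j).
have row_ofK (y : V -> R) : weight (row_of y) =1 y.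
  by move=> i; rewrite /weight mxE enum_rankK.
have AB (y : V -> R) : nneg y -> tot y = 1 -> (row_of y) \in (A `&` B)%classic.
  move=> y0 y1; rewrite in_setE; split=> [i|] /=.
    by rewrite in_itv /= mxE y0 tot_le.
  by apply: etrans y1; apply: eq_bigr => i _; rewrite row_ofK.
have AB0 : (A `&` B !=set0)%classic.
  exists (row_of (fun i => (i == v0)%:R)); rewrite -in_setE; apply: AB.
    by move=> i; exact: ler0n.
  rewrite /tot (bigD1 v0) //= eqxx big1 ?addr0 // => i /negbTE -> //.
have [c cAB cmax] := EVT_max_rV AB0 (compact_closedI cA cB)
  (continuous_subspaceT (@continuous_pol g)).
move: cAB; rewrite in_setE => -[cA' cB']; exists (weight c); split=> //.
  by move=> i; have := cA' (enum_rank i); rewrite /= in_itv /= => /andP[].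
move=> y y0 y1; have := cmax _ (AB y y0 y1).
by rewrite (pol_eq (y := y)) // => e _ i _; rewrite row_ofK.
Qed.

End Maximum.

(** * Linear stars *)

Section StarConstants.
Variable R : realFieldType.

(** The Lagrange multiplier of the complete hypergraph: at weights 1/n the derivative is the
    polynomial of the link, which is complete on n - 1 vertices of total weight 1 - 1/n. *)
Lemma lam_link n k : (1 < n)%N -> k.+1%:R * lam R n k.+1 = lam R n.-1 k * (1 - n%:R^-1) ^+ k.
Proof.
case: n => [|[|n]] // _; rewrite /lam.
have n0 : n.+2%:R != 0 :> R by rewrite pnatr_eq0.
have n1 : n.+1%:R != 0 :> R by rewrite pnatr_eq0.
have -> : 1 - n.+2%:R^-1 = n.+1%:R / n.+2%:R :> R.
  by rewrite -[X in X - _](mulfV n0) -[X in _ - X]mul1r -mulrBl -[n.+2%:R]natr1 addrK.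
rewrite expr_div_n [RHS]mulrA divfK ?expf_neq0 // mulrA -natrM -mul_bin_diag natrM.
by rewrite exprS invfM mulrACA divff // mul1r.
Qed.

(** Compares, at heaviest weight 1/(k t), the star value that [capped] allows for the link with the
    multiplier of [lam_link]; the difference is an explicit positive fraction. *)
Lemma star_gap k t : (1 < k <= 3)%N -> (1 < t)%N ->
  t.-1%:R * ((k * t)%:R^-1 * ((1 - 2 * (k * t)%:R^-1) ^+ k.-1 / (k.-1)`!%:R)) <
  lam R (k * t).-1 k * (1 - (k * t)%:R^-1) ^+ k.
Proof.
move=> k13 t1; have T2 : 2 <= t%:R :> R by rewrite ler_nat.
have t0 : (0 < t)%N by exact: ltnW.
have tE : t.-1%:R = t%:R - 1 :> R by rewrite -[in RHS](prednK t0) -natr1 addrK.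
rewrite tE natrM; case: k k13 => [|[|[|[|k]]]] // _.
  rewrite lam_graph // -[(2.-1)`!]/1%N; set T := t%:R in T2 *; rewrite -subr_gt0.
  rewrite [ltRHS](_ : _ = (T - 1) / (4 * T ^+ 2)); last first.
    by field; do ?(apply/andP; split); apply: lt0r_neq0; lra.
  by rewrite divr_gt0 ?mulr_gt0 ?exprn_gt0 //; lra.
rewrite lam_triple // -[(3.-1)`!]/2%N; set T := t%:R in T2 *; rewrite -subr_gt0.
rewrite [ltRHS](_ : _ = (T - 1) * (3 * T - 2) / (54 * T ^+ 3)); last first.
  by field; do ?(apply/andP; split); apply: lt0r_neq0; lra.
by rewrite divr_gt0 ?mulr_gt0 ?exprn_gt0 //; lra.
Qed.

Lemma exprD_le k (p d : R) : 0 <= p -> 0 <= d -> p + d <= 1 -> (p + d) ^+ k <= p ^+ k + k%:R * d.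
Proof.
move=> p0 d0 pd; elim: k => [|k IH]; first by rewrite !expr0 mul0r addr0.
rewrite !exprS mulrDl -natr1 mulrDl mul1r; set P := (p + d) ^+ k in IH *.
have P1 : P <= 1 by rewrite exprn_ile1 ?addr_ge0.
have P0 : 0 <= P by rewrite exprn_ge0 ?addr_ge0.
have : p * P <= p * (p ^+ k + k%:R * d) by rewrite ler_wpM2l.
have : p * (k%:R * d) <= k%:R * d by rewrite ler_piMl ?mulr_ge0 //; lra.
have : d * P <= d by rewrite ler_piMr.
by lra.
Qed.

End StarConstants.

Section Multipliers.
Variables (R : realFieldType) (V : finType).

(** Otherwise a small move of weight from [b] to [a] has a positive first-order gain; [h] satisfies
    h (D + 1) <= d/2, which keeps the second-order loss below it. *)
Lemma dpol_le_max (g : {set V} -> R) x a b : (forall e, 0 <= g e) -> nneg x -> tot x = 1 ->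
  (forall y : V -> R, nneg y -> tot y = 1 -> pol g y <= pol g x) ->
  b \in supp x -> dpol g a x <= dpol g b x.
Proof.
move=> g0 x0 x1 xmax bs; have [->//|ab] := eqVneq a b.
rewrite leNgt -subr_gt0; apply/negP => d0.
set d := _ - _ in d0; set D := ddpol g a b x.
have D0 : 0 <= D by exact: ddpol_ge0.
have xb : 0 < x b by rewrite lt_def x0 andbT; move: bs; rewrite inE.
pose h := Num.min (x b) (d / (D + 1) / 2).
have h0 : 0 < h by rewrite lt_min xb !divr_gt0 // ltr_wpDl.
have hb : h <= x b by rewrite ge_min lexx.
have hd : h * (D + 1) <= d / 2.
  rewrite -ler_pdivlMr ?ltr_wpDl // mulrAC ge_min lexx orbT //.
have := xmax (mv x a b h); rewrite tot_mv // pol_mv // -/d -/D => /(_ _ x1).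
have y0 : nneg (mv x a b h) by apply: nneg_mv; rewrite ?subr_ge0 // addr_ge0 // ltW.
move=> /(_ y0); apply/negP; rewrite -ltNge -addrA ltrDl subr_gt0 expr2 -mulrA ltr_pM2l //.
apply: le_lt_trans (_ : h * (D + 1) < _); first by rewrite ler_wpM2l ?lerDl // ltW.
by apply: le_lt_trans hd _; rewrite ltr_pdivrMr // ltr_pMr // ltr1n.
Qed.

Lemma dpol_max (g : {set V} -> R) x n b : unif n g -> (forall e, 0 <= g e) -> nneg x -> tot x = 1 ->
  (forall y : V -> R, nneg y -> tot y = 1 -> pol g y <= pol g x) ->
  b \in supp x -> dpol g b x = n%:R * pol g x.
Proof.
move=> gn g0 x0 x1 xmax bs; rewrite -(euler _ gn) -[LHS]mul1r -x1 /tot mulr_suml.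
apply: eq_bigr => i _; have [->|xi] := eqVneq (x i) 0; first by rewrite !mul0r.
by congr (_ * _); apply/le_anti; rewrite !dpol_le_max // inE.
Qed.

End Multipliers.

Section StarLagrangian.
Variable R : realType.

Definition star_free t (V : finType) (E : {set {set V}}) := forall v, ~ has_matching t (link_set v E).

Lemma matching_stable_homogeneous k t c (V : finType) (E : {set {set V}}) (T : {set V}) (x : V -> R) :
  (0 < k)%N -> matching_stable k t c -> uniform k E -> (forall e, e \in E -> e \subset T) ->
  ~ has_matching t E -> nneg x -> supp x \subset T ->
  (lam R (k * t).-1 k - c) * tot x ^+ k < pol (ind E) x ->
  exists2 K : {set V}, K \subset T & #|K| = (k * t).-1 /\ complete_on k E K.
Proof.
move=> k0 H Ek ET nm x0 xT lt; have t0 : 0 <= tot x by apply: sumr_ge0.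
have uE : unif k (ind E : _ -> R) by exact: unif_ind.
have [tx|tx] := eqVneq (tot x) 0.
  have := pol_le_tot uE x0; rewrite tx expr0n gtn_eqF // mul0r => h.
  move: lt; rewrite tx expr0n gtn_eqF // mulr0 ltNge h // => e.
  by rewrite /ind lern1; case: (_ \in _).
pose y i := (tot x)^-1 * x i.
have y0 : nneg y by move=> i; rewrite mulr_ge0 ?invr_ge0.
have y1 : tot y = 1 by rewrite /tot -mulr_sumr mulVf.
have yT : supp y \subset T.
  by apply: subset_trans xT; apply/subsetP => i; rewrite !inE /y mulf_eq0 invr_eq0 (negbTE tx).
apply: (H V E T y) => //; rewrite (pol_scale _ _ uE) exprVn mulrC ltr_pdivlMr //.
by rewrite exprn_gt0 // lt_def tx.
Qed.

Lemma star_stable k t : (1 < k <= 3)%N -> (1 < t)%N -> exists2 c : R, 0 < c &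
  forall (V : finType) (E : {set {set V}}) (T : {set V}) (x : V -> R),
    uniform k.+1 E -> (forall e, e \in E -> e \subset T) -> star_free t E ->
    nneg x -> tot x = 1 -> lam R (k * t) k.+1 - c < pol (ind E) x ->
    exists2 K : {set V}, K \subset T & #|K| = (k * t)%N /\ complete_on k.+1 E K.
Proof.
move=> k13 t1; have /andP[k1 k3] := k13; set q := (k * t)%N.
have k0 : (0 < k)%N by exact: ltnW.
have t0 : (0 < t)%N by exact: ltnW.
have kq : (k < q)%N by rewrite /q -[ltnLHS]muln1 ltn_mul2l k0.
have q1 : (1 < q)%N by exact: ltn_trans kq.
have qR : 0 < q%:R :> R by rewrite ltr0n ltnW.
pose p : R := 1 - q%:R^-1.
have iq0 : 0 < q%:R^-1 :> R by rewrite invr_gt0.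
have p0 : 0 < p by rewrite subr_gt0 invf_lt1 // ltr1n.
set l := lam R q.-1 k.
have l0 : 0 < l by rewrite lam_gt0 // -ltnS prednK // ltnW.
have muE : k.+1%:R * lam R q k.+1 = l * p ^+ k by exact: lam_link.
set mu := l * p ^+ k in muE.
have mu0 : 0 < mu by rewrite mulr_gt0 // exprn_gt0.
have [cM cM0 HM] := matching_stableP R k13 t1.
pose c1 := Num.min cM l.
have c10 : 0 < c1 by rewrite lt_min cM0.
have c1M : c1 <= cM by rewrite ge_min lexx.
have c1l : 0 <= l - c1 by rewrite subr_ge0 ge_min lexx orbT.
(* Tolerance for the heaviest weight: from 1/q - d on, its link lives on mass at most p + d, which
   is small enough for [b1 < mu]; d < 1/q keeps [a0] positive. *)
pose d := Num.min (c1 * p ^+ k / (2 * (k%:R * l))) (q%:R^-1 / 2).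
have kl0 : 0 < k%:R * l by rewrite mulr_gt0 // ltr0n.
have pk0 : 0 < p ^+ k by rewrite exprn_gt0.
have c1p : 0 < c1 * p ^+ k by exact: mulr_gt0.
have kl2 : 0 < 2 * (k%:R * l) by exact: mulr_gt0.
have d0 : 0 < d by rewrite lt_min (divr_gt0 c1p kl2) divr_gt0.
have d_c1 : k%:R * l * d <= c1 * p ^+ k / 2.
  have : d <= c1 * p ^+ k / (2 * (k%:R * l)) by rewrite ge_min lexx.
  rewrite ler_pdivlMr // => h; rewrite ler_pdivlMr //; apply: le_trans h.
  by rewrite [k%:R * l * d]mulrC -mulrA [k%:R * l * 2]mulrC.
have d_q : d < q%:R^-1.
  apply: (@le_lt_trans _ _ (q%:R^-1 / 2)); first by rewrite ge_min lexx orbT.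
  by rewrite ltr_pdivrMr // ltr_pMr // ltr1n.
pose a0 := q%:R^-1 - d.
have a00 : 0 < a0 by rewrite subr_gt0.
(* Upper bounds for the derivative at the heaviest vertex: [b1] if its link contains no complete set
   of q - 1 vertices, [b2] and [b3] for the clique and the star value of [capped] when the heaviest
   weight is below [a0]. All are below [mu], the value that the multiplier condition nearly
   forces. *)
pose b1 := (l - c1) * (p + d) ^+ k.
pose b2 := 'C(q.-1, k)%:R * a0 ^+ k.
pose b3 := t.-1%:R * (q%:R^-1 * ((1 - 2 * q%:R^-1) ^+ k.-1 / (k.-1)`!%:R)) : R.
have b1_mu : b1 < mu.
  have pd : p + d <= 1 by rewrite /p -addrA gerDl addrC subr_le0 ltW.
  have le1 := exprD_le k (ltW p0) (ltW d0) pd.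
  apply: le_lt_trans (ler_wpM2l c1l le1) _.
  rewrite /mu mulrBl -subr_gt0 mulrDr.
  have -> : l * p ^+ k - (l * p ^+ k + l * (k%:R * d) - c1 * (p ^+ k + k%:R * d)) =
    c1 * p ^+ k - k%:R * l * d + c1 * (k%:R * d) by ring.
  rewrite ltr_wpDr ?mulr_ge0 ?(ltW c10) ?(ltW d0) // subr_gt0; apply: le_lt_trans d_c1 _.
  by rewrite ltr_pdivrMr // ltr_pMr ?ltr1n // mulr_gt0 // exprn_gt0.
have b2_mu : b2 < mu.
  have -> : mu = 'C(q.-1, k)%:R * q%:R^-1 ^+ k.
    have q1R : q.-1%:R != 0 :> R by rewrite pnatr_eq0 -lt0n -ltnS prednK // ltnW.
    have -> : mu = lam R q.-1 k * p ^+ k by [].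
    have -> : p = q.-1%:R / q%:R.
      have qE : q%:R = q.-1%:R + 1 :> R by rewrite natr1 prednK // ltnW.
      have qn0 : q%:R != 0 :> R by exact: lt0r_neq0.
      by apply: (canRL (mulfK qn0)); rewrite /p mulrBl mul1r mulVf // qE addrK.
    by rewrite /lam expr_div_n -mulrA mulKf ?expf_neq0 // exprVn.
  rewrite /b2 ltr_pM2l; last by rewrite ltr0n bin_gt0 -ltnS prednK // ltnW.
  by rewrite ltrXn2r -?lt0n ?nnegrE ?(ltW a00) ?(ltW iq0) // /a0 ltrBlDr ltrDl d0.
have b3_mu : b3 < mu by exact: star_gap.
pose b := Num.max b1 (Num.max b2 b3).
have b_mu : b < mu by rewrite !gt_max b1_mu b2_mu b3_mu.
have [c2 c20 HN] := near_complete R (k0 : (1 < k.+1)%N) kq.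
pose c := Num.min c2 (Num.min ((mu - b) / k.+1%:R) (lam R q k.+1)).
have k1R : 0 < k.+1%:R :> R by rewrite ltr0n.
have lam0 : 0 < lam R q k.+1 by apply: lam_gt0 => //; exact: ltn_trans q1.
have c0 : 0 < c by rewrite !lt_min c20 lam0 divr_gt0 // subr_gt0.
have c_c2 : c <= c2 by rewrite ge_min lexx.
have c_b : b <= k.+1%:R * (lam R q k.+1 - c).
  have : c <= (mu - b) / k.+1%:R by rewrite !ge_min lexx !orbT.
  by rewrite ler_pdivlMr // mulrBr muE lerBrDl -lerBrDr [c * _]mulrC.
exists c => // V E T x Ek ET sf x0 x1 lt_x.
have [v0 _] : exists v0 : V, true.
  case: (pickP (xpredT : pred V)) => [v0 _|no]; first by exists v0.
  by move/eqP: x1; rewrite /tot big_pred0 // eq_sym oner_eq0.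
have uE : unif k.+1 (ind E : _ -> R) by exact: unif_ind.
(* Only the existence of a complete set is claimed, so [x] may be replaced by a maximiser;
   symmetrising keeps it maximal and makes its support a core. *)
have [y [y0 y1 ymax]] := pol_max (ind E : _ -> R) v0.
have [z [z0 z1 _ le_yz cov]] := zykov E y0; rewrite y1 in z1.
have zmax (u : V -> R) : nneg u -> tot u = 1 -> pol (ind E) u <= pol (ind E) z.
  by move=> u0 u1; apply: le_trans le_yz; exact: ymax.
have lt_z : lam R q k.+1 - c < pol (ind E) z by apply: lt_le_trans lt_x _; exact: zmax.
have dz i : i \in supp z -> b < dpol (ind E) i z.
  move=> iz; rewrite (dpol_max uE (ind_ge0 R E) z0 z1 zmax iz).
  by apply: le_lt_trans c_b _; rewrite ltr_pM2l.
have [v _ vmax] := @Order.TotalTheory.arg_maxP _ _ _ v0 xpredT z isT.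
set w := z v in vmax; have w0 : 0 <= w by exact: z0.
have vz : v \in supp z.
  rewrite inE; apply/eqP => v00; have /eqP : tot z = 0.
    by rewrite /tot big1 // => i _; apply/le_anti; rewrite z0 andbT; apply: le_trans (vmax i isT) _; rewrite /w v00.
  by rewrite z1 oner_eq0.
pose E1 := restr E (supp z).
have Lv : link_set v E1 \subset link_set v E.
  by apply/subsetP => e; rewrite !inE => /and3P[-> ->].
have L_k : uniform k (link_set v E1) by apply: uniform_link => e; rewrite inE => /andP[/Ek].
have L_T e : e \in link_set v E1 -> e \subset supp z :\ v.
  by rewrite !inE subsetD1 => /and3P[-> _]; rewrite subUset => /andP[_ ->].
have L_nm : ~ has_matching t (link_set v E1) by move=> /(has_matching_sub Lv)/sf.
have zv0 : nneg (erase v z) by exact: erase_ge0.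
have zvT : supp (erase v z) \subset supp z :\ v by exact: supp_erase.
have zv1 : tot (erase v z) = 1 - w by rewrite tot_erase z1.
have w1 : 0 <= 1 - w by rewrite -zv1 sumr_ge0.
have L_pol : b < pol (ind (link_set v E1)) (erase v z).
  apply: lt_le_trans (dz v vz) _; rewrite dpol_indE (pol_erase (o := v)); last first.
    by move=> e; rewrite /ind pnatr_eq0 eqb0 negbK inE => /andP[].
  apply: pol_le_supp => // e ez; rewrite /ind ler_nat !inE.
  case: (v \in e) => //=; case: (v |: e \in E) => //=.
  rewrite subUset sub1set vz (subset_trans ez) // (subset_trans zvT) //.
  exact: subsetDl.
have [wa|wa] := leP a0 w; last first.
  suff : pol (ind (link_set v E1)) (erase v z) <= b by rewrite leNgt L_pol.
  have wq : w <= q%:R^-1 by apply: ltW; apply: lt_trans wa _; rewrite /a0 ltrBlDr ltrDl.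
  have k13' : (0 < k <= 3)%N by rewrite k0.
  have tE : t.-1.+1 = t by rewrite prednK.
  have := cappedP (t := t.-1) k13' L_k L_T.
  rewrite tE => /(_ R (erase v z) w L_nm zv0 zvT w0) H; apply: le_trans (H _ _) _.
  - by move=> i; rewrite /erase; case: ifP => // _; exact: vmax.
  - rewrite zv1 lerBrDl -[X in X + _]mul1r -mulrDl nat1r prednK; last exact: ltnW.
    by rewrite -ler_pdivlMl // mulr1.
  rewrite zv1 ge_max; apply/andP; split.
    rewrite !le_max; apply/orP; right; apply/orP; right.
    have k2 : (k.-1 <= 2)%N by move: k3; clear; lia.
    (* Doubling brings w (1 - 2 w)^(k - 1) into the form a (s - a)^(k - 1) with s = 1. *)
    have := @star_step R k.-1 (2 * w) (2 * q%:R^-1) 1 k2.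
    rewrite mulr_ge0 // ler_pM2l // wq prednK // => /(_ isT isT).
    have -> : k%:R * (2 * q%:R^-1) <= 1 :> R.
      by rewrite mulrA ler_pdivrMr // mul1r -natrM ler_nat leq_mul2l t1 orbT.
    move=> /(_ isT); rewrite -!mulrA ler_pM2l // => h.
    rewrite /star_value /b3 -!mulrA; apply: ler_wpM2l => //; rewrite !mulrA.
    rewrite ler_pM2r ?invr_gt0 ?ltr0n ?fact_gt0 //.
    by move: h; rewrite -addrA -opprD -mulr2n mulr_natl.
  rewrite !le_max; apply/orP; right; apply/orP; left.
  rewrite /clique_value -/q /b2; apply: ler_wpM2l => //.
  by rewrite lerXn2r ?nnegrE // ltW.
have HM1 : matching_stable k t c1.
  move=> V' E' T' x' u1 u2 u3 u4 u5 u6 u7; apply: (HM V' E' T' x') => //.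
  by apply: le_lt_trans u7; rewrite lerD2l lerN2.
have [|K KT [Kc cK]] := @matching_stable_homogeneous k t c1 V _ _ _ k0 HM1 L_k L_T L_nm zv0 zvT.
  apply: le_lt_trans L_pol; rewrite !le_max; apply/orP; left; rewrite zv1 /b1.
  apply: ler_wpM2l => //; rewrite lerXn2r ?nnegrE //.
    by rewrite addr_ge0 // ltW.
  by rewrite /p -addrA lerD2l lerNl opprD opprK.
(* Every vertex of the support shares an edge with [v]; that edge without [v] lies in the link, all
   of whose edges are inside [K]. *)
have TE : supp z = v |: K.
  apply/eqP; rewrite eqEsubset subUset sub1set vz; apply/andP; split; last first.
    by apply: subset_trans KT _; exact: subsetDl.
  apply/subsetP => u uz; rewrite !inE; have [//|uv] := eqVneq u v.
  have [e [eE ez ue ve]] := cov u v uz vz uv.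
  have eL : e :\ v \in link_set v E1 by rewrite !inE eqxx setD1K // eE.
  have nm' : ~ has_matching t.-1.+1 (link_set v E1) by rewrite prednK.
  have Kc' : #|K| = (k * t.-1.+1).-1 by rewrite prednK.
  have /subsetP := complete_absorbs cK Kc' k0 nm' eL (L_k _ eL).
  by apply; rewrite !inE uv.
have vK : v \notin K by move: KT; rewrite subsetD1 => /andP[].
have Tq : #|supp z| = q by rewrite TE cardsU1 vK Kc add1n prednK // ltnW.
have lt_z2 : lam R q k.+1 - c2 < pol (ind E) z.
  by apply: le_lt_trans lt_z; rewrite lerD2l lerN2.
have [|||_ cT] := HN V E (supp z) z Ek z0 z1; rewrite ?Tq //.
  apply: lt_le_trans lt_z2 _; apply: pol_le_supp => // e ez.
  rewrite /ind ler_nat inE ez; case: (boolP (e \in E)) => // /Ek ->.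
  by rewrite eqxx.
exists (supp z) => //; apply/subsetP => u uz.
have [||f [uf fz fk]] := @subset_between V [set u] (supp z) k.+1.
- by rewrite sub1set.
- by rewrite cards1 Tq.
by apply: (subsetP (ET f (cT _ fz fk))); rewrite (subsetP uf) ?set11.
Qed.

End StarLagrangian.

(** * Matchings and linear stars are admissible *)

Section Admissible.
Variables (R : realType) (t : nat).
Hypothesis t1 : (1 < t)%N.

Definition matching_free (V : finType) (E : {set {set V}}) := ~ has_matching t E.

Lemma kt_gt0 k : (0 < k)%N -> (0 < k * t)%N.
Proof. by move=> k0; rewrite muln_gt0 k0 ltnW. Qed.

(** [adm_pair] amounts to a perfect matching of k t vertices in which no block contains both [u] and
    [v]; [adm_edge] is absorption by a complete set. *)
Lemma matching_admissible k : (1 < k <= 3)%N -> admissible R matching_free k (k * t).-1.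
Proof.
move=> k13; have /andP[k1 _] := k13; have k0 : (0 < k)%N by exact: ltnW.
have tE : t.-1.+1 = t by rewrite prednK // ltnW.
split=> [V E X u v Xc uX vX uv h|V E C e a Cc cC eE ek eC _ _|].
- apply; apply: (separated_matching k0 t1 _ uX vX uv) => [|e eX ek uve].
    by rewrite Xc prednK ?kt_gt0.
  by rewrite inE h.
- move=> nm; case/negP: eC; rewrite /matching_free -tE in nm.
  apply: (complete_absorbs (k := k) (t := t.-1) _ _ k0 nm) => //; rewrite ?tE //.
    by move=> f fC fk; rewrite inE cC //= (subset_trans fC) // subsetUl.
  by rewrite inE eE subsetUr.
- have [c c0 H] := matching_stableP R k13 t1; exists c => // V E T x Ek ET nm _.
  exact: H.
Qed.

(** For [adm_pair] the star is centred at a third vertex [b], whose link contains a perfect matching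
    of the other vertices separating [u] from [v]. For [adm_edge] it is centred at the common vertex
    [a] of [C] and [e]. *)
Lemma star_admissible k : (1 < k <= 3)%N -> admissible R (@star_free t) k.+1 (k * t).
Proof.
move=> k13; have /andP[k1 _] := k13; have k0 : (0 < k)%N by exact: ltnW.
have tE : t.-1.+1 = t by rewrite prednK // ltnW.
have kt : (1 < k * t)%N by apply: leq_trans k1 _; rewrite leq_pmulr // ltnW.
split=> [V E X u v Xc uX vX uv h|V E C e a Cc cC eE ek eC aC ae|].
- have /card_gt0P[b] : (0 < #|X :\ u :\ v|)%N.
    move: Xc; rewrite (cardsD1 u) uX (cardsD1 v (X :\ u)) !inE eq_sym uv vX /=.
    by move: kt; clear; lia.
  rewrite !inE => /and3P[bv bu bX] /(_ b); apply.
  apply: (@separated_matching V t k _ (X :\ b) u v k0 t1); rewrite ?inE 1?eq_sym ?bv ?bu //=.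
  + by move: Xc; rewrite (cardsD1 b) bX add1n => -[].
  + by rewrite eq_sym.
  + move=> e; rewrite subsetD1 !inE => /andP[eX be] ek uve.
    have sX : b |: e \subset X by rewrite subUset sub1set bX.
    rewrite be sX h //; first by rewrite cardsU1 be ek.
    by rewrite !inE ![_ == b]eq_sym (negbTE bu) (negbTE bv).
- move=> /(_ a) nm; rewrite -tE in nm; case/negP: eC.
  have aCe : a |: (C :\ a) = C by rewrite setD1K.
  rewrite -(setD1K ae) subUset sub1set aC /=; apply: subset_trans (subsetDl C [set a]).
  apply: (complete_absorbs (k := k) (t := t.-1) _ _ k0 nm); rewrite ?tE.
  + move=> f; rewrite subsetD1 !inE => /andP[fC af] fk.
    have sC : a |: f \subset C by rewrite subUset sub1set aC.
    by rewrite af cC ?(subset_trans sC) ?subsetUl // cardsU1 af fk.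
  + by rewrite -Cc [in RHS](cardsD1 a) aC.
  + by rewrite !inE eqxx setD1K // eE subsetUr.
  + by move: ek; rewrite (cardsD1 a) ae add1n => -[].
- have [c c0 H] := star_stable R k13 t1; exists c => // V E T x Ek ET sf _ x0 _ x1.
  exact: H.
Qed.

End Admissible.

(** * Hypergraphs and their weak expansions *)

Section Hypergraphs.
Variable r : nat.

Lemma edges_uniform (V : finType) (H : hypergraph r V) : uniform r (edges H).
Proof. by case: H => E /= /forall_inP h e /h/eqP. Qed.

Lemma is_subgraph_trans (U V W : finType) (F : hypergraph r U) (G : hypergraph r V) (H : hypergraph r W) :
  is_subgraph F G -> is_subgraph G H -> is_subgraph F H.
Proof.
move=> [f fi fE] [g gi gE]; exists (g \o f); first exact: inj_comp.
by move=> e /fE/gE; rewrite imset_comp.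
Qed.

Lemma hfree_sub (F : hfamily r) (V W : finType) (G : hypergraph r V) (H : hypergraph r W) :
  is_subgraph G H -> hfree F H -> hfree F G.
Proof. by move=> GH fH U K /fH nK KG; apply: nK; exact: is_subgraph_trans GH. Qed.

Definition pullback_edges (V W : finType) (f : V -> W) (E : {set {set W}}) :=
  [set e : {set V} | f @: e \in E].

Lemma pullback_uniform (V W : finType) (f : V -> W) (E : {set {set W}}) :
  injective f -> uniform r E -> uniform_edges r (pullback_edges f E).
Proof. by move=> fi Er; apply/forall_inP => e; rewrite inE => /Er; rewrite card_imset // => ->. Qed.

Definition pullback (V W : finType) (f : V -> W) (fi : injective f) (H : hypergraph r W) : hypergraph r V :=
  Hypergraph (pullback_uniform fi (edges_uniform (H := H))).

Lemma pullback_sub (V W : finType) (f : V -> W) (fi : injective f) (H : hypergraph r W) :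
  is_subgraph (pullback fi H) H.
Proof. by exists f => // e; rewrite inE. Qed.

Lemma card_pullback (V W : finType) (f : V -> W) (fi : injective f) (H : hypergraph r W) :
  #|edges (pullback fi H)| = #|[set e in edges H | e \subset f @: [set: V]]|.
Proof.
rewrite -(card_imset _ (imset_inj fi)); apply: eq_card => e; rewrite inE.
apply/imsetP/andP => [[d]|[eH eV]]; first by rewrite inE => dH ->; rewrite imsetS.
have eE : e = f @: (f @^-1: e).
  apply/setP => w; apply/idP/imsetP => [we|[v]]; last by rewrite inE => ? ->.
  by have /imsetP[v _ wv] := subsetP eV w we; exists v; rewrite // inE -wv.
by exists (f @^-1: e); rewrite // inE -eE.
Qed.

Lemma ex_number_ge (F : hfamily r) (W : finType) (H : hypergraph r W) :
  hfree F H -> (#|edges H| <= ex_number #|W| F)%N.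
Proof.
move=> fH; have fi : injective (@enum_val W predT) by exact: enum_val_inj.
have -> : #|edges H| = #|edges (pullback fi H)|.
  rewrite card_pullback; apply: eq_card => e; rewrite inE; case: (e \in _) => //=.
  apply/esym/subsetP => w _; apply/imsetP; exists (enum_rank w); first by rewrite inE.
  by rewrite enum_rankK.
rewrite /ex_number; apply: (@leq_bigmax_cond _ _ (fun H : hypergraph r 'I_#|W| => #|edges H|)).
by apply/asboolP; apply: hfree_sub fH; exact: pullback_sub.
Qed.

(** Averaging over vertex deletions: an edge survives n + 1 - r of the n + 1 deletions, and each
    leaves an F-free hypergraph on n vertices. *)
Lemma ex_numberS (F : hfamily r) n : (ex_number n.+1 F * (n.+1 - r) <= n.+1 * ex_number n F)%N.
Proof.
have [->|n0] := posnP (ex_number n.+1 F); first by rewrite mul0n.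
have [H fH ->] : exists2 H : hypergraph r 'I_n.+1, hfree F H & ex_number n.+1 F = #|edges H|.
  move: n0; rewrite /ex_number; elim/big_ind: _ => // [a b IHa IHb|H /asboolP fH _].
    by rewrite /maxn; case: ifP.
  by exists H.
have Hv (v : 'I_n.+1) : (#|[set e in edges H | v \notin e]| <= ex_number n F)%N.
  have fi : injective (lift v) by exact: lift_inj.
  have := @ex_number_ge F _ (pullback fi H) (hfree_sub (pullback_sub fi H) fH).
  rewrite card_ord card_pullback; apply: leq_trans; apply: subset_leq_card.
  apply/subsetP => e; rewrite !inE => /andP[-> ve] /=; apply/subsetP => w we.
  have [w'|wv] := unliftP v w; first by move=> ->; apply: imset_f; rewrite inE.
  by rewrite -wv we in ve.
have <- : (\sum_(v : 'I_n.+1) #|[set e in edges H | v \notin e]| = #|edges H| * (n.+1 - r))%N.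
  under eq_bigr => v _ do rewrite -sum1_card big_mkcond.
  rewrite exchange_big -sum_nat_const [RHS]big_mkcond; apply: eq_bigr => e _ /=.
  under eq_bigr => v _ do rewrite inE.
  case: ifP => [eH|_]; last by rewrite big1.
  rewrite -big_mkcond sum1_card -(edges_uniform eH) -[X in (X - _)%N](card_ord n.+1).
  by rewrite -[#|e|]/#|e| -[e in RHS]setCK -cardsCs; apply: eq_card => v; rewrite !inE.
by apply: leq_trans (leq_sum _ (fun v _ => Hv v)) _; rewrite sum_nat_const card_ord.
Qed.

Lemma min_degree_le (V : finType) (H : hypergraph r V) v : (min_degree H <= vertex_degree H v)%N.
Proof.
rewrite /min_degree; have : v \in index_enum V by exact: mem_index_enum.
elim: (index_enum V) => // a s IH; rewrite inE big_cons geq_min.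
by case/predU1P => [->|/IH ->]; rewrite ?leqnn ?orbT.
Qed.

End Hypergraphs.

(** * Blowups of complete hypergraphs *)

Section TransversalBlowup.
Variables (r q : nat).

Definition blowup_edges (W : finType) (psi : W -> 'I_q) : {set {set W}} :=
  [set e : {set W} | (#|e| == r) && (#|psi @: e| == r)].

Lemma blowup_uniform (W : finType) (psi : W -> 'I_q) : uniform_edges r (blowup_edges psi).
Proof. by apply/forall_inP => e; rewrite inE => /andP[]. Qed.

Definition blowup (W : finType) (psi : W -> 'I_q) : hypergraph r W := Hypergraph (blowup_uniform psi).

Lemma blowupP (W : finType) (psi : W -> 'I_q) : blowups_complete r q _ (blowup psi).
Proof. by exists psi => e er; rewrite !inE er eqxx. Qed.

Lemma card_blowup m : ('C(q, r) * m.+1 ^ r <=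
  #|edges (blowup (@fst 'I_q 'I_m.+1))|)%N.
Proof.
(* An edge is coded by its set of parts and the vertices chosen there; requiring the function to be
   [ord0] off those parts makes the code unique. *)
pose P := [set p : {set 'I_q} * {ffun 'I_q -> 'I_m.+1} |
  (#|p.1| == r) && (p.2 \in pffun_on ord0 (mem p.1) predT)].
have <- : #|P| = ('C(q, r) * m.+1 ^ r)%N.
  rewrite -[X in 'C(X, r)](card_ord q) -card_draws -sum_nat_const -sum1_card.
  rewrite (eq_bigl (fun p : {set 'I_q} * {ffun 'I_q -> 'I_m.+1} => (p.1 \in [set A : {set 'I_q} | #|A| == r]) &&
    (p.2 \in pffun_on ord0 (mem p.1) predT))); last by move=> p; rewrite !inE.
  rewrite -(pair_big_dep _ (fun (A : {set 'I_q}) (f : {ffun _}) => f \in pffun_on ord0 (mem A) predT) (fun _ _ => 1%N)) /=.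
  apply: eq_bigr => A AP; have : A \in [set A : {set 'I_q} | #|A| == r] by exact: AP.
  rewrite inE => /eqP Ar.
  by rewrite sum1_card card_pffun_on Ar -[in RHS](card_ord m.+1).
pose g (p : {set 'I_q} * {ffun 'I_q -> 'I_m.+1}) := [set (a, p.2 a) | a in p.1].
have g1 p : fst @: g p = p.1.
  by rewrite -imset_comp -[RHS]imset_id.
have gi : {in P &, injective g}.
  move=> [A f] [B h]; rewrite !inE /= => /andP[_ /pffun_onP[fA _]] /andP[_ /pffun_onP[hB _]] gg.
  have AB : A = B by have := g1 (A, f); rewrite gg g1.
  subst B; congr (_, _); apply/ffunP => a; have [aA|aA] := boolP (a \in A).
    have : (a, f a) \in g (A, h) by rewrite -gg; apply: imset_f.
    by case/imsetP => b _ [-> ->].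
  have out (k : {ffun 'I_q -> 'I_m.+1}) : ord0.-support k \subset mem A -> k a = ord0.
    by move=> /subsetP/(_ a); rewrite unfold_in (negbTE aA) => ka; apply/eqP; apply: contraT => /ka.
  by rewrite !out.
rewrite -(card_in_imset gi); apply: subset_leq_card; apply/subsetP => e /imsetP[p pP ->].
move: pP; rewrite inE => /andP[pr _]; rewrite inE g1 pr andbT card_imset // => a b.
by case.
Qed.

End TransversalBlowup.

(** * Weak expansions in blowups and in cliques *)

Section Expansions.
Variables (r : nat) (U : finType) (F : hypergraph r U).

Definition embeds (V : finType) (E : {set {set V}}) :=
  exists2 i : U -> V, injective i & forall e, e \in edges F -> i @: e \in E.

(** Every pair of core vertices of a weak expansion lies in an edge, and edges map injectively to
    the [q] parts, so the q + 1 core vertices would need distinct parts. *)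
Lemma blowup_free q (W : finType) (H : hypergraph r W) : #|U| = q.+1 ->
  blowups_complete r q _ H -> hfree (weak_expansions F) H.
Proof.
move=> Uq [psi Hpsi] V G [i [S [ii SU GE _]]] [f fi fG].
have inj e : e \in edges G -> {in e &, injective (psi \o f)}.
  move=> eG; have fe := fG e eG; have fr := edges_uniform fe.
  apply/imset_injP; rewrite imset_comp; apply/eqP.
  have /Hpsi := fr => -[/(_ fe)]; rewrite inE => /eqP -> _.
  by rewrite -(edges_uniform eG).
have : injective (psi \o f \o i).
  move=> a b ab; apply/eqP/negPn/negP => nab; case/negP: (nab).
  suff [e [eG ae be]] : exists e, [/\ e \in edges G, i a \in e & i b \in e].
    by apply/eqP/ii; apply: (inj e eG).
  have pS : [set a; b] \subset [set: U] by exact: subsetT.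
  have [h|h] := boolP ([set a; b] \in shadow_graph F).
    move: h; rewrite inE => /andP[_ /exists_inP[e eF abe]].
    exists (i @: e); split; first by rewrite GE inE; apply/orP; left; exact: imset_f.
      by apply: imset_f; apply: (subsetP abe); rewrite !inE eqxx.
    by apply: imset_f; apply: (subsetP abe); rewrite !inE eqxx orbT.
  have pu : [set a; b] \in uncovered_pairs F by rewrite inE h inE cards2 nab.
  have [_ iS] := SU _ pu; exists (S [set a; b]).
  split; first by rewrite GE inE; apply/orP; right; exact: imset_f.
    by apply: (subsetP iS); apply: imset_f; rewrite !inE eqxx.
  by apply: (subsetP iS); apply: imset_f; rewrite !inE eqxx ?orbT.
by move=> /leq_card; rewrite card_ord Uq ltnn.
Qed.

(** A copy of [F] inside a clique extends to a weak expansion: any edge covering an uncovered pair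
    serves as its [S]. The host is cut down to the union [Y] of the copy and the chosen edges, as
    the definition permits no further vertices. *)
Lemma clique_expansion (W : finType) (H : hypergraph r W) (X : {set W}) :
  (forall a, exists2 e, e \in edges F & a \in e) ->
  hfree (weak_expansions F) H -> clique (edges H) X -> ~ embeds (restr (edges H) X).
Proof.
move=> cov fH cX [i ii iE].
have iX a : i a \in X.
  have [e eF ae] := cov a; have := iE e eF; rewrite inE => /andP[_ /subsetP].
  by apply; exact: imset_f.
pose S (p : {set U}) := odflt set0 [pick f in edges H | i @: p \subset f].
have SP p : p \in uncovered_pairs F -> S p \in edges H /\ i @: p \subset S p.
  rewrite inE => /andP[_]; rewrite inE => /cards2P[a [b [ab pE]]].
  rewrite /S; case: pickP => [f /andP[]//|no].
  have [|f [fH1 af bf]] := cX (i a) (i b) (iX a) (iX b); first by rewrite inj_eq.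
  by have := no f; rewrite fH1 pE imsetU !imset_set1 subUset !sub1set af bf.
pose Y : {set W} := i @: [set: U] :|: \bigcup_(p in uncovered_pairs F) S p.
pose D := [set i @: e | e : {set U} in edges F] :|: [set S p | p in uncovered_pairs F].
have DH e : e \in D -> e \in edges H.
  rewrite inE => /orP[/imsetP[d /iE]|/imsetP[p /SP[pH _] ->//]].
  by rewrite inE => /andP[dH _] ->.
have DY e : e \in D -> e \subset Y.
  rewrite inE => /orP[/imsetP[d _ ->]|/imsetP[p pF ->]].
    by apply: subsetU; rewrite imsetS ?subsetT.
  by apply: subsetU; rewrite (bigcup_sup p) // orbT.
have vi : injective (val : {w | w \in Y} -> W) by exact: val_inj.
have valK (e : {set W}) : e \subset Y -> (val : {w | w \in Y} -> W) @: (val @^-1: e) = e.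
  move=> eY; apply/setP => w; apply/imsetP/idP => [[v]|we]; first by rewrite inE => ? ->.
  have wY := subsetP eY w we.
  by exists (exist _ w wY) => //; rewrite inE.
have Du : uniform r D by move=> e /DH; exact: edges_uniform.
pose G : hypergraph r {w | w \in Y} := Hypergraph (pullback_uniform vi Du).
have iY a : i a \in Y by rewrite inE imset_f ?inE.
pose j a : {w | w \in Y} := exist _ (i a) (iY a).
have vj (e : {set U}) : val @: (j @: e) = i @: e.
  by rewrite -imset_comp; apply: eq_imset.
apply: (fH _ G); last first.
  by exists val => // e; rewrite inE => /DH.
exists j, (fun p => val @^-1: S p).
have SY p : p \in uncovered_pairs F -> S p \subset Y.
  by move=> pF; apply: DY; rewrite inE; apply/orP; right; exact: imset_f.
split.
- by move=> a b /(congr1 val)/ii.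
- move=> p pF; have [pH ip] := SP p pF; split.
    by rewrite -(edges_uniform pH) -[in RHS](valK _ (SY p pF)) card_imset.
  by apply/subsetP => _ /imsetP[a ap ->]; rewrite inE (subsetP ip) //; apply: imset_f.
- apply/setP => e; rewrite inE !in_setU; congr (_ || _).
    apply/imsetP/imsetP => -[d dF].
      by rewrite -vj => /(imset_inj vi) ->; exists d.
    by move=> ->; exists d; rewrite ?vj.
  apply/imsetP/imsetP => -[p pF].
    by move=> eS; exists p => //; apply: (imset_inj vi); rewrite valK ?SY.
  by move=> ->; exists p => //; rewrite valK ?SY.
- apply/setP => -[w wY]; rewrite [LHS]inE in_setU; apply/esym.
  have : w \in Y by []; rewrite in_setU => /orP [/imsetP[a _ wa]|/bigcupP[p pF wp]].
    by apply/orP; left; apply/imsetP; exists a => //; apply: val_inj.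
  by apply/orP; right; apply/bigcupP; exists p => //; rewrite inE.
Qed.

End Expansions.

(** * Lower bound for the Turan density *)

Section Density.
Variables (R : realType) (r q : nat) (F : hfamily r).
Hypotheses (q0 : (0 < q)%N)
  (qF : forall (W : finType) (H : hypergraph r W), blowups_complete r q W H -> hfree F H).

Let u n : R := (ex_number n F)%:R / 'C(n, r)%:R.

Lemma density_ratioS n : (r <= n)%N -> u n.+1 <= u n.
Proof.
move=> rn; have c0 : 0 < 'C(n, r)%:R :> R by rewrite ltr0n bin_gt0.
have c1 : 0 < 'C(n.+1, r)%:R :> R by rewrite ltr0n bin_gt0 leqW.
rewrite /u ler_pdivrMr // mulrAC ler_pdivlMr // -!natrM ler_nat.
rewrite -(leq_pmul2l (ltn0Sn n)) mulnCA -[X in (_ * (X * _))%N]/n.+1.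
have := mul_bin_down n.+1 r; rewrite /= => ->.
by rewrite mulnA [leqRHS]mulnA leq_mul2r ex_numberS orbT.
Qed.

(** The ratio does not increase, so it is at least its value at N = q (n + 1), where the balanced
    blowup with parts of size n + 1 is F-free. *)
Lemma density_ratio_ge n : (r <= n)%N -> r`!%:R * lam R q r <= u n.
Proof.
move=> rn; have mono k : u (n + k) <= u n.
  elim: k => [|k IH]; first by rewrite addn0.
  by rewrite addnS; apply: le_trans IH; apply: density_ratioS; rewrite (leq_trans rn) ?leq_addr.
set N := (q * n.+1)%N; have nN : (n <= N)%N.
  by apply: leq_trans (leq_pmull _ q0); exact: leqnSn.
apply: le_trans (_ : u N <= _); last by rewrite -(subnKC nN).
have N0 : 0 < 'C(N, r)%:R :> R by rewrite ltr0n bin_gt0 (leq_trans rn).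
rewrite /u ler_pdivlMr // /lam.
apply: le_trans (_ : 'C(q, r)%:R * n.+1%:R ^+ r <= _); last first.
  rewrite -natrX -natrM ler_nat; apply: leq_trans (card_blowup r q n) _.
  have := @ex_number_ge r F _ (blowup r (@fst 'I_q 'I_n.+1)) (qF (blowupP _ _)).
  by rewrite card_prod !card_ord.
have qr0 : 0 < q%:R ^+ r :> R by rewrite exprn_gt0 // ltr0n.
rewrite [r`!%:R * _]mulrC -mulrA -natrM [(r`! * _)%N]mulnC bin_ffact mulrAC ler_pdivrMr //.
rewrite -mulrA ler_wpM2l // -exprMn -natrM mulnC -natrX ler_nat.
exact: ffact_leq_exp.
Qed.

(** Monotonicity is available from [r] on, where the binomial coefficient is positive, so
    convergence is proved for the sequence shifted by [r]. *)
Lemma turan_density_ge : r`!%:R * lam R q r <= turan_density R F.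
Proof.
pose v n := u (n + r); have vc : cvgn v.
  apply: nonincreasing_is_cvgn.
    by apply/nonincreasing_seqP => n; rewrite /v addSn density_ratioS // leq_addl.
  by exists 0 => _ [n _ <-]; rewrite divr_ge0.
have uc : cvgn u by move: vc; rewrite /v => /cvg_ex[l vl]; apply/cvg_ex; exists l; rewrite -(cvg_shiftn r).
apply: limr_ge => //; exists r => // n /= rn; exact: density_ratio_ge.
Qed.

End Density.

Section DegreeStable.
Variables (R : realType) (s q : nat) (U : finType) (F : hypergraph s.+2 U) (Ff : forbids).
Hypotheses (adm : admissible R Ff s.+2 q) (sq : (s.+2 < q)%N) (Uq : #|U| = q.+1).
Hypothesis cov : forall a, exists2 e, e \in edges F & a \in e.
Hypothesis free : forall (V : finType) (E : {set {set V}}), uniform s.+2 E -> ~ embeds F E -> Ff E.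

Theorem weak_expansions_degree_stable :
  degree_stable R (weak_expansions F) (blowups_complete s.+2 q).
Proof.
have q0 : (0 < q)%N by exact: leq_trans sq.
have blow (W : finType) (H : hypergraph s.+2 W) :
  blowups_complete s.+2 q W H -> hfree (weak_expansions F) H by exact: blowup_free.
split=> //; have [eps [n0 [eps0 stab]]] := degree_stability adm sq.
exists eps, n0; split=> // V H Vn fH; rewrite subn1 /= => deg.
have [||v|phi phiP] := stab V (edges H) Vn.
- exact: edges_uniform.
- move=> X cX; apply: free; last exact: clique_expansion fH cX.
  by move=> e; rewrite inE => /andP[/edges_uniform].
- apply: (@le_trans _ _ (min_degree H)%:R); last by rewrite ler_nat min_degree_le.
  apply: le_trans deg; rewrite ler_wpM2r ?exprn_ge0 // lerD2r.
  rewrite ler_pdivlMr ?ltr0n ?fact_gt0 //; apply: le_trans (turan_density_ge R q0 blow).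
  by rewrite mulrAC -natrM -factS.
exists V, (blowup s.+2 phi); split; first exact: blowupP.
exists id => // e eH; rewrite imset_id inE (edges_uniform eH) eqxx /=.
by rewrite card_in_imset ?(edges_uniform eH) //; apply: phiP; rewrite ?subsetT.
Qed.

End DegreeStable.

(** * The three families *)

Section Instances.
Variables (r t : nat).

Lemma blocks_embedding (V : finType) (M : 'I_t -> {set V}) : (forall a, #|M a| = r) ->
  (forall a b, a != b -> [disjoint M a & M b]) ->
  exists2 i : 'I_t * 'I_r -> V, injective i & forall a, [set i (a, j) | j : 'I_r] = M a.
Proof.
move=> Mr Md; pose i p := enum_val (cast_ord (esym (Mr p.1)) p.2).
have iM a j : i (a, j) \in M a by exact: enum_valP.
have inj a : injective (fun j => i (a, j)).
  by move=> j k /enum_val_inj/(congr1 val) /= jk; apply: val_inj.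
exists i => [[a j] [b k] ij|a].
  have ab : a = b.
    apply/eqP/negPn/negP => /Md d; have := iM b k.
    by rewrite -ij (disjointFr d (iM a j)).
  by subst b; rewrite (inj a j k).
apply/eqP; rewrite eqEcard card_imset // card_ord Mr leqnn andbT.
by apply/fintype.subsetP => x /imsetP[j _ ->].
Qed.

Lemma matching_embeds (V : finType) (E : {set {set V}}) : uniform r E ->
  ~ embeds (matching r t) E -> matching_free t E.
Proof.
move=> Er nE [M [ME Md]]; apply: nE.
have [i ii iM] := blocks_embedding (fun a => Er _ (ME a)) Md.
exists i => // _ /imsetP[a _ ->]; rewrite -imset_comp.
by have := ME a; rewrite -iM.
Qed.

Lemma linear_star_embeds (V : finType) (E : {set {set V}}) : uniform r.+1 E ->
  ~ embeds (linear_star r t) E -> star_free t E.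
Proof.
move=> Er nE v [M [ME Md]]; apply: nE.
have Lr := uniform_link (o := v) Er.
have [i ii iM] := blocks_embedding (fun a => Lr _ (ME a)) Md.
have iv p : i p != v.
  case: p => a j; have := ME a; rewrite inE => /andP[va _].
  by apply: contraNneq va => <-; rewrite -iM; apply: imset_f.
exists (fun o => if o is Some p then i p else v) => [|_ /imsetP[a _ ->]].
  move=> [p|] [p'|] // => [/ii -> //|/eqP|/esym/eqP]; by rewrite (negbTE (iv _)).
have := ME a; rewrite inE -iM => /andP[_].
by rewrite imsetU1 -imset_comp.
Qed.

Lemma matching_cover a : exists2 e, e \in edges (matching r t) & a \in e.
Proof.
by case: a => a j; exists [set (a, j) | j : 'I_r]; exact: imset_f.
Qed.

Lemma linear_star_cover a : (0 < t)%N -> exists2 e, e \in edges (linear_star r t) & a \in e.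
Proof.
move=> t0; pose E (b : 'I_t) := None |: [set Some (b, j) | j : 'I_r].
case: a => [[b j]|]; [exists (E b)|exists (E (Ordinal t0))];
  rewrite ?inE ?imset_f ?orbT //.
Qed.

End Instances.

Theorem corollary1p13 (R : realType) (t : nat) (ht : (2 <= t)%N) :
  degree_stable R (weak_expansions (matching 3 t)) (blowups_complete 3 (3 * t - 1))
  /\ degree_stable R (weak_expansions (linear_star 2 t : hypergraph 3 _))
       (blowups_complete 3 (2 * t))
  /\ degree_stable R (weak_expansions (linear_star 3 t : hypergraph 4 _))
       (blowups_complete 4 (3 * t)).
Proof.
have t0 : (0 < t)%N by exact: ltnW.
split; [|split].
- rewrite subn1; apply: (@weak_expansions_degree_stable R 1 _ _ _ _ (matching_admissible R ht _)) => //.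
  + by move: ht; clear; lia.
  + by rewrite card_prod !card_ord mulnC prednK // muln_gt0.
  + exact: matching_cover.
  + exact: matching_embeds.
- apply: (@weak_expansions_degree_stable R 1 _ _ _ _ (star_admissible R ht _)) => //.
  + by move: ht; clear; lia.
  + by rewrite card_option card_prod !card_ord mulnC.
  + by move=> a; exact: linear_star_cover.
  + exact: linear_star_embeds.
- apply: (@weak_expansions_degree_stable R 2 _ _ _ _ (star_admissible R ht _)) => //.
  + by move: ht; clear; lia.
  + by rewrite card_option card_prod !card_ord mulnC.
  + by move=> a; exact: linear_star_cover.
  + exact: linear_star_embeds.
Qed.
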